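(* Let $M$ be a positive integer. For $\heartsuit\in\{\mathrm{I},\mathrm{III}\}$ let $P_{\mathrm I}=\{(k_1,k_2)\in\mathbf Z^2:k_1,k_2\ge0,\ 2k_1+k_2\le M-1\}$ and $P_{\mathrm{III}}=\{(k_1,k_2)\in\mathbf Z^2:k_1\ge0,\ k_2\ge1,\ 2k_1+k_2\le M-1\}$, and let $\ddot H(\Lambda^{(M)[K(1),0](\heartsuit)}_{k_1,k_2})$, $(k_1,k_2)\in P_\heartsuit$, be the N=4 superconformal modules described in the context. Then: 1) the $\mathbf C$-linear span of $$\bigcup_{\heartsuit=\mathrm I,\mathrm{III}}\Big\{\mathrm{ch}^{(+)}_{\ddot H(\Lambda^{(M)[K(1),0](\heartsuit)}_{k_1,k_2})}(\tau,z),\ \mathrm{ch}^{(-)}_{\ddot H(\Lambda^{(M)[K(1),0](\heartsuit)}_{k_1,k_2})}(\tau,z),\ \mathrm{ch}^{(+)\mathrm{tw}}_{\ddot H(\Lambda^{(M)[K(1),0](\heartsuit)}_{k_1,k_2})}(\tau,z)\ :\ (k_1,k_2)\in P_\heartsuit\Big\}$$ is $SL_2(\mathbf Z)$-invariant; 2) the $\mathbf C$-linear span of $$\bigcup_{\heartsuit=\mathrm I,\mathrm{III}}\Big\{\mathrm{ch}^{(-)\mathrm{tw}}_{\ddot H(\Lambda^{(M)[K(1),0](\heartsuit)}_{k_1,k_2})}(\tau,z)\ :\ (k_1,k_2)\in P_\heartsuit\Big\}$$ is $SL_2(\mathbf Z)$-invariant. Here $SL_2(\mathbf Z)$ acts on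 meromorphic functions $f(\tau,z)$ by $$\Big(f\big|\begin{pmatrix}a&b\\c&d\end{pmatrix}\Big)(\tau,z)=\exp\Big(-2\pi i\,\frac{1-M}{M}\cdot\frac{cz^2}{c\tau+d}\Big)f\Big(\frac{a\tau+b}{c\tau+d},\frac z{c\tau+d}\Big).$$
   Context: Notation: $\mathrm{Im}\,\tau>0$, $q=e^{2\pi i\tau}$; $\vartheta_{ab}(\tau,z)=\sum_{n\in\mathbf Z}e^{\pi i(n+\frac a2)^2\tau+2\pi i(n+\frac a2)(z+\frac b2)}$; $\eta(\tau)=q^{1/24}\prod_{n\ge1}(1-q^n)$. For $m\in\frac12\mathbf Z_{>0}$, $s\in\frac12\mathbf Z$, $$\Phi^{(A(1|1))[m,s]}(\tau,z_1,z_2,t)=e^{-2\pi imt}\sum_{j\in\mathbf Z}\Big(\frac{e^{2\pi imj(z_1+z_2)+2\pi isz_1}q^{mj^2+sj}}{(1-e^{2\pi iz_1}q^j)^2}-\frac{e^{-2\pi imj(z_1+z_2)-2\pi isz_2}q^{mj^2+sj}}{(1-e^{-2\pi iz_2}q^j)^2}\Big).$$ Modules: let $\widehat A(1,1)$ be the affine Lie superalgebra of $sl(2|2)/\mathbf CI$, with simple roots $\alpha_0,\alpha_1,\alpha_2,\alpha_3$ ($\alpha_1,\alpha_3$ odd). For $m_2\in\{0,1\}$, $\Lambda^{(M)[K(1),m_2](\heartsuit)}_{k_1,k_2}$ denotes the principal admissible weight of level $-\frac1M$ associated with the simple subset $\Pi^{(M),(\mathrm I)}_{k_1,k_2}=\{k_0\delta+\alpha_0,k_1\delta+\alpha_1,k_2\delta+\alpha_2,k_1\delta+\alpha_3\}$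 (for $\heartsuit=\mathrm I$), resp. $\Pi^{(M),(\mathrm{III})}_{k_1,k_2}=\{k_0\delta+\alpha_0,k_1\delta+\alpha_1+\alpha_2,k_2\delta-\alpha_2,k_1\delta+\alpha_2+\alpha_3\}$ (for $\heartsuit=\mathrm{III}$), where $k_0+2k_1+k_2+1=M$, and the integrable weight $-\Lambda_0-\frac{m_2}2(\alpha_1+\alpha_3)$. $L(\lambda)$ is the irreducible highest weight module, $H(\lambda)$ the N=4 superconformal module obtained from it by quantum Hamiltonian reduction (for $f=e_{-\theta}$, $\theta=\alpha_1+\alpha_2+\alpha_3$), $H^{\mathrm{tw}}(\lambda)$ its Ramond twisted version for the twist $w_0=r_{\alpha_2}t_{\frac12\alpha_2}$; the central charge is $6(\frac1M-1)$. Set $\ddot H(\Lambda^{(M)[K(1),0](\heartsuit)}_{k_1,k_2})=H(\Lambda^{(M)[K(1),0](\heartsuit)}_{k_1,k_2})\oplus H(\Lambda^{(M)[K(1),1](\heartsuit)}_{k_1,k_2})$, the two highest weight vectors having opposite parity, and similarly in the twisted case, so that $$\mathrm{ch}^{(\pm)}_{\ddot H(\Lambda^{(M)[K(1),0](\heartsuit)}_{k_1,k_2})}=\mathrm{ch}^{(\pm)}_{H(\Lambda^{(M)[K(1),0](\heartsuit)}_{k_1,k_2})}\pm\mathrm{ch}^{(\pm)}_{H(\Lambda^{(M)[K(1),1](\heartsuit)}_{k_1,k_2})},$$ and likewise with $\mathrm{tw}$. Characters: these are the functions determined as follows. Put $(\sigma_+,a_+)=((-1)^{m_2+1},\frac12)$,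 $(\sigma_-,a_-)=(1,0)$ and $\Phi=\Phi^{(A(1|1))[1,m_2+1]}$. With denominators $$\overset{N=4}{R}{}^{(+)}=-i\eta(\tau)^3\frac{\vartheta_{11}(\tau,2z)}{\vartheta_{00}(\tau,z)^2},\quad \overset{N=4}{R}{}^{(-)}=i\eta(\tau)^3\frac{\vartheta_{11}(\tau,2z)}{\vartheta_{01}(\tau,z)^2},\quad \overset{N=4}{R}{}^{(+)\mathrm{tw}}=-i\eta(\tau)^3\frac{\vartheta_{11}(\tau,2z)}{\vartheta_{10}(\tau,z)^2},\quad \overset{N=4}{R}{}^{(-)\mathrm{tw}}=i\eta(\tau)^3\frac{\vartheta_{11}(\tau,2z)}{\vartheta_{11}(\tau,z)^2},$$ one has, for $\lambda=\Lambda^{(M)[K(1),m_2](\heartsuit)}_{k_1,k_2}$: - $\heartsuit=\mathrm I$: $\overset{N=4}{R}{}^{(\pm)}\mathrm{ch}^{(\pm)}_{H(\lambda)}(\tau,z)=\sigma_\pm e^{-\frac{2\pi i}Mk_2z}q^{-\frac1M(k_1+\frac12)(k_1+k_2+\frac12)}\Phi(M\tau,z+(k_1+\frac12)\tau+a_\pm,z-(k_1+k_2+\frac12)\tau+a_\pm,0)$; - $\heartsuit=\mathrm{III}$: $\overset{N=4}{R}{}^{(\pm)}\mathrm{ch}^{(\pm)}_{H(\lambda)}(\tau,z)=\sigma_\pm e^{\frac{2\pi i}Mk_2z}q^{-\frac1M(k_1+\frac12)(k_1+k_2+\frac12)}\Phi(M\tau,-z+(k_1+\frac12)\tau+a_\pm,-z-(k_1+k_2+\frac12)\tau+a_\pm,0)$;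 - $\heartsuit=\mathrm I$: $\overset{N=4}{R}{}^{(\pm)\mathrm{tw}}\mathrm{ch}^{(\pm)\mathrm{tw}}_{H(\lambda)}(\tau,z)=\sigma_\pm e^{\frac{2\pi i}M(k_2+1)z}q^{-\frac1Mk_1(k_1+k_2+1)}\Phi(M\tau,-z+k_1\tau+a_\pm,-z-(k_1+k_2+1)\tau+a_\pm,0)$; - $\heartsuit=\mathrm{III}$: $\overset{N=4}{R}{}^{(\pm)\mathrm{tw}}\mathrm{ch}^{(\pm)\mathrm{tw}}_{H(\lambda)}(\tau,z)=\sigma_\pm e^{-\frac{2\pi i}M(k_2-1)z}q^{-\frac1M(k_1+1)(k_1+k_2)}\Phi(M\tau,z+(k_1+1)\tau+a_\pm,z-(k_1+k_2)\tau+a_\pm,0)$. *)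

(* Defs.v *)
From Stdlib Require Export Reals ZArith List.
From Coquelicot Require Export Coquelicot.
Local Open Scope C_scope.

Definition Cexp (z : C) : C := RtoC (exp (Re z)) * (cos (Im z), sin (Im z)).

(* [expi x] is e^{2 pi i x}, so that q^x = expi (x * tau), also for
   fractional x. *)
Definition expi (x : C) : C := Cexp (RtoC 2 * RtoC PI * Ci * x).

(* Limits of complex sequences, taken on real and imaginary parts; as with
   [Lim_seq], the value is meaningful only for convergent sequences. *)
Definition CLim_seq (u : nat -> C) : C :=
  (real (Lim_seq (fun n => Re (u n))), real (Lim_seq (fun n => Im (u n)))).

Definition CSeries (u : nat -> C) : C := CLim_seq (fun n => sum_n u n).

(* The sum over Z is the sum over j >= 0 plus the sum over j = -1-n <= -1. *)
Definition CSeriesZ (u : Z -> C) : C :=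
  CSeries (fun n => u (Z.of_nat n)) + CSeries (fun n => u (- 1 - Z.of_nat n)%Z).

Fixpoint Cprod (u : nat -> C) (n : nat) : C :=
  match n with
  | O => RtoC 1
  | S n' => Cprod u n' * u n
  end.

Definition ZtoC (n : Z) : C := RtoC (IZR n).

Definition theta (a b : Z) (tau z : C) : C :=
  CSeriesZ (fun n =>
    let n' := ZtoC n + ZtoC a / RtoC 2 in
    Cexp (RtoC PI * Ci * (n' * n') * tau
          + RtoC 2 * RtoC PI * Ci * n' * (z + ZtoC b / RtoC 2))).

Definition eta (tau : C) : C :=
  expi (tau / RtoC 24)
  * CLim_seq (Cprod (fun n => RtoC 1 - expi (RtoC (INR n) * tau))).

(* Phi^{(A(1|1))[m,s]}(tau, z1, z2, t). *)
Definition Phi (m s : R) (tau z1 z2 t : C) : C :=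
  expi (- (RtoC m * t)) *
  CSeriesZ (fun n =>
    let j := ZtoC n in
    expi (RtoC m * j * (z1 + z2) + RtoC s * z1)
      * expi ((RtoC m * (j * j) + RtoC s * j) * tau)
      / (RtoC 1 - expi z1 * expi (j * tau)) ^ 2
    - expi (- (RtoC m * j * (z1 + z2)) - RtoC s * z2)
      * expi ((RtoC m * (j * j) + RtoC s * j) * tau)
      / (RtoC 1 - expi (- z2) * expi (j * tau)) ^ 2).

(* The type of the simple subset Pi^{(M)}_{k1,k2}. *)
Inductive heart := TypeI | TypeIII.

(* [Plus] is the character, [Minus] the supercharacter. *)
Inductive sign := Plus | Minus.

(* [Tw] is the Ramond twisted sector. *)
Inductive sector := Untw | Tw.

Definition sgnC (e : sign) : C :=
  match e with Plus => RtoC 1 | Minus => RtoC (- 1) end.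

Definition sigma (e : sign) (m2 : nat) : C :=
  match e with Plus => RtoC (- 1) ^ (m2 + 1) | Minus => RtoC 1 end.

Definition shift (e : sign) : C :=
  match e with Plus => RtoC (1 / 2) | Minus => RtoC 0 end.

(* The N=4 denominators R^{(+)}, R^{(-)}, R^{(+)tw}, R^{(-)tw}. *)
Definition denom (x : sector) (e : sign) (tau z : C) : C :=
  match x, e with
  | Untw, Plus =>
      - Ci * eta tau ^ 3 * theta 1 1 tau (RtoC 2 * z) / theta 0 0 tau z ^ 2
  | Untw, Minus =>
      Ci * eta tau ^ 3 * theta 1 1 tau (RtoC 2 * z) / theta 0 1 tau z ^ 2
  | Tw, Plus =>
      - Ci * eta tau ^ 3 * theta 1 1 tau (RtoC 2 * z) / theta 1 0 tau z ^ 2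
  | Tw, Minus =>
      Ci * eta tau ^ 3 * theta 1 1 tau (RtoC 2 * z) / theta 1 1 tau z ^ 2
  end.

(* The product of the N=4 denominator with the (twisted) (super)character of
   H(Lambda^{(M)[K(1),m2](h)}_{k1,k2}). *)
Definition numer (x : sector) (e : sign) (h : heart) (M : Z) (m2 : nat)
    (k1 k2 : Z) (tau z : C) : C :=
  let MM := ZtoC M in
  let K1 := ZtoC k1 in
  let K2 := ZtoC k2 in
  let half := RtoC (1 / 2) in
  let a := shift e in
  let F z1 z2 := Phi 1 (INR (m2 + 1)) (MM * tau) z1 z2 (RtoC 0) in
  sigma e m2 *
  match x, h with
  | Untw, TypeI =>
      expi (- (K2 * z / MM))
      * expi (- ((K1 + half) * (K1 + K2 + half) / MM) * tau)
      * F (z + (K1 + half) * tau + a) (z - (K1 + K2 + half) * tau + a)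
  | Untw, TypeIII =>
      expi (K2 * z / MM)
      * expi (- ((K1 + half) * (K1 + K2 + half) / MM) * tau)
      * F (- z + (K1 + half) * tau + a) (- z - (K1 + K2 + half) * tau + a)
  | Tw, TypeI =>
      expi ((K2 + RtoC 1) * z / MM)
      * expi (- (K1 * (K1 + K2 + RtoC 1) / MM) * tau)
      * F (- z + K1 * tau + a) (- z - (K1 + K2 + RtoC 1) * tau + a)
  | Tw, TypeIII =>
      expi (- ((K2 - RtoC 1) * z / MM))
      * expi (- ((K1 + RtoC 1) * (K1 + K2) / MM) * tau)
      * F (z + (K1 + RtoC 1) * tau + a) (z - (K1 + K2) * tau + a)
  end.

Definition ch_H (x : sector) (e : sign) (h : heart) (M : Z) (m2 : nat)
    (k1 k2 : Z) (tau z : C) : C :=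
  numer x e h M m2 k1 k2 tau z / denom x e tau z.

(* The highest weight vectors of the two summands of ddot H have opposite
   parity, whence the sign in the supercharacter. *)
Definition ch_ddotH (x : sector) (e : sign) (h : heart) (M k1 k2 : Z)
    (tau z : C) : C :=
  ch_H x e h M 0 k1 k2 tau z + sgnC e * ch_H x e h M 1 k1 k2 tau z.

Definition index_set (h : heart) (M k1 k2 : Z) : Prop :=
  match h with
  | TypeI => (0 <= k1 /\ 0 <= k2 /\ 2 * k1 + k2 <= M - 1)%Z
  | TypeIII => (0 <= k1 /\ 1 <= k2 /\ 2 * k1 + k2 <= M - 1)%Z
  end.

(* A meromorphic function on {Im tau > 0} x C is represented by a total
   function whose values on its polar divisor are irrelevant.  All poles of
   the characters above and all zeros and poles of the denominators lie on the
   divisor 2 z \in Z + Z tau, which is stable under SL_2(Z); so these functions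
   are holomorphic on the dense open set [regular], and two of them are equal
   as meromorphic functions iff they coincide there. *)
Definition regular (tau z : C) : Prop :=
  (0 < Im tau)%R /\
  forall m n : Z, RtoC 2 * z <> ZtoC m + ZtoC n * tau.

Definition mero_eq (f g : C -> C -> C) : Prop :=
  forall tau z : C, regular tau z -> f tau z = g tau z.

Definition lin_comb (l : list (C * (C -> C -> C))) (tau z : C) : C :=
  fold_right (fun p acc => fst p * snd p tau z + acc) (RtoC 0) l.

Definition in_span (S : (C -> C -> C) -> Prop) (f : C -> C -> C) : Prop :=
  exists l : list (C * (C -> C -> C)),
    List.Forall (fun p => S (snd p)) l /\ mero_eq f (lin_comb l).

(* The action f | (a b; c d). *)
Definition slash (M : Z) (f : C -> C -> C) (a b c d : Z) (tau z : C) : C :=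
  let j := ZtoC c * tau + ZtoC d in
  expi (- (ZtoC (1 - M) / ZtoC M * (ZtoC c * z ^ 2 / j)))
  * f ((ZtoC a * tau + ZtoC b) / j) (z / j).

Definition SL2Z_invariant_span (M : Z) (S : (C -> C -> C) -> Prop) : Prop :=
  forall f : C -> C -> C, in_span S f ->
  forall a b c d : Z, (a * d - b * c = 1)%Z ->
  in_span S (slash M f a b c d).

(* Main.v *)
Require Import Defs.
From Stdlib Require Import Lra Lia Psatz.
Local Open Scope C_scope.

(* Write e(x) = exp(2 pi i x). The difference Phi^{[1,1]} - Phi^{[1,2]} is
   the Kronecker function
     Psi(tau, u, v) = (q)_oo^3 theta(u + v) / (theta(u) theta(v)),
   so every character of the modules ddot H is, up to a constant, a quotient
   N_{i,j}^{(M)} / N_{0,0}^{(1)} of two values of Psi, the index (i, j) being taken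
   modulo M and up to symmetry: the denominators are the numerators for M = 1.
   The product formula for Psi is the limit of a finite partial fraction
   identity. It yields the quasi-periodicity of Psi and its continuity in u, v.
   The map T : tau -> tau + n permutes the functions N_{i,j} up to constants
   and characteristics. For S, the Lambert series
     Psi = sum_n e(n v) / (1 - e(u + n tau))
   and the Mittag-Leffler expansion of its terms show that Psi is a conditionally
   convergent lattice sum of e(n r - m s) / (u + m + n tau), v = s tau + r; after
   two summations by parts it converges absolutely, the order of summation can
   be exchanged, and Psi(-1/tau, u/tau, v/tau) = tau e(u v / tau) Psi(tau, u, v).
   Splitting the Lambert series modulo M expresses Psi(tau/M, u/M, v/M) as a
   combination of the values Psi(M tau, u + d tau, v + c tau), and therefore S maps
   N_{i,j} to a combination of all the N_{d,c}. *)

(** * Limits and bilateral series *)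

(** Only limits of sequences are used: no contour integral, identity theorem or Liouville argument.
    Each infinite identity is the limit of a finite one (partial fractions, the q-binomial theorem,
    Fourier inversion on Z/(2K+1)), and the passage to the limit is dominated convergence with a
    majorant given by telescoping tails. Identities first obtained for v in a strip, or for generic
    z, are extended by quasi-periodicity and by continuity. The obstacle for S is that 1/|l| is far
    from summable over a lattice, where a decay faster than |l|^(-2) is required; one difference in
    each direction yields |l|^(-3). These differences cost only the factors 1 - e(-s) and 1 - e(r),
    which vanish for integral s, r alone. The two spans of the theorem reflect the orbits of the
    modular group on the characteristics (p, e) mod 2: S exchanges p and e, and tau -> tau + n adds
    p n to e. So (1,1), (1,0), (0,1) form one orbit and (0,0) is fixed. *)

Lemma C_ext (z w : C) : Re z = Re w -> Im z = Im w -> z = w.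
Proof. destruct z, w; simpl; intros -> ->; reflexivity. Qed.

(** Componentwise like [CLim_seq], but a relation: it asserts convergence, whereas [CLim_seq] also
    returns a value on divergent sequences. *)
Definition Clim (u : nat -> C) (l : C) : Prop :=
  is_lim_seq (fun n => Re (u n)) (Re l) /\ is_lim_seq (fun n => Im (u n)) (Im l).

Lemma Clim_ext_loc (u v : nat -> C) (l : C) :
  (exists N, forall n, (N <= n)%nat -> u n = v n) -> Clim u l -> Clim v l.
Proof.
  intros [N H] [H1 H2]; split.
  - apply is_lim_seq_ext_loc with (2 := H1). exists N; intros n Hn; now rewrite H.
  - apply is_lim_seq_ext_loc with (2 := H2). exists N; intros n Hn; now rewrite H.
Qed.

Lemma Clim_ext (u v : nat -> C) (l : C) : (forall n, u n = v n) -> Clim u l -> Clim v l.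
Proof. intros H; apply Clim_ext_loc; exists 0%nat; auto. Qed.

Lemma is_lim_seq_scal_0 (c : R) (t : nat -> R) :
  is_lim_seq t 0%R -> is_lim_seq (fun k => (c * t k)%R) 0%R.
Proof.
  intros H. replace (Finite 0%R) with (Finite (c * 0)%R) by (f_equal; ring).
  apply is_lim_seq_mult'; [apply is_lim_seq_const|exact H].
Qed.

Lemma Clim_const (c : C) : Clim (fun _ => c) c.
Proof. split; apply is_lim_seq_const. Qed.

Lemma Clim_plus (u v : nat -> C) (l m : C) :
  Clim u l -> Clim v m -> Clim (fun n => u n + v n) (l + m).
Proof. intros [] []; split; now apply is_lim_seq_plus'. Qed.

Lemma Clim_mult (u v : nat -> C) (l m : C) :
  Clim u l -> Clim v m -> Clim (fun n => u n * v n) (l * m).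
Proof.
  intros [] []; split; simpl.
  - apply is_lim_seq_minus'; now apply is_lim_seq_mult'.
  - apply is_lim_seq_plus'; now apply is_lim_seq_mult'.
Qed.

Lemma Clim_scal (c : C) (u : nat -> C) (l : C) : Clim u l -> Clim (fun n => c * u n) (c * l).
Proof. intros; apply Clim_mult; [apply Clim_const | assumption]. Qed.

Lemma Clim_opp (u : nat -> C) (l : C) : Clim u l -> Clim (fun n => - u n) (- l).
Proof.
  intros H. apply Clim_ext with (fun n => - 1 * u n); [intros; ring|].
  replace (- l) with (- 1 * l) by ring. now apply Clim_scal.
Qed.

Lemma Clim_minus (u v : nat -> C) (l m : C) :
  Clim u l -> Clim v m -> Clim (fun n => u n - v n) (l - m).
Proof. intros; apply Clim_plus; [|apply Clim_opp]; assumption. Qed.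

Lemma Cnorm2_neq0 (z : C) : z <> 0 -> (Re z ^ 2 + Im z ^ 2 <> 0)%R.
Proof.
  intros H E. apply H. destruct z as [a b]; simpl in *.
  apply C_ext; simpl; nra.
Qed.

Lemma Clim_inv (u : nat -> C) (l : C) : l <> 0 -> Clim u l -> Clim (fun n => / u n) (/ l).
Proof.
  intros Hl [H1 H2]. pose proof (Cnorm2_neq0 l Hl) as N.
  assert (D : is_lim_seq (fun n => (Re (u n) ^ 2 + Im (u n) ^ 2)%R) (Re l ^ 2 + Im l ^ 2)%R).
  { simpl. apply is_lim_seq_plus'.
    - apply is_lim_seq_mult'; auto; apply is_lim_seq_mult'; auto; apply is_lim_seq_const.
    - apply is_lim_seq_mult'; auto; apply is_lim_seq_mult'; auto; apply is_lim_seq_const. }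
  split; simpl.
  - apply is_lim_seq_div'; assumption.
  - apply is_lim_seq_div'; try assumption.
    apply (is_lim_seq_opp (fun n => snd (u n)) (Finite (Im l))) in H2. exact H2.
Qed.

Lemma Clim_div (u v : nat -> C) (l m : C) :
  m <> 0 -> Clim u l -> Clim v m -> Clim (fun n => u n / v n) (l / m).
Proof. intros; apply Clim_mult; [|apply Clim_inv]; assumption. Qed.

Lemma Clim_unique (u : nat -> C) (l m : C) : Clim u l -> Clim u m -> l = m.
Proof.
  intros [A1 A2] [B1 B2]. apply is_lim_seq_unique in A1, A2, B1, B2.
  apply C_ext; congruence.
Qed.

Lemma Clim_subseq (u : nat -> C) (l : C) (phi : nat -> nat) :
  filterlim phi eventually eventually -> Clim u l -> Clim (fun n => u (phi n)) l.
Proof.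
  intros H [A B]; split.
  - now apply (is_lim_seq_subseq (fun n => Re (u n)) (Re l) phi).
  - now apply (is_lim_seq_subseq (fun n => Im (u n)) (Im l) phi).
Qed.

Lemma Clim_incr (u : nat -> C) (l : C) : Clim u l <-> Clim (fun n => u (S n)) l.
Proof.
  split; intros [A B]; split.
  - now apply -> is_lim_seq_incr_1 in A.
  - now apply -> is_lim_seq_incr_1 in B.
  - now apply is_lim_seq_incr_1.
  - now apply is_lim_seq_incr_1.
Qed.

Lemma CLim_seq_eq (u : nat -> C) (l : C) : Clim u l -> CLim_seq u = l.
Proof.
  intros [A B]. apply is_lim_seq_unique in A, B. unfold CLim_seq. rewrite A, B.
  now destruct l.
Qed.

Lemma Cmod_le_Rabs (z : C) : (Cmod z <= Rabs (Re z) + Rabs (Im z))%R.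
Proof.
  destruct z as [a b]. replace (a, b) with (RtoC a + Ci * RtoC b).
  2:{ apply C_ext; simpl; ring. }
  eapply Rle_trans; [apply Cmod_triangle|].
  rewrite Cmod_mult, Cmod_Ci, !Cmod_R. simpl. replace (a + _)%R with a by ring.
  replace (0+ _)%R with b by ring. lra.
Qed.

Lemma Rabs_le_Cmod (z : C) : (Rabs (Re z) <= Cmod z /\ Rabs (Im z) <= Cmod z)%R.
Proof.
  pose proof (Rmax_Cmod z) as H. split; (eapply Rle_trans; [|exact H]);
  [apply Rmax_l|apply Rmax_r].
Qed.

Lemma Clim_Cmod (u : nat -> C) (l : C) :
  Clim u l <-> is_lim_seq (fun n => Cmod (u n - l)) 0%R.
Proof.
  split.
  - intros [A B].
    apply (is_lim_seq_le_le (fun _ => 0%R) _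
             (fun n => (Rabs (Re (u n) - Re l) + Rabs (Im (u n) - Im l))%R)).
    + intros n; split; [apply Cmod_ge_0|]. apply (Cmod_le_Rabs (u n - l)).
    + apply is_lim_seq_const.
    + assert (forall (a : nat -> R) (b : R), is_lim_seq a b ->
               is_lim_seq (fun n => Rabs (a n - b)) 0%R) as K.
      { intros a b Hab. replace 0%R with (Rabs (b - b)) by (rewrite Rminus_diag; apply Rabs_R0).
        apply (is_lim_seq_abs (fun n => (a n - b)%R) (Finite (b - b))).
        apply is_lim_seq_minus'; [assumption|apply is_lim_seq_const]. }
      replace (Finite 0%R) with (Finite (0 + 0)%R) by (f_equal; ring).
      apply is_lim_seq_plus'; apply K; assumption.
  - intros H.
    assert (forall (a : nat -> R) (b : R), (forall n, Rabs (a n - b) <= Cmod (u n - l))%R ->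
              is_lim_seq a b) as K.
    { intros a b Hab.
      apply is_lim_seq_ext with (fun n => ((a n - b) + b)%R); [intros; ring|].
      replace (Finite b) with (Finite (0 + b)%R) by (f_equal; ring).
      apply is_lim_seq_plus'; [|apply is_lim_seq_const].
      apply is_lim_seq_abs_0.
      apply (is_lim_seq_le_le (fun _ => 0%R) _ (fun n => Cmod (u n - l))).
      - intros n; split; [apply Rabs_pos|apply Hab].
      - apply is_lim_seq_const.
      - exact H. }
    split; apply K; intros n; apply (Rabs_le_Cmod (u n - l)).
Qed.

Lemma is_lim_seq_eps (u : nat -> R) (l : R) :
  is_lim_seq u l <->
  (forall eps : R, (0 < eps)%R -> exists N, forall n, (N <= n)%nat -> (Rabs (u n - l) < eps)%R).
Proof.
  split.
  - intros H eps He. apply is_lim_seq_spec in H. exact (H (mkposreal eps He)).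
  - intros H. apply is_lim_seq_spec. intros eps. exact (H eps (cond_pos eps)).
Qed.

Lemma Clim_eps (u : nat -> C) (l : C) :
  Clim u l <->
  (forall eps : R, (0 < eps)%R -> exists N, forall n, (N <= n)%nat -> (Cmod (u n - l) < eps)%R).
Proof.
  rewrite Clim_Cmod, is_lim_seq_eps. split; intros H eps He; destruct (H eps He) as [N HN];
  exists N; intros n Hn; specialize (HN n Hn).
  - rewrite Rminus_0_r, Rabs_pos_eq in HN by apply Cmod_ge_0. exact HN.
  - rewrite Rminus_0_r, Rabs_pos_eq by apply Cmod_ge_0. exact HN.
Qed.

Lemma Clim_abs (u : nat -> C) (l : C) : Clim u l -> is_lim_seq (fun n => Cmod (u n)) (Cmod l).
Proof.
  intros H. apply is_lim_seq_eps. intros eps He.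
  destruct (proj1 (Clim_eps u l) H eps He) as [N HN]. exists N; intros n Hn.
  specialize (HN n Hn). eapply Rle_lt_trans; [|exact HN].
  apply Rabs_le. split.
  - assert (Cmod l <= Cmod (u n) + Cmod (u n - l))%R; [|lra].
    replace (Cmod (u n - l)) with (Cmod (-(u n - l))) by apply Cmod_opp.
    eapply Rle_trans; [|apply Cmod_triangle]. apply Req_le. f_equal. ring.
  - assert (Cmod (u n) <= Cmod l + Cmod (u n - l))%R; [|lra].
    eapply Rle_trans; [|apply Cmod_triangle]. apply Req_le. f_equal. ring.
Qed.

Lemma Clim_abs_ge (u : nat -> C) (l : C) (B : R) :
  (exists N, forall n, (N <= n)%nat -> (B <= Cmod (u n))%R) -> Clim u l -> (B <= Cmod l)%R.
Proof.
  intros [N HN] H. apply Clim_abs in H.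
  apply (is_lim_seq_le_loc (fun _ => B) (fun n => Cmod (u n)) B (Cmod l)); auto.
  - exists N; auto.
  - apply is_lim_seq_const.
Qed.

Lemma Clim_abs_le (u : nat -> C) (l : C) (B : R) :
  (exists N, forall n, (N <= n)%nat -> (Cmod (u n) <= B)%R) -> Clim u l -> (Cmod l <= B)%R.
Proof.
  intros [N HN] H. apply Clim_abs in H.
  apply (is_lim_seq_le_loc (fun n => Cmod (u n)) (fun _ => B) (Cmod l) B); auto.
  - exists N; auto.
  - apply is_lim_seq_const.
Qed.

Lemma Clim_0_le (u : nat -> C) (b : nat -> R) :
  (exists N, forall n, (N <= n)%nat -> (Cmod (u n) <= b n)%R) -> is_lim_seq b 0%R -> Clim u 0.
Proof.
  intros [N HN] H. apply Clim_eps. intros eps He.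
  destruct (proj1 (is_lim_seq_eps b 0) H eps He) as [N' HN'].
  exists (N + N')%nat. intros n Hn. replace (u n - 0) with (u n) by ring.
  eapply Rle_lt_trans; [apply HN; lia|].
  specialize (HN' n ltac:(lia)). rewrite Rminus_0_r in HN'.
  eapply Rle_lt_trans; [apply Rle_abs|exact HN'].
Qed.

Lemma Clim_Cauchy (u : nat -> C) (t : nat -> R) (N : nat) :
  (forall m n, (N <= n)%nat -> (n <= m)%nat -> (Cmod (u m - u n) <= t n)%R) ->
  is_lim_seq t 0%R -> exists l, Clim u l.
Proof.
  intros H Ht.
  assert (forall a : nat -> R, (forall m n, (Rabs (a m - a n) <= Cmod (u m - u n))%R) ->
    ex_finite_lim_seq a) as K.
  { intros a Ha. apply ex_lim_seq_cauchy_corr. intros eps.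
    destruct (proj1 (is_lim_seq_eps t 0) Ht eps (cond_pos eps)) as [N' HN'].
    exists (N + N')%nat.
    assert (forall n m, (N + N' <= n)%nat -> (n <= m)%nat -> (Rabs (a m - a n) < eps)%R) as Q.
    { intros n m Hn Hm. eapply Rle_lt_trans; [apply Ha|].
      eapply Rle_lt_trans; [apply H; lia|].
      specialize (HN' n ltac:(lia)). rewrite Rminus_0_r in HN'.
      eapply Rle_lt_trans; [apply Rle_abs|exact HN']. }
    intros n m Hn Hm. destruct (Nat.le_ge_cases n m) as [L|L].
    - rewrite Rabs_minus_sym. now apply Q.
    - now apply Q. }
  destruct (K (fun n => Re (u n))) as [x Hx].
  { intros m n. apply (Rabs_le_Cmod (u m - u n)). }
  destruct (K (fun n => Im (u n))) as [y Hy].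
  { intros m n. apply (Rabs_le_Cmod (u m - u n)). }
  exists (x, y). split; assumption.
Qed.

(** * Finite sums, majorants and dominated convergence *)

Fixpoint sumn (a : nat -> C) (n : nat) : C :=
  match n with O => 0 | S m => sumn a m + a m end.

Lemma sumn_ext (a b : nat -> C) (n : nat) :
  (forall k, (k < n)%nat -> a k = b k) -> sumn a n = sumn b n.
Proof.
  induction n; simpl; intros H; [reflexivity|].
  rewrite IHn, H by (auto with arith). reflexivity.
Qed.

Lemma sumn_plus (a b : nat -> C) (n : nat) :
  sumn (fun k => a k + b k) n = sumn a n + sumn b n.
Proof. induction n; simpl; [ring|rewrite IHn; ring]. Qed.

Lemma sumn_scal (c : C) (a : nat -> C) (n : nat) :
  sumn (fun k => c * a k) n = c * sumn a n.
Proof. induction n; simpl; [ring|rewrite IHn; ring]. Qed.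

Lemma sumn_0 (n : nat) : sumn (fun _ => 0) n = 0.
Proof. induction n; simpl; [reflexivity|rewrite IHn; ring]. Qed.

Lemma sumn_swap (a : nat -> nat -> C) (n m : nat) :
  sumn (fun i => sumn (fun j => a i j) m) n = sumn (fun j => sumn (fun i => a i j) n) m.
Proof.
  induction n; simpl.
  - now rewrite sumn_0.
  - rewrite IHn. now rewrite <- sumn_plus.
Qed.

Lemma sumn_S_l (a : nat -> C) (n : nat) : sumn a (S n) = a 0%nat + sumn (fun k => a (S k)) n.
Proof. induction n; [simpl; ring|]. change (sumn a (S (S n))) with (sumn a (S n) + a (S n)).
  rewrite IHn. simpl. ring. Qed.

Lemma sumn_add (a : nat -> C) (n m : nat) :
  sumn a (n + m) = sumn a n + sumn (fun k => a (n + k)%nat) m.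
Proof.
  induction m; simpl.
  - rewrite Nat.add_0_r. ring.
  - rewrite Nat.add_succ_r. simpl. rewrite IHm. ring.
Qed.

Lemma sumn_rev (a : nat -> C) (n : nat) : sumn a n = sumn (fun k => a (n - 1 - k)%nat) n.
Proof.
  induction n; [reflexivity|]. rewrite (sumn_S_l (fun k => a (S n - 1 - k)%nat)).
  change (sumn a (S n)) with (sumn a n + a n). rewrite IHn.
  replace (S n - 1 - 0)%nat with n by lia. rewrite Cplus_comm. f_equal.
  apply sumn_ext. intros k Hk. f_equal. lia.
Qed.

Lemma sum_n_sumn (a : nat -> C) (n : nat) : sum_n a n = sumn a (S n).
Proof.
  induction n.
  - rewrite sum_O. simpl. ring.
  - rewrite sum_Sn, IHn. reflexivity.
Qed.

Lemma Clim_sumn (f : nat -> nat -> C) (g : nat -> C) (n : nat) :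
  (forall k, (k < n)%nat -> Clim (fun K => f K k) (g k)) ->
  Clim (fun K => sumn (f K) n) (sumn g n).
Proof.
  induction n; intros H; simpl.
  - apply Clim_const.
  - apply Clim_plus; auto with arith.
Qed.

(* A summable majorant is given by its tails [t], so that the partial sums
   telescope. *)
Definition tail_bound (a : nat -> C) (t : nat -> R) (k0 : nat) : Prop :=
  forall k, (k0 <= k)%nat -> (Cmod (a k) <= t k - t (S k))%R.

Lemma tail_bound_sum (a : nat -> C) (t : nat -> R) (k0 n m : nat) :
  tail_bound a t k0 -> (k0 <= n)%nat -> (n <= m)%nat ->
  (Cmod (sumn a m - sumn a n) <= t n - t m)%R.
Proof.
  intros H Hn Hm. induction Hm.
  - replace (sumn a n - sumn a n) with (RtoC 0) by ring. rewrite Cmod_0. lra.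
  - simpl. replace (sumn a m + a m - sumn a n) with ((sumn a m - sumn a n) + a m) by ring.
    eapply Rle_trans; [apply Cmod_triangle|]. pose proof (H m ltac:(lia)). lra.
Qed.

Lemma tail_nonneg (t : nat -> R) (k0 : nat) :
  (forall k, (k0 <= k)%nat -> (0 <= t k - t (S k))%R) -> is_lim_seq t 0%R ->
  forall k, (k0 <= k)%nat -> (0 <= t k)%R.
Proof.
  intros H Ht k Hk.
  assert (D : forall m, (k <= m)%nat -> (t m <= t k)%R).
  { intros m Hm. induction Hm; [lra|]. pose proof (H m ltac:(lia)). lra. }
  apply (is_lim_seq_le_loc t (fun _ => t k) 0%R (t k)); auto.
  - exists k; auto.
  - apply is_lim_seq_const.
Qed.

Lemma tail_bound_nonneg (a : nat -> C) (t : nat -> R) (k0 : nat) :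
  tail_bound a t k0 -> is_lim_seq t 0%R -> forall k, (k0 <= k)%nat -> (0 <= t k)%R.
Proof.
  intros H Ht. apply tail_nonneg; auto. intros k Hk.
  eapply Rle_trans; [apply Cmod_ge_0|]. apply (H k Hk).
Qed.

Lemma tail_bound_cv (a : nat -> C) (t : nat -> R) (k0 : nat) :
  tail_bound a t k0 -> is_lim_seq t 0%R -> exists l, Clim (sumn a) l.
Proof.
  intros H Ht. apply (Clim_Cauchy _ t k0); [|assumption].
  intros m n Hn Hm. pose proof (tail_bound_sum _ _ _ _ _ H Hn Hm).
  pose proof (tail_bound_nonneg _ _ _ H Ht m ltac:(lia)). lra.
Qed.

Lemma tail_bound_lim (a : nat -> C) (t : nat -> R) (k0 n : nat) (l : C) :
  tail_bound a t k0 -> is_lim_seq t 0%R -> Clim (sumn a) l -> (k0 <= n)%nat ->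
  (Cmod (l - sumn a n) <= t n)%R.
Proof.
  intros H Ht Hl Hn.
  apply (Clim_abs_le (fun m => sumn a m - sumn a n)).
  - exists n. intros m Hm. pose proof (tail_bound_sum _ _ _ _ _ H Hn Hm).
    pose proof (tail_bound_nonneg _ _ _ H Ht m ltac:(lia)). lra.
  - apply Clim_minus; [assumption|apply Clim_const].
Qed.

(** Tannery's theorem, that is dominated convergence for series: from index n on every series
    contributes at most t n, and the finitely many earlier terms converge one by one. The domination
    is only required for K >= K0. *)
Lemma tannery (f : nat -> nat -> C) (g : nat -> C) (t : nat -> R) (k0 K0 : nat)
    (l : nat -> C) (T : C) :
  is_lim_seq t 0%R ->
  (forall K, (K0 <= K)%nat -> tail_bound (f K) t k0) ->
  (forall k, Clim (fun K => f K k) (g k)) ->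
  (forall K, Clim (sumn (f K)) (l K)) ->
  Clim (sumn g) T -> Clim l T.
Proof.
  intros Ht Hd Hp Hl HT. apply Clim_eps. intros eps He.
  destruct (proj1 (is_lim_seq_eps t 0) Ht (eps / 4)%R ltac:(lra)) as [N1 HN1].
  destruct (proj1 (Clim_eps _ _) HT (eps / 4)%R ltac:(lra)) as [N2 HN2].
  (* This cut is past the start of the domination, has a small tail, and has the partial sum of g
     close to T. *)
  set (n := (k0 + N1 + N2)%nat).
  destruct (proj1 (Clim_eps _ _) (Clim_sumn f g n (fun k _ => Hp k)) (eps / 4)%R ltac:(lra))
    as [N3 HN3].
  exists (K0 + N3)%nat. intros K HK.
  specialize (HN3 K ltac:(lia)). specialize (HN2 n ltac:(lia)). specialize (HN1 n ltac:(lia)).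
  rewrite Rminus_0_r in HN1.
  pose proof (tail_bound_lim _ _ _ n _ (Hd K ltac:(lia)) Ht (Hl K) ltac:(lia)) as HB.
  pose proof (Rle_abs (t n)).
  replace (l K - T) with ((l K - sumn (f K) n) + ((sumn (f K) n - sumn g n) + (sumn g n - T)))
    by ring.
  eapply Rle_lt_trans; [apply Cmod_triangle|].
  pose proof (Cmod_triangle (sumn (f K) n - sumn g n) (sumn g n - T)). lra.
Qed.

(** The window is -n <= j < n, as in the pairing of [CSeriesZ]. Its asymmetry produces the two
    boundary terms in [SZ_shift] and [SZ_opp]. *)
Definition SZ (a : Z -> C) (n : nat) : C :=
  sumn (fun k => a (Z.of_nat k) + a (- 1 - Z.of_nat k)%Z) n.

Definition sumZ (a : Z -> C) (l : C) : Prop := Clim (SZ a) l.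

Definition tail_boundZ (a : Z -> C) (t : nat -> R) (k0 : nat) : Prop :=
  forall k, (k0 <= k)%nat ->
  (Cmod (a (Z.of_nat k)) <= t k - t (S k) /\ Cmod (a (- 1 - Z.of_nat k)%Z) <= t k - t (S k))%R.

Definition summable (a : Z -> C) : Prop :=
  exists t k0, is_lim_seq t 0%R /\ tail_boundZ a t k0.

Lemma tail_boundZ_fold (a : Z -> C) (t : nat -> R) (k0 : nat) :
  tail_boundZ a t k0 ->
  tail_bound (fun k => a (Z.of_nat k) + a (- 1 - Z.of_nat k)%Z) (fun k => (2 * t k)%R) k0.
Proof.
  intros H k Hk. destruct (H k Hk). eapply Rle_trans; [apply Cmod_triangle|]. lra.
Qed.

Lemma summable_sumZ (a : Z -> C) : summable a -> exists l, sumZ a l.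
Proof.
  intros (t & k0 & Ht & H). apply tail_boundZ_fold in H.
  eapply tail_bound_cv; [exact H|]. now apply is_lim_seq_scal_0.
Qed.

(** [CSeriesZ] adds two separate one-sided limits while [sumZ] is the limit of paired sums; the
    majorant makes each half converge by itself. *)
Lemma summable_CSeriesZ (a : Z -> C) (l : C) : summable a -> sumZ a l -> CSeriesZ a = l.
Proof.
  intros (t & k0 & Ht & H) Hl.
  destruct (tail_bound_cv (fun k => a (Z.of_nat k)) t k0) as [p Hp]; auto.
  { intros k Hk. apply (H k Hk). }
  destruct (tail_bound_cv (fun k => a (- 1 - Z.of_nat k)%Z) t k0) as [q Hq]; auto.
  { intros k Hk. apply (H k Hk). }
  unfold CSeriesZ, CSeries.
  assert (forall u x, Clim (sumn u) x -> CLim_seq (fun n => sum_n u n) = x) as E.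
  { intros u x Hx. apply CLim_seq_eq. apply -> Clim_incr in Hx.
    eapply Clim_ext; [|exact Hx]. intros n. now rewrite sum_n_sumn. }
  rewrite (E _ _ Hp), (E _ _ Hq).
  apply (Clim_unique (SZ a)); [|exact Hl].
  apply Clim_ext with (fun n => sumn (fun k => a (Z.of_nat k)) n
    + sumn (fun k => a (- 1 - Z.of_nat k)%Z) n).
  { intros n. unfold SZ. now rewrite sumn_plus. }
  now apply Clim_plus.
Qed.

Lemma tanneryZ (f : nat -> Z -> C) (g : Z -> C) (t : nat -> R) (k0 K0 : nat)
    (l : nat -> C) (T : C) :
  is_lim_seq t 0%R ->
  (forall K, (K0 <= K)%nat -> tail_boundZ (f K) t k0) ->
  (forall j, Clim (fun K => f K j) (g j)) ->
  (forall K, sumZ (f K) (l K)) ->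
  sumZ g T -> Clim l T.
Proof.
  intros Ht Hd Hp Hl HT.
  apply (tannery (fun K k => f K (Z.of_nat k) + f K (- 1 - Z.of_nat k)%Z)
           (fun k => g (Z.of_nat k) + g (- 1 - Z.of_nat k)%Z) (fun k => (2 * t k)%R) k0 K0); auto.
  - now apply is_lim_seq_scal_0.
  - intros K HK. apply tail_boundZ_fold. auto.
  - intros k. apply Clim_plus; auto.
Qed.

Lemma sumZ_ext (a b : Z -> C) (l : C) : (forall j, a j = b j) -> sumZ a l -> sumZ b l.
Proof.
  intros H. apply Clim_ext. intros n. apply sumn_ext. intros k _. now rewrite !H.
Qed.

Lemma sumZ_plus (a b : Z -> C) (l m : C) :
  sumZ a l -> sumZ b m -> sumZ (fun j => a j + b j) (l + m).
Proof.
  intros Ha Hb. apply Clim_ext with (2 := Clim_plus _ _ _ _ Ha Hb).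
  intros n. unfold SZ. rewrite <- sumn_plus. apply sumn_ext. intros; ring.
Qed.

Lemma sumZ_scal (c : C) (a : Z -> C) (l : C) :
  sumZ a l -> sumZ (fun j => c * a j) (c * l).
Proof.
  intros Ha. apply Clim_ext with (2 := Clim_scal c _ _ Ha).
  intros n. unfold SZ. rewrite <- sumn_scal. apply sumn_ext. intros; ring.
Qed.

Lemma sumZ_minus (a b : Z -> C) (l m : C) :
  sumZ a l -> sumZ b m -> sumZ (fun j => a j - b j) (l - m).
Proof.
  intros Ha Hb. replace (l - m) with (l + (- 1) * m) by ring.
  apply sumZ_ext with (fun j => a j + (-1) * b j); [intros; ring|].
  apply sumZ_plus; [assumption|]. now apply sumZ_scal.
Qed.

Lemma sumZ_sumn (a : nat -> Z -> C) (l : nat -> C) (n : nat) :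
  (forall k, (k < n)%nat -> sumZ (a k) (l k)) ->
  sumZ (fun j => sumn (fun k => a k j) n) (sumn l n).
Proof.
  induction n; intros H; simpl.
  - apply Clim_ext with (fun _ => 0); [|apply Clim_const].
    intros n. unfold SZ. rewrite <- (sumn_0 n) at 1. apply sumn_ext. intros; ring.
  - apply sumZ_plus; auto with arith.
Qed.

Lemma SZ_S (a : Z -> C) (n : nat) :
  SZ a (S n) = SZ a n + (a (Z.of_nat n) + a (- 1 - Z.of_nat n)%Z).
Proof. reflexivity. Qed.

Lemma SZ_shift (a : Z -> C) (n : nat) :
  SZ (fun j => a (j + 1)%Z) n = SZ a n + a (Z.of_nat n) - a (- Z.of_nat n)%Z.
Proof.
  induction n.
  - unfold SZ; simpl. ring.
  - rewrite !SZ_S, IHn.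
    replace (Z.of_nat n + 1)%Z with (Z.of_nat (S n)) by lia.
    replace (-1 - Z.of_nat n + 1)%Z with (- Z.of_nat n)%Z by lia.
    replace (-1 - Z.of_nat n)%Z with (- Z.of_nat (S n))%Z by lia.
    ring.
Qed.

Lemma SZ_opp (a : Z -> C) (n : nat) :
  SZ (fun j => a (- j)%Z) n = SZ a n + a (Z.of_nat n) - a (- Z.of_nat n)%Z.
Proof.
  induction n.
  - unfold SZ; simpl. ring.
  - rewrite !SZ_S, IHn.
    replace (- (-1 - Z.of_nat n))%Z with (Z.of_nat (S n)) by lia.
    replace (-1 - Z.of_nat n)%Z with (- Z.of_nat (S n))%Z by lia.
    ring.
Qed.

(** What a conditionally convergent [sumZ] needs in order to allow a translation or reflection of
    the index: the boundary terms tend to 0. *)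
Definition vanishing (a : Z -> C) : Prop :=
  Clim (fun n => a (Z.of_nat n)) 0 /\ Clim (fun n => a (- Z.of_nat n)%Z) 0.

Lemma summable_vanishing (a : Z -> C) : summable a -> vanishing a.
Proof.
  intros (t & k0 & Ht & H).
  assert (Hd : is_lim_seq (fun k => (t k - t (S k))%R) 0%R).
  { replace (Finite 0%R) with (Finite (0 - 0)%R) by (f_equal; ring).
    apply is_lim_seq_minus'; [exact Ht|]. now apply -> is_lim_seq_incr_1 in Ht. }
  split.
  - apply Clim_0_le with (2 := Hd). exists k0. intros n Hn. apply (H n Hn).
  - apply Clim_incr. apply Clim_0_le with (2 := Hd). exists k0. intros n Hn.
    replace (- Z.of_nat (S n))%Z with (-1 - Z.of_nat n)%Z by lia. apply (H n Hn).
Qed.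

Lemma sumZ_shift (a : Z -> C) (l : C) :
  vanishing a -> sumZ a l -> sumZ (fun j => a (j + 1)%Z) l.
Proof.
  intros [H1 H2] H. apply Clim_ext with (fun n => SZ a n + a (Z.of_nat n) - a (- Z.of_nat n)%Z).
  { intros; now rewrite SZ_shift. }
  replace l with (l + 0 - 0) by ring. apply Clim_minus; [apply Clim_plus|]; assumption.
Qed.

Lemma sumZ_opp (a : Z -> C) (l : C) :
  vanishing a -> sumZ a l -> sumZ (fun j => a (- j)%Z) l.
Proof.
  intros [H1 H2] H. apply Clim_ext with (fun n => SZ a n + a (Z.of_nat n) - a (- Z.of_nat n)%Z).
  { intros; now rewrite SZ_opp. }
  replace l with (l + 0 - 0) by ring. apply Clim_minus; [apply Clim_plus|]; assumption.
Qed.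

Lemma summable_ext (a b : Z -> C) : (forall j, a j = b j) -> summable a -> summable b.
Proof.
  intros E (t & k0 & Ht & H). exists t, k0. split; [exact Ht|].
  intros k Hk. rewrite <- !E. auto.
Qed.

Lemma summable_le (a b : Z -> C) (c : R) (n0 : nat) :
  (forall j, (Z.of_nat n0 <= Z.abs j)%Z -> (Cmod (a j) <= c * Cmod (b j))%R) ->
  summable b -> summable a.
Proof.
  intros Hab (t & k0 & Ht & H). exists (fun k => (Rmax c 0 * t k)%R), (k0 + n0)%nat. split.
  - now apply is_lim_seq_scal_0.
  - assert (forall j x, (Z.of_nat n0 <= Z.abs j)%Z -> (Cmod (b j) <= x)%R ->
       (Cmod (a j) <= Rmax c 0 * x)%R) as Q.
    { intros j x Hj Hx. eapply Rle_trans; [apply Hab; exact Hj|].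
      pose proof (Rmax_l c 0). pose proof (Rmax_r c 0). pose proof (Cmod_ge_0 (b j)). nra. }
    intros k Hk. destruct (H k ltac:(lia)) as [A B]. rewrite <- Rmult_minus_distr_l.
    split; apply Q; auto; lia.
Qed.

Lemma summable_plus (a b : Z -> C) : summable a -> summable b -> summable (fun j => a j + b j).
Proof.
  intros (t & k0 & Ht & H) (t' & k0' & Ht' & H').
  exists (fun k => (t k + t' k)%R), (k0 + k0')%nat. split.
  - replace (Finite 0%R) with (Finite (0 + 0)%R) by (f_equal; ring). now apply is_lim_seq_plus'.
  - intros k Hk. destruct (H k ltac:(lia)), (H' k ltac:(lia)).
    split; (eapply Rle_trans; [apply Cmod_triangle|]); lra.
Qed.

Lemma geom_tail_lim (c r : R) : (0 <= r < 1)%R -> is_lim_seq (fun k => (c * r ^ k / (1 - r))%R) 0%R.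
Proof.
  intros Hr. apply is_lim_seq_ext with (fun k => ((c / (1 - r)) * r ^ k)%R).
  { intros; field; lra. }
  apply is_lim_seq_scal_0. apply is_lim_seq_geom.
  rewrite Rabs_pos_eq; lra.
Qed.

Lemma geom_tail (c r : R) (k : nat) : (0 <= r < 1)%R ->
  (c * r ^ k / (1 - r) - c * r ^ S k / (1 - r) = c * r ^ k)%R.
Proof. intros; simpl; field; lra. Qed.

Lemma summable_geom (a : Z -> C) (c r : R) (k0 : nat) :
  (0 <= r < 1)%R ->
  (forall k, (k0 <= k)%nat ->
    (Cmod (a (Z.of_nat k)) <= c * r ^ k /\ Cmod (a (- 1 - Z.of_nat k)%Z) <= c * r ^ k)%R) ->
  summable a.
Proof.
  intros Hr H. exists (fun k => (c * r ^ k / (1 - r))%R), k0. split.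
  - now apply geom_tail_lim.
  - intros k Hk. rewrite geom_tail by assumption. auto.
Qed.

Lemma tanneryZ_le (f : nat -> Z -> C) (g b : Z -> C) (c : R) (n0 K0 : nat)
    (l : nat -> C) (T : C) :
  summable b ->
  (forall K j, (K0 <= K)%nat -> (Z.of_nat n0 <= Z.abs j)%Z -> (Cmod (f K j) <= c * Cmod (b j))%R) ->
  (forall j, Clim (fun K => f K j) (g j)) ->
  (forall K, sumZ (f K) (l K)) ->
  sumZ g T -> Clim l T.
Proof.
  intros (t & k0 & Ht & H) Hf Hp Hl HT.
  apply (tanneryZ f g (fun k => (Rmax c 0 * t k)%R) (k0 + n0) K0); auto.
  - now apply is_lim_seq_scal_0.
  - intros K HK.
    assert (forall j x, (Z.of_nat n0 <= Z.abs j)%Z -> (Cmod (b j) <= x)%R ->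
       (Cmod (f K j) <= Rmax c 0 * x)%R) as Q.
    { intros j x Hj Hx. eapply Rle_trans; [apply Hf; assumption|].
      pose proof (Rmax_l c 0). pose proof (Rmax_r c 0). pose proof (Cmod_ge_0 (b j)). nra. }
    intros k Hk. destruct (H k ltac:(lia)) as [A B]. rewrite <- Rmult_minus_distr_l.
    split; apply Q; auto; lia.
Qed.

Lemma summable_scal (c : C) (a : Z -> C) : summable a -> summable (fun j => c * a j).
Proof.
  apply (summable_le _ _ (Cmod c) 0). intros j _. rewrite Cmod_mult. lra.
Qed.

Lemma SZ_const_from (a : Z -> C) (N n : nat) :
  (forall j, (Z.of_nat N < Z.abs j)%Z -> a j = 0) -> (N < n)%nat -> SZ a n = SZ a (S N).
Proof.
  intros H Hn. induction Hn; [reflexivity|].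
  rewrite SZ_S, IHHn, !H by lia. ring.
Qed.

Lemma sumZ_finite (a : Z -> C) (N : nat) :
  (forall j, (Z.of_nat N < Z.abs j)%Z -> a j = 0) -> sumZ a (SZ a (S N)).
Proof.
  intros H. apply Clim_ext_loc with (2 := Clim_const (SZ a (S N))).
  exists (S N). intros n Hn. symmetry. apply SZ_const_from; auto with arith.
Qed.

Lemma SZ_ext (a b : Z -> C) (n : nat) :
  (forall j, (- Z.of_nat n <= j < Z.of_nat n)%Z -> a j = b j) -> SZ a n = SZ b n.
Proof.
  intros H. apply sumn_ext. intros k Hk. rewrite !H by lia. reflexivity.
Qed.

Lemma sumn_SZ (f : Z -> C) (N : nat) :
  sumn (fun k => f (Z.of_nat k - Z.of_nat N)%Z) (2 * N) = SZ f N.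
Proof.
  induction N.
  - reflexivity.
  - replace (2 * S N)%nat with (S (S (2 * N))) by lia. rewrite sumn_S_l.
    change (sumn ?a (S ?n)) with (sumn a n + a n). rewrite SZ_S, <- IHN.
    rewrite (sumn_ext _ (fun k => f (Z.of_nat k - Z.of_nat N)%Z)).
    2:{ intros k _. f_equal. lia. }
    replace (Z.of_nat 0 - Z.of_nat (S N))%Z with (-1 - Z.of_nat N)%Z by lia.
    replace (Z.of_nat (S (2 * N)) - Z.of_nat (S N))%Z with (Z.of_nat N) by lia.
    ring.
Qed.

(** Makes a bilateral series out of a finite sum over -N <= j <= N, so that Tannery's theorem
    applies to the finite identities. *)
Definition truncate (f : Z -> C) (N : nat) (j : Z) : C :=
  if Z_le_dec (Z.abs j) (Z.of_nat N) then f j else 0.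

Lemma sumZ_truncate (f : Z -> C) (N : nat) :
  sumZ (truncate f N) (sumn (fun k => f (Z.of_nat k - Z.of_nat N)%Z) (2 * N + 1)).
Proof.
  replace (sumn _ (2 * N + 1)) with (SZ (truncate f N) (S N)).
  - apply sumZ_finite. intros j Hj. unfold truncate. destruct Z_le_dec; [lia|reflexivity].
  - rewrite SZ_S, Nat.add_1_r. change (sumn ?a (S ?n)) with (sumn a n + a n).
    rewrite sumn_SZ. f_equal.
    + apply SZ_ext. intros j Hj. unfold truncate. destruct Z_le_dec; [reflexivity|lia].
    + unfold truncate at 1. destruct Z_le_dec; [|lia].
      unfold truncate. destruct Z_le_dec; [lia|].
      rewrite Cplus_0_r. f_equal. lia.
Qed.

(** * Infinite products *)

Local Notation NtoC n := (ZtoC (Z.of_nat n)).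

Lemma expi_form (x : C) :
  expi x = RtoC (exp (- (2 * PI * Im x))) * (cos (2 * PI * Re x), sin (2 * PI * Re x)).
Proof.
  unfold expi, Cexp. destruct x as [a b]. f_equal.
  - f_equal. f_equal. simpl. ring.
  - f_equal; f_equal; simpl; ring.
Qed.

Lemma expi_add (x y : C) : expi (x + y) = expi x * expi y.
Proof.
  rewrite !expi_form. destruct x as [a b], y as [c d]. simpl.
  replace (- (2 * PI * (b + d)))%R with (- (2 * PI * b) + - (2 * PI * d))%R by ring.
  rewrite exp_plus, !Rmult_plus_distr_l, cos_plus, sin_plus.
  apply C_ext; simpl; ring.
Qed.

Lemma expi_0 : expi 0 = 1.
Proof.
  rewrite expi_form. simpl. rewrite !Rmult_0_r, Ropp_0, exp_0, cos_0, sin_0.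
  apply C_ext; simpl; ring.
Qed.

Lemma Cmod_expi (x : C) : Cmod (expi x) = exp (- (2 * PI * Im x)).
Proof.
  rewrite expi_form, Cmod_mult, Cmod_R, Rabs_pos_eq by (left; apply exp_pos).
  replace (Cmod _) with 1%R; [ring|]. unfold Cmod; simpl.
  rewrite !Rmult_1_r. symmetry. rewrite Rplus_comm.
  rewrite <- sqrt_1. f_equal. apply sin2_cos2.
Qed.

Lemma expi_neq_0 (x : C) : expi x <> 0.
Proof. apply Cmod_gt_0. rewrite Cmod_expi. apply exp_pos. Qed.

Lemma expi_opp (x : C) : expi (- x) = / expi x.
Proof.
  pose proof (expi_neq_0 x).
  assert (expi (- x) * expi x = 1) as E.
  { rewrite <- expi_add. replace (- x + x) with (RtoC 0) by ring. apply expi_0. }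
  replace (expi (- x)) with (expi (- x) * expi x * / expi x) by (field; assumption).
  rewrite E. ring.
Qed.

Lemma expi_sub (x y : C) : expi (x - y) = expi x / expi y.
Proof. unfold Cminus. rewrite expi_add, expi_opp. reflexivity. Qed.

Lemma expi_half : expi (1 / 2) = - (1).
Proof.
  replace (1 / 2)%C with (RtoC (1 / 2)) by (rewrite RtoC_div by lra; reflexivity).
  rewrite expi_form. simpl. replace (2 * PI * (1 / 2))%R with PI by field.
  rewrite Rmult_0_r, Ropp_0, exp_0, cos_PI, sin_PI. apply C_ext; simpl; ring.
Qed.

Lemma expi_1 : expi 1 = 1.
Proof.
  replace (RtoC 1) with (1 / 2 + 1 / 2)%C at 1 by field.
  rewrite expi_add, expi_half. ring.
Qed.

Lemma ZtoC_plus (m n : Z) : ZtoC (m + n) = ZtoC m + ZtoC n.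
Proof. unfold ZtoC. now rewrite plus_IZR, RtoC_plus. Qed.
Lemma ZtoC_minus (m n : Z) : ZtoC (m - n) = ZtoC m - ZtoC n.
Proof. unfold ZtoC. now rewrite minus_IZR, RtoC_minus. Qed.
Lemma ZtoC_mult (m n : Z) : ZtoC (m * n) = ZtoC m * ZtoC n.
Proof. unfold ZtoC. now rewrite mult_IZR, RtoC_mult. Qed.
Lemma ZtoC_opp (m : Z) : ZtoC (- m) = - ZtoC m.
Proof. unfold ZtoC. now rewrite opp_IZR, RtoC_opp. Qed.
Lemma ZtoC_succ (n : nat) : NtoC (S n) = NtoC n + 1.
Proof. rewrite Nat2Z.inj_succ. unfold Z.succ. now rewrite ZtoC_plus. Qed.
Lemma ZtoC_inj (m n : Z) : ZtoC m = ZtoC n -> m = n.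
Proof. intros H. apply RtoC_inj in H. now apply eq_IZR. Qed.

Ltac zc :=
  repeat first [ rewrite ZtoC_plus | rewrite ZtoC_minus | rewrite ZtoC_mult | rewrite ZtoC_opp
               | rewrite ZtoC_succ ];
  change (Z.of_nat 0) with 0%Z; change (ZtoC 0) with (RtoC 0); change (ZtoC 1) with (RtoC 1); change (ZtoC 2) with (RtoC 2);
  change (ZtoC (-1)) with (RtoC (-1)).

Lemma expi_nat (n : nat) : expi (NtoC n) = 1.
Proof.
  induction n; [apply expi_0|]. rewrite ZtoC_succ, expi_add, IHn, expi_1. ring.
Qed.

Lemma expi_Z (n : Z) : expi (ZtoC n) = 1.
Proof.
  destruct (Z_le_gt_dec 0 n) as [L|L].
  - rewrite <- (Z2Nat.id n) by lia. apply expi_nat.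
  - replace n with (- Z.of_nat (Z.to_nat (- n)))%Z by lia.
    rewrite ZtoC_opp, expi_opp, expi_nat. field.
Qed.

Lemma expi_add_Z (x : C) (n : Z) : expi (x + ZtoC n) = expi x.
Proof. rewrite expi_add, expi_Z. ring. Qed.

(** The modulus forces Im x = 0; then cos (2 pi x) = 1 - 2 sin^2 (pi x) reduces the claim to the
    zeros of the sine. *)
Lemma expi_eq_1 (x : C) : expi x = 1 -> exists n : Z, x = ZtoC n.
Proof.
  intros H. pose proof (Cmod_expi x) as M. rewrite H, Cmod_1 in M.
  assert (I : Im x = 0%R).
  { rewrite <- exp_0 in M. apply exp_inv in M. pose proof PI_RGT_0. nra. }
  rewrite expi_form, I, Rmult_0_r, Ropp_0, exp_0 in H.
  apply (f_equal Re) in H. simpl in H. rewrite Rmult_1_l, Rmult_0_l, Rminus_0_r in H.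
  replace (2 * PI * Re x)%R with (2 * (PI * Re x))%R in H by ring.
  rewrite cos_2a_sin in H.
  assert (S : sin (PI * Re x) = 0%R) by nra.
  apply sin_eq_0_0 in S. destruct S as [k Hk]. exists k.
  apply C_ext; simpl; [|exact I]. pose proof PI_RGT_0. nra.
Qed.

Lemma Clim_expi (u : nat -> C) (l : C) : Clim u l -> Clim (fun n => expi (u n)) (expi l).
Proof.
  intros [A B].
  assert (Clim (fun n => RtoC (exp (- (2 * PI * Im (u n)))) *
    (cos (2 * PI * Re (u n)), sin (2 * PI * Re (u n)))) (expi l)) as K.
  { rewrite expi_form. apply Clim_mult.
    - split; simpl; [|apply is_lim_seq_const].
      apply (is_lim_seq_continuous (fun y => exp (- (2 * PI * y)))); [|exact B].
      reg.
    - split; simpl.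
      + apply (is_lim_seq_continuous (fun y => cos (2 * PI * y))); [|exact A].
        reg.
      + apply (is_lim_seq_continuous (fun y => sin (2 * PI * y))); [|exact A].
        reg. }
  eapply Clim_ext; [|exact K]. intros n. symmetry. apply expi_form.
Qed.

Lemma Cmod_1_minus_ge (z : C) : (1 - Cmod z <= Cmod (1 - z) /\ Cmod z - 1 <= Cmod (1 - z))%R.
Proof.
  split.
  - assert (Cmod (1 - z + z) <= Cmod (1 - z) + Cmod z)%R by apply Cmod_triangle.
    replace (1 - z + z) with (RtoC 1) in H by ring. rewrite Cmod_1 in H. lra.
  - assert (Cmod ((1 + - (1 - z))) <= Cmod 1 + Cmod (- (1 - z)))%R by apply Cmod_triangle.
    replace (1 + - (1 - z)) with z in H by ring. rewrite Cmod_1, Cmod_opp in H. lra.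
Qed.

Lemma Cmod_1_minus_le (z : C) : (Cmod (1 - z) <= 1 + Cmod z)%R.
Proof.
  eapply Rle_trans; [apply Cmod_triangle|]. rewrite Cmod_1, Cmod_opp. lra.
Qed.

Lemma Cprod_neq_0 (a : nat -> C) (n : nat) :
  (forall k, (1 <= k <= n)%nat -> a k <> 0) -> Cprod a n <> 0.
Proof.
  induction n; intros H; simpl.
  - apply C1_nz.
  - apply Cmult_neq_0; [apply IHn; intros; apply H; lia|apply H; lia].
Qed.

Lemma Cprod_ext (a b : nat -> C) (n : nat) :
  (forall k, (1 <= k <= n)%nat -> a k = b k) -> Cprod a n = Cprod b n.
Proof.
  induction n; intros H; simpl; [reflexivity|].
  rewrite IHn, H; auto with arith. intros; apply H; lia.
Qed.

Section InfiniteProduct.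
Variables (a : nat -> C) (c r : R).
Hypothesis Hr : (0 <= r < 1)%R.
Hypothesis Ha : forall k, (Cmod (a k) <= c * r ^ k)%R.
Let p := Cprod (fun k => 1 - a k).
Let t (k : nat) := (c * r ^ k / (1 - r))%R.

Lemma prod_c_nonneg : (0 <= c)%R.
Proof. pose proof (Ha 0). pose proof (Cmod_ge_0 (a 0%nat)). simpl in H. lra. Qed.

Lemma prod_t_step (k : nat) : (Cmod (a k) <= t k - t (S k))%R.
Proof. unfold t. rewrite geom_tail by assumption. apply Ha. Qed.

Lemma prod_t_nonneg (k : nat) : (0 <= t k)%R.
Proof.
  unfold t. pose proof prod_c_nonneg. pose proof (pow_le r k (proj1 Hr)).
  apply Rle_div_r; [lra|]. rewrite Rmult_0_l. nra.
Qed.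

(** From |1 - a_k| <= 1 + |a_k| <= exp |a_k|, the sum of the |a_k| being telescoped by the tails
    t. *)
Lemma Cprod_upper : exists U, (0 < U)%R /\ forall n, (Cmod (p n) <= U)%R.
Proof.
  exists (exp (t 1)). split; [apply exp_pos|].
  intros n. apply Rle_trans with (exp (t 1 - t (S n)))%R.
  - induction n.
    + unfold p. simpl Cprod. rewrite Cmod_1. right. rewrite Rminus_diag. now rewrite exp_0.
    + unfold p in *. simpl Cprod. rewrite Cmod_mult.
      replace (t 1 - t (S (S n)))%R with ((t 1 - t (S n)) + (t (S n) - t (S (S n))))%R by ring.
      rewrite exp_plus. apply Rmult_le_compat; try apply Cmod_ge_0; [exact IHn|].
      eapply Rle_trans; [apply Cmod_1_minus_le|].
      eapply Rle_trans; [|apply exp_ineq1_le]. pose proof (prod_t_step (S n)). lra.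
  - assert (forall x y, (x <= y)%R -> (exp x <= exp y)%R) as M.
    { intros x y [L|L]; [left; now apply exp_increasing|right; now f_equal]. }
    apply M. pose proof (prod_t_nonneg (S n)). lra.
Qed.

(** The increments p_(k+1) - p_k = - p_k a_(k+1) are dominated by U times the tails, with U a bound
    of all the partial products. *)
Lemma Cprod_cv : exists l, Clim p l.
Proof.
  destruct Cprod_upper as (U & HU & HpU).
  destruct (tail_bound_cv (fun k => - (p k * a (S k))) (fun k => (U * t (S k))%R) 0) as [l Hl].
  - intros k _. rewrite Cmod_opp, Cmod_mult, <- Rmult_minus_distr_l.
    apply Rmult_le_compat; try apply Cmod_ge_0; [apply HpU|apply prod_t_step].
  - apply is_lim_seq_scal_0.
    apply -> (is_lim_seq_incr_1 t). now apply geom_tail_lim.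
  - exists (1 + l). apply Clim_ext with (fun n => 1 + sumn (fun k => - (p k * a (S k))) n).
    + intros n. induction n; unfold p in *; simpl; [ring|].
      rewrite Cplus_assoc, IHn. ring.
    + apply Clim_plus; [apply Clim_const|exact Hl].
Qed.

(** A bound uniform in n, not just a nonzero limit: these products become denominators of the finite
    identities and have to be bounded below in the majorants. Past n0 the remaining tail is at most
    1/2; the earlier products are finitely many and nonzero. *)
Lemma Cprod_lower :
  (forall k, (1 <= k)%nat -> 1 - a k <> 0) ->
  exists L, (0 < L)%R /\ forall n, (L <= Cmod (p n))%R.
Proof.
  intros Hn0.
  assert (Hp : forall n, (0 < Cmod (p n))%R).
  { intros n. apply Cmod_gt_0. apply Cprod_neq_0. intros; apply Hn0; lia. }
  assert (F : forall n0, exists L, (0 < L)%R /\ forall n, (n <= n0)%nat -> (L <= Cmod (p n))%R).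
  { induction n0 as [|n0 (L & HL & IH)].
    - exists (Cmod (p 0)). split; [apply Hp|]. intros n Hn. replace n with 0%nat by lia. lra.
    - exists (Rmin L (Cmod (p (S n0)))). split.
      + apply Rmin_glb_lt; auto.
      + intros n Hn. destruct (Nat.eq_dec n (S n0)) as [->|E]; [apply Rmin_r|].
        eapply Rle_trans; [apply Rmin_l|]. apply IH; lia. }
  destruct (proj1 (is_lim_seq_eps _ _) (geom_tail_lim c r Hr) (1 / 2)%R ltac:(lra)) as [n0 Hn].
  destruct (F n0) as (L & HL & HF).
  exists (L / 2)%R. split; [lra|]. intros n.
  destruct (Nat.le_gt_cases n n0) as [K|K]; [specialize (HF n K); lra|].
  assert (T0 : (t (S n0) <= 1 / 2)%R).
  { specialize (Hn (S n0) ltac:(lia)). fold (t (S n0)) in Hn. rewrite Rminus_0_r in Hn.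
    pose proof (Rle_abs (t (S n0))). lra. }
  (* Weierstrass' inequality: a product of factors 1 - x_k is at least 1 minus the sum of the
     x_k. *)
  assert (Q : forall m, (Cmod (p n0) * (1 - (t (S n0) - t (S (n0 + m)))) <= Cmod (p (n0 + m)))%R).
  { induction m.
    - rewrite Nat.add_0_r. lra.
    - rewrite Nat.add_succ_r. unfold p in *. simpl Cprod. rewrite Cmod_mult.
      pose proof (prod_t_step (S (n0 + m))) as S1.
      pose proof (proj1 (Cmod_1_minus_ge (a (S (n0 + m))))) as S2.
      pose proof (Cmod_ge_0 (a (S (n0 + m)))).
      pose proof (prod_t_nonneg (S (S (n0 + m)))).
      pose proof (prod_t_nonneg (S (n0 + m))).
      pose proof (Hp n0) as P0. unfold p in P0.
      set (A := Cmod (a (S (n0 + m)))) in *. set (P := Cmod (Cprod _ (n0 + m))) in *.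
      set (P1 := Cmod (Cprod _ n0)) in *. set (B := Cmod (1 - a (S (n0 + m)))) in *.
      set (t1 := t (S (S (n0 + m)))) in *. set (t2 := t (S (n0 + m))) in *.
      set (t3 := t (S n0)) in *.
      assert (DM : (t2 <= t3)%R).
      { unfold t2, t3. clear - Hr Ha. induction m; [rewrite Nat.add_0_r; lra|].
        rewrite Nat.add_succ_r. pose proof (prod_t_step (S (n0 + m))).
        pose proof (Cmod_ge_0 (a (S (n0 + m)))). lra. }
      apply Rle_trans with (P1 * (1 - (t3 - t2)) * (1 - A))%R.
      + rewrite Rmult_assoc. apply Rmult_le_compat_l; [lra|]. nra.
      + apply Rmult_le_compat; [|lra|exact IHm|lra]. apply Rmult_le_pos; lra. }
  specialize (Q (n - n0)%nat). replace (n0 + (n - n0))%nat with n in Q by lia.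
  pose proof (prod_t_nonneg (S n)). specialize (HF n0 (le_n _)).
  eapply Rle_trans; [|exact Q]. nra.
Qed.

End InfiniteProduct.

(* The q-Pochhammer symbol (x q; q)_n with x = e(u), and (x q; q)_oo. *)
Definition qpoch (tau u : C) : nat -> C := Cprod (fun k => 1 - expi (u + NtoC k * tau)).
Definition qpoch_inf (tau u : C) : C := CLim_seq (qpoch tau u).

Definition in_lattice (tau u : C) : Prop := exists m n : Z, u = ZtoC m + ZtoC n * tau.

Lemma Cmod_expi_nat (tau u : C) (k : nat) :
  Cmod (expi (u + NtoC k * tau)) = (Cmod (expi u) * Cmod (expi tau) ^ k)%R.
Proof.
  rewrite expi_add, Cmod_mult. f_equal. induction k.
  - simpl. change (ZtoC 0) with (RtoC 0). rewrite Cmult_0_l, expi_0, Cmod_1. reflexivity.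
  - rewrite ZtoC_succ, Cmult_plus_distr_r, expi_add, Cmod_mult, IHk, Cmult_1_l. simpl. ring.
Qed.

Lemma Cmod_expi_lt_1 (tau : C) : (0 < Im tau)%R -> (0 <= Cmod (expi tau) < 1)%R.
Proof.
  intros H. split; [apply Cmod_ge_0|]. rewrite Cmod_expi, <- exp_0. apply exp_increasing.
  pose proof PI_RGT_0. nra.
Qed.

Lemma qpoch_lim (tau u : C) : (0 < Im tau)%R -> Clim (qpoch tau u) (qpoch_inf tau u).
Proof.
  intros H.
  destruct (Cprod_cv (fun k => expi (u + NtoC k * tau)) (Cmod (expi u))
    (Cmod (expi tau)) (Cmod_expi_lt_1 tau H)) as [l Hl].
  { intros k. rewrite Cmod_expi_nat. lra. }
  unfold qpoch_inf. now rewrite (CLim_seq_eq (qpoch tau u) l Hl).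
Qed.

Lemma one_minus_eq_0 (x : C) : 1 - x = 0 -> x = 1.
Proof. intros E. replace x with (1 - (1 - x)) by ring. rewrite E. ring. Qed.

Lemma in_lattice_expi (tau u : C) (k : Z) : expi (u + ZtoC k * tau) = 1 -> in_lattice tau u.
Proof.
  intros H. apply expi_eq_1 in H. destruct H as [n Hn]. exists n, (- k)%Z.
  rewrite ZtoC_opp, <- Hn. ring.
Qed.

Lemma one_minus_neq_0 (tau u : C) (k : Z) : ~ in_lattice tau u -> 1 - expi (u + ZtoC k * tau) <> 0.
Proof.
  intros H E. apply H. apply (in_lattice_expi _ _ k). now apply one_minus_eq_0.
Qed.

Lemma one_minus_expi_neq_0 (tau x : C) : ~ in_lattice tau x -> 1 - expi x <> 0.
Proof.
  intros Hx. pose proof (one_minus_neq_0 tau x 0 Hx) as E. change (ZtoC 0) with (RtoC 0) in E.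
  now rewrite Cmult_0_l, Cplus_0_r in E.
Qed.

(** The alternative u = 0 serves (q)_oo: there u is a lattice point, but k >= 1 keeps u + k tau off
    the real axis. *)
Lemma qpoch_factor_neq_0 (tau u : C) (k : nat) :
  (0 < Im tau)%R -> ~ in_lattice tau u \/ u = 0 -> (1 <= k)%nat ->
  1 - expi (u + NtoC k * tau) <> 0.
Proof.
  intros Ht [H| ->] Hk; [now apply one_minus_neq_0|].
  intros E. apply one_minus_eq_0, expi_eq_1 in E. destruct E as [n Hn]. apply (f_equal Im) in Hn.
  destruct tau as [x y]. simpl in *. rewrite !Rmult_0_l, !Rplus_0_l, Rplus_0_r in Hn.
  assert (1 <= IZR (Z.of_nat k))%R by (apply IZR_le; lia). nra.
Qed.

Lemma qpoch_lower (tau u : C) : (0 < Im tau)%R -> ~ in_lattice tau u \/ u = 0 ->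
  exists L, (0 < L)%R /\ forall n, (L <= Cmod (qpoch tau u n))%R.
Proof.
  intros Ht H.
  apply (Cprod_lower (fun k => expi (u + NtoC k * tau)) (Cmod (expi u))
    (Cmod (expi tau)) (Cmod_expi_lt_1 tau Ht)).
  - intros k. rewrite Cmod_expi_nat. lra.
  - intros k Hk. now apply qpoch_factor_neq_0.
Qed.

Lemma qpoch_neq_0 (tau u : C) (n : nat) : (0 < Im tau)%R -> ~ in_lattice tau u \/ u = 0 -> qpoch tau u n <> 0.
Proof.
  intros Ht H. destruct (qpoch_lower tau u Ht H) as (L & HL & Hn).
  apply Cmod_gt_0. specialize (Hn n). lra.
Qed.

Lemma qpoch_inf_neq_0 (tau u : C) : (0 < Im tau)%R -> ~ in_lattice tau u \/ u = 0 -> qpoch_inf tau u <> 0.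
Proof.
  intros Ht H. destruct (qpoch_lower tau u Ht H) as (L & HL & Hn).
  apply Cmod_gt_0. apply Rlt_le_trans with L; [exact HL|].
  apply (Clim_abs_ge (qpoch tau u)); [exists 0%nat; auto|now apply qpoch_lim].
Qed.

Lemma in_lattice_opp (tau u : C) : in_lattice tau (- u) -> in_lattice tau u.
Proof.
  intros (m & n & H). exists (- m)%Z, (- n)%Z. rewrite !ZtoC_opp.
  replace u with (- - u) by ring. rewrite H. ring.
Qed.

(* (x; q)_oo (q / x; q)_oo with x = e(u); by the triple product this is the
   theta function divided by (q)_oo. *)
Definition theta_prod (tau u : C) : C := (1 - expi u) * qpoch_inf tau u * qpoch_inf tau (- u).

Lemma theta_prod_neq_0 (tau u : C) : (0 < Im tau)%R -> ~ in_lattice tau u -> theta_prod tau u <> 0.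
Proof.
  intros Ht H. unfold theta_prod. repeat apply Cmult_neq_0.
  - now apply (one_minus_expi_neq_0 tau).
  - apply qpoch_inf_neq_0; auto.
  - apply qpoch_inf_neq_0; auto. left. intros K; apply H. now apply in_lattice_opp.
Qed.

(** * A finite partial fraction identity *)

Fixpoint prodn (f : nat -> C) (n : nat) : C :=
  match n with O => 1 | S m => prodn f m * f m end.

Lemma prodn_S (f : nat -> C) (n : nat) : prodn f (S n) = prodn f n * f n.
Proof. reflexivity. Qed.

Lemma Cprod_S (f : nat -> C) (n : nat) : Cprod f (S n) = Cprod f n * f (S n).
Proof. reflexivity. Qed.

Lemma prodn_ext (f g : nat -> C) (n : nat) :
  (forall i, (i < n)%nat -> f i = g i) -> prodn f n = prodn g n.
Proof.
  induction n; simpl; intros H; [reflexivity|].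
  rewrite IHn, H by (auto with arith). reflexivity.
Qed.

Lemma prodn_mult (f g : nat -> C) (n : nat) :
  prodn (fun i => f i * g i) n = prodn f n * prodn g n.
Proof. induction n; simpl; [ring|rewrite IHn; ring]. Qed.

Lemma prodn_neq_0 (f : nat -> C) (n : nat) :
  (forall i, (i < n)%nat -> f i <> 0) -> prodn f n <> 0.
Proof.
  induction n; simpl; intros H; [apply C1_nz|].
  apply Cmult_neq_0; auto with arith.
Qed.

Lemma prodn_add (f : nat -> C) (n m : nat) :
  prodn f (n + m) = prodn f n * prodn (fun i => f (n + i)%nat) m.
Proof.
  induction m; simpl.
  - rewrite Nat.add_0_r. ring.
  - rewrite Nat.add_succ_r. simpl. rewrite IHm. ring.
Qed.

Lemma prodn_S_l (f : nat -> C) (n : nat) :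
  prodn f (S n) = f 0%nat * prodn (fun i => f (S i)) n.
Proof. change (S n) with (1 + n)%nat. rewrite prodn_add. simpl. ring. Qed.

Lemma prodn_rev (f : nat -> C) (n : nat) : prodn f n = prodn (fun k => f (n - 1 - k)%nat) n.
Proof.
  induction n; [reflexivity|]. rewrite (prodn_S_l (fun k => f (S n - 1 - k)%nat)).
  change (prodn f (S n)) with (prodn f n * f n). rewrite IHn.
  replace (S n - 1 - 0)%nat with n by lia. rewrite Cmult_comm. f_equal.
  apply prodn_ext. intros k Hk. f_equal. lia.
Qed.

Lemma prodn_Cprod (f : nat -> C) (n : nat) : prodn (fun i => f (S i)) n = Cprod f n.
Proof. induction n; simpl; [reflexivity|]. now rewrite IHn. Qed.

(** The product of the c i - c k over i <> k, i < n, split at k so that both halves are plain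
    products. *)
Definition node_prod (c : nat -> C) (k n : nat) : C :=
  prodn (fun i => c i - c k) k * prodn (fun i => c (k + 1 + i)%nat - c k) (n - k - 1).

Lemma Cminus_neq_0 (a b : C) : a <> b -> a - b <> 0.
Proof. intros H E. apply H. replace a with (a - b + b) by ring. rewrite E. ring. Qed.

Lemma node_prod_S (c : nat -> C) (k n : nat) : (k < n)%nat ->
  node_prod c k (S n) = node_prod c k n * (c n - c k).
Proof.
  intros H. unfold node_prod. replace (S n - k - 1)%nat with (S (n - k - 1)) by lia.
  simpl. replace (k + 1 + (n - k - 1))%nat with n by lia. ring.
Qed.

Lemma node_prod_neq_0 (c : nat -> C) (k n : nat) :
  (forall i j, (i < n)%nat -> (j < n)%nat -> i <> j -> c i <> c j) -> (k < n)%nat ->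
  node_prod c k n <> 0.
Proof.
  intros H Hk. unfold node_prod. apply Cmult_neq_0; apply prodn_neq_0; intros i Hi;
  apply Cminus_neq_0; apply H; lia.
Qed.

(** By induction on the number of nodes. The induction hypothesis is used at s and also at the new
    node c n; the second instance supplies the coefficient of 1 / (c n - s). With no node the
    identity would read 1 = 0. *)
Lemma partial_fractions (c : nat -> C) (n : nat) :
  (forall i j, (i < n)%nat -> (j < n)%nat -> i <> j -> c i <> c j) -> (0 < n)%nat ->
  forall s, (forall i, (i < n)%nat -> c i <> s) ->
  / prodn (fun i => c i - s) n = sumn (fun k => / ((c k - s) * node_prod c k n)) n.
Proof.
  induction n as [|n IH]; intros Hc Hn s Hs; [lia|].
  destruct (Nat.eq_dec n 0) as [->|N0].
  - unfold node_prod; simpl. rewrite Cplus_0_l. f_equal. ring.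
  - assert (Hc' : forall i j, (i < n)%nat -> (j < n)%nat -> i <> j -> c i <> c j).
    { intros; apply Hc; lia. }
    assert (IH' := IH Hc' ltac:(lia)).
    assert (E1 : / prodn (fun i => c i - s) n
                 = sumn (fun k => / ((c k - s) * node_prod c k n)) n) by auto.
    assert (E2 : / prodn (fun i => c i - c n) n
                 = sumn (fun k => / ((c k - c n) * node_prod c k n)) n).
    { apply IH'. intros i Hi. apply Hc; lia. }
    assert (NP : node_prod c n (S n) = prodn (fun i => c i - c n) n).
    { unfold node_prod. replace (S n - n - 1)%nat with 0%nat by lia. simpl. ring. }
    assert (Sn : c n - s <> 0) by (apply Cminus_neq_0; auto).
    assert (P1 : prodn (fun i => c i - s) n <> 0).
    { apply prodn_neq_0; intros; apply Cminus_neq_0; auto. }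
    assert (P2 : prodn (fun i => c i - c n) n <> 0).
    { apply prodn_neq_0; intros; apply Cminus_neq_0; apply Hc; lia. }
    change (prodn (fun i => c i - s) (S n)) with (prodn (fun i => c i - s) n * (c n - s)).
    change (sumn (fun k => / ((c k - s) * node_prod c k (S n))) (S n)) with
      (sumn (fun k => / ((c k - s) * node_prod c k (S n))) n
       + / ((c n - s) * node_prod c n (S n))).
    rewrite NP.
    replace (/ (prodn (fun i => c i - s) n * (c n - s)))
      with (/ (c n - s) * / prodn (fun i => c i - s) n) by (field; auto).
    replace (/ ((c n - s) * prodn (fun i => c i - c n) n))
      with (/ (c n - s) * / prodn (fun i => c i - c n) n) by (field; auto).
    rewrite E1, E2, <- !sumn_scal, <- sumn_plus. apply sumn_ext. intros k Hk.
    rewrite node_prod_S by assumption.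
    assert (node_prod c k n <> 0) by now apply node_prod_neq_0.
    assert (c k - s <> 0) by (apply Cminus_neq_0; auto).
    assert (c n - c k <> 0) by (apply Cminus_neq_0, Hc; lia).
    assert (c k - c n <> 0) by (apply Cminus_neq_0, Hc; lia).
    field. auto.
Qed.

(** Each factor is turned over by 1 - y = - y (1 - 1/y). The sign is written e(1/2), so that the
    prefactors collect in a single exponential. *)
Lemma prodn_below (tau u : C) (n : nat) :
  prodn (fun i => 1 - expi (u - NtoC (S i) * tau)) n
  = expi (NtoC n * (u + 1 / 2)
          - NtoC n * (NtoC n + 1) / 2 * tau) * qpoch tau (- u) n.
Proof.
  induction n.
  - simpl. change (ZtoC 0) with (RtoC 0).
    replace (0 * (u + 1 / 2) - 0 * (0 + 1) / 2 * tau) with (RtoC 0) by field.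
    rewrite expi_0. unfold qpoch. simpl. ring.
  - rewrite prodn_S, IHn. unfold qpoch. rewrite Cprod_S.
    set (P := Cprod _ n). rewrite !ZtoC_succ. set (m := NtoC n).
    replace (expi ((m + 1) * (u + 1 / 2) - (m + 1) * (m + 1 + 1) / 2 * tau))
      with (expi (m * (u + 1 / 2) - m * (m + 1) / 2 * tau) * (expi (1/2) * expi (u - (m + 1) * tau))).
    2:{ rewrite <- !expi_add. f_equal. field. }
    rewrite expi_half.
    replace (expi (- u + (m + 1) * tau)) with (/ expi (u - (m + 1) * tau)).
    2:{ rewrite <- expi_opp. f_equal. ring. }
    pose proof (expi_neq_0 (u - (m + 1) * tau)). field. assumption.
Qed.

Lemma prodn_above (tau u : C) (n : nat) :
  prodn (fun i => 1 - expi (u + NtoC i * tau)) (S n) = (1 - expi u) * qpoch tau u n.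
Proof.
  rewrite prodn_S_l. f_equal.
  - change (Z.of_nat 0) with 0%Z. change (ZtoC 0) with (RtoC 0). do 2 f_equal. ring.
  - apply (prodn_Cprod (fun i => 1 - expi (u + NtoC i * tau))).
Qed.

Lemma prodn_two_sided (tau u : C) (a b : nat) :
  prodn (fun i => 1 - expi (u + (NtoC i - NtoC a) * tau)) (a + S b)
  = expi (NtoC a * (u + 1 / 2)
          - NtoC a * (NtoC a + 1) / 2 * tau)
    * ((1 - expi u) * qpoch tau u b * qpoch tau (- u) a).
Proof.
  rewrite prodn_add, prodn_rev.
  rewrite (prodn_ext _ (fun i => 1 - expi (u - NtoC (S i) * tau)) a).
  2:{ intros i Hi. do 2 f_equal. unfold Cminus at 2. f_equal.
      replace (Z.of_nat (a - 1 - i)) with (Z.of_nat a - Z.of_nat (S i))%Z by lia.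
      zc. ring. }
  rewrite (prodn_ext _ (fun i => 1 - expi (u + NtoC i * tau)) (S b)).
  2:{ intros i Hi. do 3 f_equal. rewrite Nat2Z.inj_add. zc. ring. }
  rewrite prodn_below, prodn_above. ring.
Qed.

Lemma prodn_expi_lin (tau b : C) (m : nat) :
  prodn (fun i => expi ((b + NtoC i) * tau)) m
  = expi ((NtoC m * b + NtoC m * (NtoC m - 1) / 2) * tau).
Proof.
  induction m.
  - change (NtoC 0) with (RtoC 0). simpl prodn.
    replace ((0 * b + 0 * (0 - 1) / 2) * tau) with (RtoC 0) by field. now rewrite expi_0.
  - rewrite prodn_S, IHm, ZtoC_succ, <- expi_add. f_equal. field.
Qed.

(* With [t = q^(i - N)], the product [(1 - x t) (1 - y t)] is
   [t (1 / t + x y t - (x + y))]: the identity is a partial fraction expansion in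
   the variable [x + y], with nodes [1 / t + x y t]. *)
Section Finite.
Variables (tau u v : C).
Hypothesis Htau : (0 < Im tau)%R.
Hypothesis Hu : ~ in_lattice tau u.
Hypothesis Hv : ~ in_lattice tau v.
Hypothesis Hw : ~ in_lattice tau (u + v).
Variable N : nat.
Let NN := NtoC N.
Let t (i : nat) := expi ((NtoC i - NN) * tau).
Let c (i : nat) := / t i + expi (u + v) * t i.
Let s := expi u + expi v.

Lemma t_neq_0 i : t i <> 0.
Proof. apply expi_neq_0. Qed.

Lemma node_minus_s i :
  c i - s = / t i * (1 - expi (u + (NtoC i - NN) * tau))
            * (1 - expi (v + (NtoC i - NN) * tau)).
Proof.
  unfold c, s. rewrite !expi_add. fold (t i). pose proof (t_neq_0 i). field. assumption.
Qed.

(** With P = e(u + v), the difference of (1/a + P a) and (1/b + P b) factors as (1/a) (1 - a/b) (1 -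
    P a b). The companion for i < k pulls out - 1/t k instead, so that the quotient of the t's is in
    both cases a positive power of q. *)
Lemma node_diff_above i k :
  c (k + 1 + i)%nat - c k = / t (k + 1 + i) * (1 - expi (0 + NtoC (S i) * tau))
   * (1 - expi (u + v + (NtoC (k + 1 + i) - (2 * NN - NtoC k)) * tau)).
Proof.
  replace (expi (0 + NtoC (S i) * tau)) with (t (k + 1 + i) / t k).
  2:{ unfold t. rewrite <- expi_sub. f_equal.
      replace (Z.of_nat (k + 1 + i)) with (Z.of_nat k + Z.of_nat (S i))%Z by lia. zc. ring. }
  replace (expi (u + v + (NtoC (k + 1 + i) - (2 * NN - NtoC k)) * tau))
    with (expi (u + v) * t (k + 1 + i) * t k).
  2:{ unfold t. rewrite <- !expi_add. f_equal. ring. }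
  unfold c. pose proof (t_neq_0 k). pose proof (t_neq_0 (k + 1 + i)). field. auto.
Qed.

Lemma node_diff_below i k : (i < k)%nat ->
  c i - c k = (expi (1 / 2) * / t k) * (1 - expi (0 + NtoC (k - i) * tau))
   * (1 - expi (u + v + (NtoC i - (2 * NN - NtoC k)) * tau)).
Proof.
  intros Hi.
  replace (expi (0 + NtoC (k - i) * tau)) with (t k / t i).
  2:{ unfold t. rewrite <- expi_sub. f_equal.
      replace (Z.of_nat (k - i)) with (Z.of_nat k - Z.of_nat i)%Z by lia. zc. ring. }
  replace (expi (u + v + (NtoC i - (2 * NN - NtoC k)) * tau))
    with (expi (u + v) * t i * t k).
  2:{ unfold t. rewrite <- !expi_add. f_equal. ring. }
  rewrite expi_half.
  unfold c. pose proof (t_neq_0 k). pose proof (t_neq_0 i). field. auto.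
Qed.

Lemma node_distinct i j : i <> j -> c i <> c j.
Proof.
  assert (Q : forall i k, (i < k)%nat -> c i <> c k).
  { intros i0 k Hi E. assert (c i0 - c k = 0) as Z by (rewrite E; ring).
    rewrite node_diff_below in Z by assumption. revert Z.
    apply Cmult_neq_0; [apply Cmult_neq_0|].
    - apply Cmult_neq_0; [apply expi_neq_0|]. unfold t. rewrite <- expi_opp. apply expi_neq_0.
    - apply qpoch_factor_neq_0; auto. lia.
    - replace (NtoC i0 - (2 * NN - NtoC k))
        with (ZtoC (Z.of_nat i0 + Z.of_nat k - 2 * Z.of_nat N)) by (unfold NN; zc; ring).
      now apply one_minus_neq_0. }
  intros H. destruct (Nat.lt_total i j) as [L|[L|L]]; [auto|lia|].
  intros E. now apply (Q j i).
Qed.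

Lemma node_neq_s i : c i <> s.
Proof.
  intros E. assert (c i - s = 0) as Z by (rewrite E; ring). rewrite node_minus_s in Z. revert Z.
  replace (NtoC i - NN) with (ZtoC (Z.of_nat i - Z.of_nat N)) by (unfold NN; zc; ring).
  apply Cmult_neq_0; [apply Cmult_neq_0|].
  - unfold t. rewrite <- expi_opp. apply expi_neq_0.
  - now apply one_minus_neq_0.
  - now apply one_minus_neq_0.
Qed.

(** Among the factors 1 - P t_i t_k, P = e(u + v), only i = k is missing; multiplying by 1 - P t_k^2
    completes them to a two-sided product with m = 2N - k factors below and k above the central
    one. *)
Lemma node_prod_eq (k m : nat) : (k + m = 2 * N)%nat ->
  node_prod c k (2 * N + 1)
  * (1 - expi (u + v + 2 * (NtoC k - NN) * tau))
  = expi (NN * (u + v) - (NN * (NN + 1)) * tau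
          - (NtoC k - NN) * (u + v)
          - (NtoC k - NN) * (NtoC k - NN) * tau
          + (NtoC k - NN) * tau)
    * (qpoch tau 0 k * qpoch tau 0 m * ((1 - expi (u + v)) * qpoch tau (u + v) k * qpoch tau (- (u + v)) m)).
Proof.
  intros Hk. unfold node_prod. replace (2 * N + 1 - k - 1)%nat with m by lia.
  set (K := NtoC k). set (MM := NtoC m).
  assert (HM : MM = 2 * NN - K).
  { unfold MM, K, NN. replace (Z.of_nat m) with (2 * Z.of_nat N - Z.of_nat k)%Z by lia.
    zc. ring. }
  rewrite (prodn_ext (fun i => c i - c k) (fun i => (expi (1 / 2 - (K - NN) * tau)
     * (1 - expi (0 + NtoC (k - i) * tau)))
   * (1 - expi (u + v + (NtoC i - MM) * tau)))).
  2:{ intros i Hi. rewrite node_diff_below by assumption. rewrite HM. do 2 f_equal.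
      unfold t. rewrite <- expi_opp, <- expi_add. f_equal. }
  rewrite !prodn_mult.
  rewrite (prodn_ext (fun i => c (k + 1 + i)%nat - c k)
    (fun i => (expi ((NN - K - 1 + NtoC i - 2 * NtoC i) * tau) *
     (1 - expi (0 + NtoC (S i) * tau)))
   * (1 - expi (u + v + (NtoC (S k + i) - MM) * tau)))).
  2:{ intros i Hi. rewrite node_diff_above. rewrite HM. f_equal; [f_equal|].
      - unfold t. rewrite <- expi_opp. f_equal. rewrite !Nat2Z.inj_add. unfold K.
        zc. ring.
      - do 2 f_equal. replace (k + 1 + i)%nat with (S k + i)%nat by lia. reflexivity. }
  rewrite !prodn_mult.
  pose proof (prodn_two_sided tau (u + v) m k) as W.
  replace (m + S k)%nat with (S k + m)%nat in W by lia.
  rewrite prodn_add, prodn_S in W. fold MM in W.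
  replace (u + v + 2 * (K - NN) * tau) with (u + v + (K - MM) * tau).
  2:{ rewrite HM. ring. }
  set (W1 := prodn _ k) in W at 1.
  set (W2 := prodn _ m) in W at 1.
  fold K in W.
  fold W1 W2.
  assert (Q0 : prodn (fun _ : nat => expi (1 / 2 - (K - NN) * tau)) k
     = expi (K * (1 / 2 - (K - NN) * tau))).
  { unfold K at 2. generalize (1 / 2 - (K - NN) * tau) as y. intros y.
    clear. induction k.
    - simpl prodn. change (NtoC 0) with (RtoC 0). rewrite Cmult_0_l, expi_0. reflexivity.
    - rewrite prodn_S, IHk, ZtoC_succ, <- expi_add. f_equal. ring. }
  rewrite Q0.
  rewrite (prodn_rev (fun i => 1 - expi (0 + NtoC (k - i) * tau)) k).
  rewrite (prodn_ext _ (fun i => 1 - expi (0 + NtoC (S i) * tau)) k).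
  2:{ intros i Hi. replace (k - (k - 1 - i))%nat with (S i) by lia. reflexivity. }
  rewrite !(prodn_Cprod (fun i => 1 - expi (0 + NtoC i * tau))).
  fold (qpoch tau 0).
  rewrite (prodn_ext (fun i => expi ((NN - K - 1 + NtoC i - 2 * NtoC i) * tau))
     (fun i => expi ((1 + K - NN + NtoC i) * (- tau)))).
  2:{ intros i _. f_equal. ring. }
  rewrite prodn_expi_lin. fold MM.
  transitivity (expi (K * (1 / 2 - (K - NN) * tau))
    * expi ((MM * (1 + K - NN) + MM * (MM - 1) / 2) * - tau)
    * (qpoch tau 0 k * qpoch tau 0 m * (W1 * (1 - expi (u + v + (K - MM) * tau)) * W2))); [ring|].
  rewrite W.
  match goal with |- ?a * ?b * (?p * (?d * ?e)) = ?f * (?p * ?e) =>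
    transitivity ((a * b * d) * (p * e)); [ring|f_equal] end.
  rewrite <- !expi_add.
  (* The signs e(1/2), k + m = 2N in number, add up to the integer N in the exponent. *)
  rewrite <- (expi_add_Z (NN * (u + v) - NN * (NN + 1) * tau - (K - NN) * (u + v) - (K - NN) * (K - NN) * tau +
   (K - NN) * tau) (Z.of_nat N)). fold NN.
  f_equal. rewrite HM. field.
Qed.

(** The partial fraction expansion at s = e(u) + e(v), multiplied by 1 - e(u + v) and the prefactor
    L. For fixed j = k - N the last denominator tends to a constant as N grows, and the term in
    front of it is [kernel] at j. *)
Lemma finite_identity :
  (1 - expi (u + v)) / (((1 - expi u) * qpoch tau u N * qpoch tau (- u) N)
                      * ((1 - expi v) * qpoch tau v N * qpoch tau (- v) N))
  = sumn (fun k =>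
      (expi ((NtoC k - NN) * (u + v)
             + (NtoC k - NN) * (NtoC k - NN) * tau)
       * (1 - expi (u + v + 2 * (NtoC k - NN) * tau))
       / ((1 - expi (u + (NtoC k - NN) * tau))
          * (1 - expi (v + (NtoC k - NN) * tau))))
       / (qpoch tau 0 k * qpoch tau 0 (2 * N - k) * (qpoch tau (u + v) k * qpoch tau (- (u + v)) (2 * N - k))))
    (2 * N + 1).
Proof.
  pose proof (partial_fractions c (2 * N + 1) (fun i j _ _ => node_distinct i j) ltac:(lia) s
    (fun i _ => node_neq_s i)) as PF.
  rewrite (prodn_ext _ (fun i => expi ((NN + NtoC i - 2 * NtoC i) * tau) *
      (1 - expi (u + (NtoC i - NN) * tau))
            * (1 - expi (v + (NtoC i - NN) * tau)))) in PF.
  2:{ intros i _. rewrite node_minus_s. do 2 f_equal. unfold t. rewrite <- expi_opp. f_equal. ring. }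
  rewrite !prodn_mult in PF.
  replace (2 * N + 1)%nat with (N + S N)%nat in PF at 2 3 by lia.
  unfold NN in PF. rewrite !prodn_two_sided in PF. fold NN in PF.
  rewrite (prodn_ext _ (fun i => expi ((- NN + NtoC i) * - tau))) in PF.
  2:{ intros i _. f_equal. ring. }
  rewrite prodn_expi_lin in PF.
  assert (Hu' : ~ in_lattice tau (- u)) by (intros K; now apply Hu, in_lattice_opp).
  assert (Hv' : ~ in_lattice tau (- v)) by (intros K; now apply Hv, in_lattice_opp).
  assert (Hw' : ~ in_lattice tau (- (u + v))) by (intros K; now apply Hw, in_lattice_opp).
  pose proof (one_minus_expi_neq_0 tau) as one.
  set (Bu := (1 - expi u) * qpoch tau u N * qpoch tau (- u) N) in *.
  set (Bv := (1 - expi v) * qpoch tau v N * qpoch tau (- v) N) in *.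
  assert (NBu : Bu <> 0) by (unfold Bu; repeat apply Cmult_neq_0; auto; apply qpoch_neq_0; auto).
  assert (NBv : Bv <> 0) by (unfold Bv; repeat apply Cmult_neq_0; auto; apply qpoch_neq_0; auto).
  set (L := expi (NN * (u + v) - NN * (NN + 1) * tau)).
  assert (NL : L <> 0) by apply expi_neq_0.
  match type of PF with / ?X = _ => assert (EX : X = L * (Bu * Bv)) end.
  { match goal with |- ?a * (?b * _) * (?d * _) = _ =>
      transitivity ((a * b * d) * (Bu * Bv)); [ring|f_equal] end.
    rewrite <- !expi_add. unfold L.
    rewrite <- (expi_add_Z (NN * (u + v) - NN * (NN + 1) * tau) (Z.of_nat N)). f_equal.
    rewrite Nat2Z.inj_add, Nat2Z.inj_mul. fold NN. zc. fold NN.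
    change (NtoC 2) with (RtoC 2). change (NtoC 1) with (RtoC 1).
    field. }
  rewrite EX in PF.
  transitivity ((1 - expi (u + v)) * L * / (L * (Bu * Bv))); [field; auto|].
  rewrite PF, <- sumn_scal. apply sumn_ext. intros k Hk.
  pose proof (node_prod_eq k (2 * N - k) ltac:(lia)) as NP.
  rewrite node_minus_s. unfold t.
  replace (NtoC k - NN) with (ZtoC (Z.of_nat k - Z.of_nat N)) in * by (unfold NN; zc; ring).
  set (j := ZtoC (Z.of_nat k - Z.of_nat N)) in *.
  pose proof (one_minus_neq_0 tau u (Z.of_nat k - Z.of_nat N) Hu) as N1.
  pose proof (one_minus_neq_0 tau v (Z.of_nat k - Z.of_nat N) Hv) as N2.
  pose proof (one_minus_neq_0 tau (u + v) (2 * (Z.of_nat k - Z.of_nat N)) Hw) as N3.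
  replace (ZtoC (2 * (Z.of_nat k - Z.of_nat N))) with (2 * j) in N3.
  2:{ unfold j. rewrite (ZtoC_mult 2). reflexivity. }
  fold j in N1, N2.
  set (X := 1 - expi (u + v + 2 * j * tau)) in *.
  set (Y := qpoch tau 0 k * qpoch tau 0 (2 * N - k) *
     ((1 - expi (u + v)) * qpoch tau (u + v) k * qpoch tau (- (u + v)) (2 * N - k))) in *.
  pose proof (qpoch_neq_0 tau 0 k Htau (or_intror eq_refl)).
  pose proof (qpoch_neq_0 tau 0 (2 * N - k) Htau (or_intror eq_refl)).
  pose proof (qpoch_neq_0 tau _ k Htau (or_introl Hw)).
  pose proof (qpoch_neq_0 tau _ (2 * N - k) Htau (or_introl Hw')).
  pose proof (one _ Hw).
  assert (Y <> 0) by (unfold Y; repeat apply Cmult_neq_0; auto).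
  set (np := node_prod c k (2 * N + 1)) in *.
  assert (Enp : np = L * expi (- (j * (u + v) + j * j * tau)) * expi (j * tau) * Y / X).
  { replace np with (np * X / X) by (field; auto). rewrite NP. unfold L. f_equal.
    f_equal. rewrite <- !expi_add. f_equal. ring. }
  rewrite Enp, expi_opp. unfold Y.
  pose proof (expi_neq_0 (j * tau)).
  pose proof (expi_neq_0 (j * (u + v) + j * j * tau)).
  field. repeat split; auto.
Qed.

End Finite.

(** * The product formula and the Jacobi triple product *)

Lemma exp_neg_INR (k : nat) : exp (- INR k) = (exp (-1) ^ k)%R.
Proof.
  induction k; [simpl; rewrite Ropp_0; apply exp_0|].
  rewrite S_INR. replace (- (INR k + 1))%R with (-1 + - INR k)%R by ring.
  rewrite exp_plus, IHk. reflexivity.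
Qed.

Lemma exp_m1_lt_1 : (0 <= exp (-1) < 1)%R.
Proof.
  split; [left; apply exp_pos|]. rewrite <- exp_0. apply exp_increasing. lra.
Qed.

Lemma exp_le (x y : R) : (x <= y)%R -> (exp x <= exp y)%R.
Proof. intros [L|L]; [left; now apply exp_increasing|right; now f_equal]. Qed.

(** Once k Im tau >= |B| + 1, the quadratic part outweighs the linear one and the imaginary part of
    the exponent is at least k. The index k0 depends on alpha only through the bound B; this
    uniformity is what continuity of the theta function requires. *)
Lemma gauss_bound (tau : C) (B : R) : (0 < Im tau)%R ->
  exists k0, forall alpha, (Rabs (Im alpha) <= B)%R -> forall k, (k0 <= k)%nat ->
  (Cmod (expi (NtoC k * alpha + NtoC k * NtoC k * tau)) <= 1 * exp (-1) ^ k /\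
   Cmod (expi (ZtoC (- 1 - Z.of_nat k) * alpha + ZtoC (- 1 - Z.of_nat k) * ZtoC (- 1 - Z.of_nat k) * tau)) <= 1 * exp (-1) ^ k)%R.
Proof.
  intros Ht. destruct (INR_unbounded ((Rabs B + 1) / Im tau)%R) as [k0 Hk0].
  exists k0. intros alpha Ha k Hk. rewrite !Rmult_1_l, <- exp_neg_INR, !Cmod_expi.
  assert (K0 : (Rabs B + 1 <= INR k * Im tau)%R).
  { apply Rlt_le. apply (Rmult_lt_compat_r (Im tau)) in Hk0; [|assumption].
    unfold Rdiv in Hk0. rewrite Rmult_assoc, Rinv_l, Rmult_1_r in Hk0 by lra.
    eapply Rlt_le_trans; [exact Hk0|]. apply Rmult_le_compat_r; [lra|]. now apply le_INR. }
  assert (KB : (Rabs (Im alpha) <= Rabs B)%R) by (eapply Rle_trans; [exact Ha|apply Rle_abs]).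
  pose proof (pos_INR k) as P. pose proof PI2_3_2 as PP. unfold PI2 in PP.
  apply Rabs_le_between in KB.
  assert (I : forall a x y, Im (ZtoC a * x + ZtoC a * ZtoC a * y)
     = (IZR a * Im x + IZR a * IZR a * Im y)%R).
  { intros. destruct x, y. simpl. ring. }
  rewrite !I, minus_IZR, <- INR_IZR_INZ.
  assert (Q : forall x y, (0 <= x)%R -> (x <= y)%R -> (- (2 * PI * y) <= - x)%R).
  { intros. nra. }
  split; apply exp_le, Q; auto; nra.
Qed.

Lemma summable_gauss (tau alpha : C) : (0 < Im tau)%R ->
  summable (fun j => expi (ZtoC j * alpha + ZtoC j * ZtoC j * tau)).
Proof.
  intros Ht. destruct (gauss_bound tau (Rabs (Im alpha)) Ht) as [k0 H].
  apply (summable_geom _ 1 (exp (-1)) k0 exp_m1_lt_1). intros k Hk. apply H; [lra|exact Hk].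
Qed.

Lemma expi_nat_small (tau u : C) (eps : R) : (0 < Im tau)%R -> (0 < eps)%R ->
  exists n0, forall k, (n0 <= k)%nat -> (Cmod (expi (u + NtoC k * tau)) < eps)%R.
Proof.
  intros Ht He.
  assert (L : is_lim_seq (fun k => (Cmod (expi u) * Cmod (expi tau) ^ k)%R) 0%R).
  { apply is_lim_seq_scal_0. apply is_lim_seq_geom.
    pose proof (Cmod_expi_lt_1 tau Ht). rewrite Rabs_pos_eq; lra. }
  destruct (proj1 (is_lim_seq_eps _ _) L eps He) as [n0 H]. exists n0. intros k Hk.
  specialize (H k Hk). rewrite Rminus_0_r in H. rewrite Cmod_expi_nat.
  eapply Rle_lt_trans; [apply Rle_abs|exact H].
Qed.

(** The modulus of e(u + j tau) is below 1/2 for large j and above 2 for j near -oo. *)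
Lemma one_minus_large (tau u : C) : (0 < Im tau)%R ->
  exists n0, forall j, (Z.of_nat n0 <= Z.abs j)%Z -> (1 / 2 <= Cmod (1 - expi (u + ZtoC j * tau)))%R.
Proof.
  intros Ht.
  destruct (expi_nat_small tau u (1 / 2) Ht ltac:(lra)) as [n1 H1].
  destruct (expi_nat_small tau (- u) (1 / 2) Ht ltac:(lra)) as [n2 H2].
  exists (n1 + n2)%nat. intros j Hj. destruct (Z_le_gt_dec 0 j) as [L|L].
  - specialize (H1 (Z.to_nat j) ltac:(lia)). rewrite Z2Nat.id in H1 by lia.
    pose proof (proj1 (Cmod_1_minus_ge (expi (u + ZtoC j * tau)))). lra.
  - specialize (H2 (Z.to_nat (- j)) ltac:(lia)). rewrite Z2Nat.id in H2 by lia.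
    replace (- u + ZtoC (- j) * tau) with (- (u + ZtoC j * tau)) in H2 by (zc; ring).
    rewrite expi_opp, Cmod_inv in H2 by apply expi_neq_0.
    pose proof (proj2 (Cmod_1_minus_ge (expi (u + ZtoC j * tau)))).
    assert (0 < Cmod (expi (u + ZtoC j * tau)))%R by apply Cmod_gt_0, expi_neq_0.
    set (X := Cmod (expi (u + ZtoC j * tau))) in *.
    assert (/ X * X = 1)%R by (field; lra). nra.
Qed.

Definition Psi (tau u v : C) : C :=
  qpoch_inf tau 0 * qpoch_inf tau 0 * theta_prod tau (u + v) / (theta_prod tau u * theta_prod tau v).

(** The Gaussian expansion of the Kronecker function. It converges for all u, v off the lattice,
    whereas the Lambert series confines v to a strip. *)
Definition kernel (tau u v : C) (j : Z) : C :=
  expi (ZtoC j * (u + v) + ZtoC j * ZtoC j * tau) * (1 - expi (u + v + 2 * ZtoC j * tau))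
  / ((1 - expi (u + ZtoC j * tau)) * (1 - expi (v + ZtoC j * tau))).

Lemma Cmod_div_le (a b : C) (m : R) : (0 < m)%R -> (m <= Cmod b)%R ->
  (Cmod (a / b) <= / m * Cmod a)%R.
Proof.
  intros Hm Hb. assert (b <> 0) by (apply Cmod_gt_0; lra).
  rewrite Cmod_div, Rmult_comm by assumption. unfold Rdiv.
  apply Rmult_le_compat_l; [apply Cmod_ge_0|]. apply Rinv_le_contravar; lra.
Qed.

Lemma summable_kernel (tau u v : C) : (0 < Im tau)%R -> summable (kernel tau u v).
Proof.
  intros Ht.
  destruct (one_minus_large tau u Ht) as [n1 H1], (one_minus_large tau v Ht) as [n2 H2].
  apply (summable_le _ (fun j => expi (ZtoC j * (u + v) + ZtoC j * ZtoC j * tau)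
     + (- expi (u + v)) * expi (ZtoC j * (u + v + 2 * tau) + ZtoC j * ZtoC j * tau))
     (/ (1 / 2 * (1 / 2))) (n1 + n2)).
  - intros j Hj. unfold kernel.
    replace (expi (ZtoC j * (u + v) + ZtoC j * ZtoC j * tau) * (1 - expi (u + v + 2 * ZtoC j * tau)))
     with (expi (ZtoC j * (u + v) + ZtoC j * ZtoC j * tau)
     + (- expi (u + v)) * expi (ZtoC j * (u + v + 2 * tau) + ZtoC j * ZtoC j * tau)).
    2:{ replace (ZtoC j * (u + v + 2 * tau) + ZtoC j * ZtoC j * tau) with
         ((ZtoC j * (u + v) + ZtoC j * ZtoC j * tau) + 2 * ZtoC j * tau) by ring.
        rewrite !(expi_add _ (2 * ZtoC j * tau)). ring. }
    apply Cmod_div_le; [lra|]. rewrite Cmod_mult.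
    apply Rmult_le_compat; try lra; [apply H1|apply H2]; lia.
  - apply summable_plus; [|apply summable_scal]; now apply summable_gauss.
Qed.

Lemma filterlim_to_nat (j : Z) :
  filterlim (fun N => Z.to_nat (Z.of_nat N + j)) eventually eventually.
Proof.
  intros P [n0 H]. exists (n0 + Z.to_nat (- j))%nat. intros n Hn. apply H. lia.
Qed.

Lemma Clim_qpoch_shift (tau u : C) (j : Z) : (0 < Im tau)%R ->
  Clim (fun N => qpoch tau u (Z.to_nat (Z.of_nat N + j))) (qpoch_inf tau u).
Proof.
  intros Ht. apply (Clim_subseq (qpoch tau u)); [apply filterlim_to_nat|now apply qpoch_lim].
Qed.

(** The left side of [finite_identity] has two limits: as a quotient of products, and as a series by
    Tannery's theorem. The lower bounds of the Pochhammer symbols are uniform in their length, so a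
    multiple of [kernel] itself is the majorant. *)
Theorem sumZ_kernel (tau u v : C) : (0 < Im tau)%R -> ~ in_lattice tau u -> ~ in_lattice tau v ->
  ~ in_lattice tau (u + v) -> sumZ (kernel tau u v) (Psi tau u v).
Proof.
  intros Ht Hu Hv Hw.
  assert (Hw' : ~ in_lattice tau (- (u + v))) by (intros K; now apply Hw, in_lattice_opp).
  assert (Hu' : ~ in_lattice tau (- u)) by (intros K; now apply Hu, in_lattice_opp).
  assert (Hv' : ~ in_lattice tau (- v)) by (intros K; now apply Hv, in_lattice_opp).
  destruct (summable_sumZ _ (summable_kernel tau u v Ht)) as [T HT].
  set (D := qpoch_inf tau 0 * qpoch_inf tau 0 * (qpoch_inf tau (u + v) * qpoch_inf tau (- (u + v)))).
  set (den := fun N j => qpoch tau 0 (Z.to_nat (Z.of_nat N + j)) * qpoch tau 0 (Z.to_nat (Z.of_nat N - j))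
     * (qpoch tau (u + v) (Z.to_nat (Z.of_nat N + j)) * qpoch tau (- (u + v)) (Z.to_nat (Z.of_nat N - j)))).
  destruct (qpoch_lower tau 0 Ht (or_intror eq_refl)) as (L0 & HL0 & L0b).
  destruct (qpoch_lower tau _ Ht (or_introl Hw)) as (L1 & HL1 & L1b).
  destruct (qpoch_lower tau _ Ht (or_introl Hw')) as (L2 & HL2 & L2b).
  assert (PN0 := qpoch_inf_neq_0 tau 0 Ht (or_intror eq_refl)).
  assert (PN1 := qpoch_inf_neq_0 tau _ Ht (or_introl Hw)).
  assert (PN2 := qpoch_inf_neq_0 tau _ Ht (or_introl Hw')).
  assert (ND : D <> 0) by (unfold D; repeat apply Cmult_neq_0; auto).
  assert (E : Clim (fun N => (1 - expi (u + v)) / (((1 - expi u) * qpoch tau u N * qpoch tau (- u) N)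
                      * ((1 - expi v) * qpoch tau v N * qpoch tau (- v) N))) (T / D)).
  { apply (tanneryZ_le (fun N => truncate (fun j => kernel tau u v j / den N j) N)
      (fun j => / D * kernel tau u v j) (kernel tau u v)
      (/ (L0 * L0 * (L1 * L2))) 0 0).
    - now apply summable_kernel.
    - intros N j _ _. unfold truncate. destruct Z_le_dec as [_|_].
      + apply Cmod_div_le.
        * repeat apply Rmult_lt_0_compat; assumption.
        * unfold den. rewrite !Cmod_mult.
          repeat apply Rmult_le_compat; auto; try apply Rmult_le_pos; lra.
      + rewrite Cmod_0. apply Rmult_le_pos; [|apply Cmod_ge_0].
        left. apply Rinv_0_lt_compat. repeat apply Rmult_lt_0_compat; assumption.
    - intros j. apply Clim_ext_loc with (fun N => / den N j * kernel tau u v j).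
      { exists (Z.to_nat (Z.abs j)). intros N HN. unfold truncate.
        destruct Z_le_dec; [unfold Cdiv; ring|lia]. }
      apply Clim_mult; [|apply Clim_const]. apply Clim_inv; [exact ND|].
      unfold D, den. repeat apply Clim_mult; try now apply Clim_qpoch_shift.
    - intros N. rewrite (finite_identity tau u v Ht Hu Hv Hw N).
      pose proof (sumZ_truncate (fun j => kernel tau u v j / den N j) N) as K.
      match type of K with sumZ _ ?X => match goal with |- sumZ _ ?Y =>
        replace Y with X; [exact K|] end end.
      apply sumn_ext. intros k Hk. unfold kernel, den.
      replace (ZtoC (Z.of_nat k - Z.of_nat N)) with (NtoC k - NtoC N)
        by (zc; ring).
      replace (Z.to_nat (Z.of_nat N + (Z.of_nat k - Z.of_nat N))) with k by lia.
      replace (Z.to_nat (Z.of_nat N - (Z.of_nat k - Z.of_nat N))) with (2 * N - k)%nat by lia.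
      reflexivity.
    - unfold Cdiv. rewrite Cmult_comm. now apply sumZ_scal. }
  assert (E' : Clim (fun N => (1 - expi (u + v)) / (((1 - expi u) * qpoch tau u N * qpoch tau (- u) N)
                      * ((1 - expi v) * qpoch tau v N * qpoch tau (- v) N)))
             ((1 - expi (u + v)) / (theta_prod tau u * theta_prod tau v))).
  { apply Clim_div.
    - apply Cmult_neq_0; now apply theta_prod_neq_0.
    - apply Clim_const.
    - unfold theta_prod. repeat apply Clim_mult; try apply Clim_const; now apply qpoch_lim. }
  assert (EQ := Clim_unique _ _ _ E E').
  replace (Psi tau u v) with T; [exact HT|].
  replace T with (T / D * D) by (field; exact ND). rewrite EQ. unfold Psi, D.
  replace (theta_prod tau (u + v)) with ((1 - expi (u + v)) * qpoch_inf tau (u + v) * qpoch_inf tau (- (u + v)))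
    by reflexivity.
  field. split; now apply theta_prod_neq_0.
Qed.

(** The q-binomial coefficients, by the q-Pascal rule that weights the second term by q^(n-k); this
    is the rule met when a product is extended by its last factor 1 - x q^n. *)
Fixpoint gauss_binom (tau : C) (n k : nat) : C :=
  match n, k with
  | O, O => 1
  | O, S _ => 0
  | S _, O => 1
  | S n', S k' =>
      gauss_binom tau n' (S k') + expi ((NtoC n' - NtoC k') * tau) * gauss_binom tau n' k'
  end.

Lemma gauss_binom_gt (tau : C) (n k : nat) : (n < k)%nat -> gauss_binom tau n k = 0.
Proof.
  revert k. induction n; intros [|k] H; try lia; [reflexivity|].
  simpl. rewrite !IHn by lia. ring.
Qed.

Lemma gauss_binom_0_r (tau : C) (n : nat) : gauss_binom tau n 0 = 1.
Proof. destruct n; reflexivity. Qed.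

Lemma qpoch_S (tau u : C) (n : nat) :
  qpoch tau u (S n) = qpoch tau u n * (1 - expi (u + (NtoC n + 1) * tau)).
Proof. unfold qpoch. rewrite Cprod_S, ZtoC_succ. reflexivity. Qed.

Lemma gauss_binom_qpoch (tau : C) (n k : nat) : (k <= n)%nat ->
  gauss_binom tau n k * (qpoch tau 0 k * qpoch tau 0 (n - k)) = qpoch tau 0 n.
Proof.
  revert k. induction n; intros k Hk.
  - replace k with 0%nat by lia. unfold qpoch. simpl. ring.
  - destruct k as [|k].
    { rewrite gauss_binom_0_r, Nat.sub_0_r. unfold qpoch at 1. simpl Cprod. ring. }
    simpl gauss_binom. simpl Nat.sub.
    assert (IHk := IHn k ltac:(lia)).
    rewrite (qpoch_S _ _ n). rewrite <- IHk at 1. rewrite (qpoch_S _ _ k).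
    destruct (Nat.eq_dec k n) as [->|E].
    + rewrite gauss_binom_gt by lia. rewrite Nat.sub_diag.
      replace ((NtoC n - NtoC n) * tau) with (RtoC 0) by ring.
      rewrite expi_0. ring.
    + assert (IHk1 := IHn (S k) ltac:(lia)).
      replace (n - k)%nat with (S (n - S k)) in * by lia. rewrite (qpoch_S _ _ (n - S k)) in *.
      rewrite (qpoch_S _ _ k) in IHk1.
      replace (NtoC (n - S k) + 1) with (NtoC n - NtoC k) in *.
      2:{ replace (Z.of_nat (n - S k)) with (Z.of_nat n - Z.of_nat k - 1)%Z by lia. zc. ring. }
      set (nn := NtoC n) in *. set (kk := NtoC k) in *.
      replace (expi (0 + (nn + 1) * tau)) with (expi ((nn - kk) * tau) * expi (0 + (kk + 1) * tau)).
      2:{ rewrite <- expi_add. f_equal. ring. }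
      replace (expi (0 + (nn - kk) * tau)) with (expi ((nn - kk) * tau)) in * by (f_equal; ring).
      set (A := expi ((nn - kk) * tau)) in *. set (B := expi (0 + (kk + 1) * tau)) in *.
      transitivity ((gauss_binom tau n (S k) * (qpoch tau 0 k * (1 - B) * qpoch tau 0 (n - S k))) * (1 - A)
        + A * (1 - B) * (gauss_binom tau n k * (qpoch tau 0 k * (qpoch tau 0 (n - S k) * (1 - A))))); [ring|].
      rewrite IHk1, <- IHk. ring.
Qed.

Lemma q_binomial (tau u : C) (n : nat) :
  prodn (fun i => 1 - expi (u + NtoC i * tau)) n
  = sumn (fun k => expi (NtoC k * (u + 1 / 2)
        + NtoC k * (NtoC k - 1) / 2 * tau) * gauss_binom tau n k) (S n).
Proof.
  induction n.
  - simpl. change (ZtoC 0) with (RtoC 0).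
    replace (0 * (u + 1 / 2) + 0 * (0 - 1) / 2 * tau) with (RtoC 0) by field.
    rewrite expi_0. ring.
  - rewrite prodn_S, IHn. set (e := fun k : nat => expi (NtoC k * (u + 1 / 2)
        + NtoC k * (NtoC k - 1) / 2 * tau)).
    change (sumn (fun k => e k * gauss_binom tau n k) (S n) * (1 - expi (u + NtoC n * tau))
      = sumn (fun k => e k * gauss_binom tau (S n) k) (S (S n))).
    rewrite (sumn_S_l _ (S n)).
    rewrite (sumn_ext (fun k => e (S k) * gauss_binom tau (S n) (S k))
      (fun k => e (S k) * gauss_binom tau n (S k) + (- expi (u + NtoC n * tau)) * (e k * gauss_binom tau n k))).
    2:{ intros k Hk. simpl gauss_binom. rewrite Cmult_plus_distr_l. f_equal.
        replace (e (S k)) with (e k * (expi (1 / 2) * expi (u + NtoC k * tau))).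
        2:{ unfold e. rewrite <- !expi_add. f_equal. rewrite ZtoC_succ. field. }
        rewrite expi_half.
        replace (expi (u + NtoC n * tau)) with (expi (u + NtoC k * tau)
           * expi ((NtoC n - NtoC k) * tau)).
        2:{ rewrite <- expi_add. f_equal. ring. }
        ring. }
    rewrite sumn_plus, sumn_scal.
    replace (e 0%nat * gauss_binom tau (S n) 0 + (sumn (fun k => e (S k) * gauss_binom tau n (S k)) (S n)
       + - expi (u + NtoC n * tau) * sumn (fun k => e k * gauss_binom tau n k) (S n)))
     with ((e 0%nat * gauss_binom tau n 0 + sumn (fun k => e (S k) * gauss_binom tau n (S k)) (S n))
       + - expi (u + NtoC n * tau) * sumn (fun k => e k * gauss_binom tau n k) (S n)).
    2:{ rewrite !gauss_binom_0_r. ring. }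
    rewrite <- (sumn_S_l (fun k => e k * gauss_binom tau n k)).
    change (sumn (fun k => e k * gauss_binom tau n k) (S (S n))) with
      (sumn (fun k => e k * gauss_binom tau n k) (S n) + e (S n) * gauss_binom tau n (S n)).
    rewrite gauss_binom_gt by lia. ring.
Qed.

(** This is (-1)^j x^j q^(j(j-1)/2) with x = e(u), the sign being carried by 1/2 in the exponent. *)
Definition jtp_term (tau u : C) (j : Z) : C :=
  expi (ZtoC j * (u + 1 / 2) + (ZtoC j * ZtoC j - ZtoC j) / 2 * tau).

(** The q-binomial theorem with 2N + 2 factors, started at u - (N + 1) tau. The factor 1 - e(u)
    stands alone, which leaves N factors above it and N + 1 below. *)
Lemma finite_jtp (tau u : C) (N : nat) : (0 < Im tau)%R ->
  (1 - expi u) * qpoch tau u N * qpoch tau (- u) (S N)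
  = sumn (fun k => jtp_term tau u (Z.of_nat k - Z.of_nat (S N)) *
      (qpoch tau 0 (2 * S N) / (qpoch tau 0 k * qpoch tau 0 (2 * S N - k)))) (2 * S N + 1).
Proof.
  intros Ht. pose proof (q_binomial tau (u - NtoC (S N) * tau) (2 * S N)) as QB.
  pose proof (prodn_two_sided tau u (S N) N) as TS.
  replace (S N + S N)%nat with (2 * S N)%nat in TS by lia.
  rewrite (prodn_ext _ (fun i => 1 - expi (u - NtoC (S N) * tau + NtoC i * tau))) in TS.
  2:{ intros i _. do 2 f_equal. ring. }
  rewrite TS in QB. clear TS.
  rewrite Nat.add_1_r. set (NN := NtoC (S N)) in *.
  set (A := NN * (u + 1 / 2) - NN * (NN + 1) / 2 * tau) in *.
  set (X := (1 - expi u) * qpoch tau u N * qpoch tau (- u) (S N)) in *.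
  transitivity (expi (- A) * (expi A * X)).
  { rewrite expi_opp. pose proof (expi_neq_0 A). field. assumption. }
  rewrite QB, <- sumn_scal. apply sumn_ext. intros k Hk.
  rewrite <- (gauss_binom_qpoch tau (2 * S N) k) by lia.
  pose proof (qpoch_neq_0 tau 0 k Ht (or_intror eq_refl)).
  pose proof (qpoch_neq_0 tau 0 (2 * S N - k) Ht (or_intror eq_refl)).
  rewrite Cmult_assoc, <- expi_add.
  replace (gauss_binom tau (2 * S N) k * (qpoch tau 0 k * qpoch tau 0 (2 * S N - k)) /
    (qpoch tau 0 k * qpoch tau 0 (2 * S N - k))) with (gauss_binom tau (2 * S N) k) by (field; auto).
  f_equal. unfold jtp_term. f_equal.
  rewrite ZtoC_minus. fold NN. unfold A. field.
Qed.

Lemma jtp_term_gauss (tau u : C) (j : Z) :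
  jtp_term tau u j = expi (ZtoC j * (u + 1 / 2 - tau / 2) + ZtoC j * ZtoC j * (tau / 2)).
Proof. unfold jtp_term. f_equal. field. Qed.

Lemma Im_half (tau : C) : Im (tau / 2) = (Im tau / 2)%R.
Proof. destruct tau. simpl. field. Qed.

Lemma summable_jtp (tau u : C) : (0 < Im tau)%R -> summable (jtp_term tau u).
Proof.
  intros Ht. eapply summable_ext; [intros j; symmetry; apply jtp_term_gauss|].
  apply summable_gauss. rewrite Im_half. lra.
Qed.

(** As for [sumZ_kernel], the two limits of the finite form are compared. Here a product also stands
    in the numerator of the coefficients, whence the upper bound U. *)
Theorem jacobi_triple_product (tau u : C) : (0 < Im tau)%R ->
  sumZ (jtp_term tau u) (qpoch_inf tau 0 * theta_prod tau u).
Proof.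
  intros Ht. destruct (summable_sumZ _ (summable_jtp tau u Ht)) as [S0 HS].
  destruct (qpoch_lower tau 0 Ht (or_intror eq_refl)) as (L0 & HL0 & L0b).
  assert (PN0 := qpoch_inf_neq_0 tau 0 Ht (or_intror eq_refl)).
  destruct (Cprod_upper (fun k => expi (0 + NtoC k * tau)) (Cmod (expi 0))
    (Cmod (expi tau)) (Cmod_expi_lt_1 tau Ht)) as (U & HU & Hub).
  { intros k. rewrite Cmod_expi_nat. lra. }
  set (den := fun N j => qpoch tau 0 (2 * S N) / (qpoch tau 0 (Z.to_nat (Z.of_nat (S N) + j))
     * qpoch tau 0 (Z.to_nat (Z.of_nat (S N) - j)))).
  assert (E : Clim (fun N => (1 - expi u) * qpoch tau u N * qpoch tau (- u) (S N)) (/ qpoch_inf tau 0 * S0)).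
  { apply (tanneryZ_le (fun N => truncate (fun j => jtp_term tau u j * den N j) (S N))
      (fun j => / qpoch_inf tau 0 * jtp_term tau u j) (jtp_term tau u) (U * / (L0 * L0)) 0 0).
    - now apply summable_jtp.
    - intros N j _ _. unfold truncate. destruct Z_le_dec.
      + rewrite Cmod_mult, Rmult_comm. apply Rmult_le_compat_r; [apply Cmod_ge_0|].
        eapply Rle_trans; [apply (Cmod_div_le _ _ (L0 * L0))|].
        * now apply Rmult_lt_0_compat.
        * rewrite Cmod_mult. apply Rmult_le_compat; auto; lra.
        * rewrite Rmult_comm. apply Rmult_le_compat_r; [|apply Hub].
          left. apply Rinv_0_lt_compat. now apply Rmult_lt_0_compat.
      + rewrite Cmod_0. apply Rmult_le_pos; [|apply Cmod_ge_0].
        apply Rmult_le_pos; [lra|]. left. apply Rinv_0_lt_compat. now apply Rmult_lt_0_compat.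
    - intros j. apply Clim_ext_loc with (fun N => den N j * jtp_term tau u j).
      { exists (Z.to_nat (Z.abs j)). intros N HN. unfold truncate.
        destruct Z_le_dec; [ring|lia]. }
      apply Clim_mult; [|apply Clim_const].
      replace (/ qpoch_inf tau 0) with (qpoch_inf tau 0 / (qpoch_inf tau 0 * qpoch_inf tau 0)) by (field; exact PN0).
      unfold den. apply Clim_div; [now apply Cmult_neq_0| |].
      + apply (Clim_subseq (qpoch tau 0)); [|now apply qpoch_lim].
        intros P [n0 H]. exists n0. intros n Hn. apply H. lia.
      + apply -> (Clim_incr (fun N => qpoch tau 0 (Z.to_nat (Z.of_nat N + j))
          * qpoch tau 0 (Z.to_nat (Z.of_nat N - j)))).
        apply Clim_mult; [now apply Clim_qpoch_shift|apply (Clim_qpoch_shift tau 0 (- j) Ht)].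
    - intros N. rewrite (finite_jtp tau u N Ht).
      pose proof (sumZ_truncate (fun j => jtp_term tau u j * den N j) (S N)) as K.
      match type of K with sumZ _ ?X => match goal with |- sumZ _ ?Y =>
        replace Y with X; [exact K|] end end.
      apply sumn_ext. intros k Hk. unfold den.
      replace (Z.to_nat (Z.of_nat (S N) + (Z.of_nat k - Z.of_nat (S N)))) with k by lia.
      replace (Z.to_nat (Z.of_nat (S N) - (Z.of_nat k - Z.of_nat (S N)))) with (2 * S N - k)%nat by lia.
      reflexivity.
    - now apply sumZ_scal. }
  assert (E' : Clim (fun N => (1 - expi u) * qpoch tau u N * qpoch tau (- u) (S N)) (theta_prod tau u)).
  { unfold theta_prod. repeat apply Clim_mult; [apply Clim_const|now apply qpoch_lim|].
    apply -> Clim_incr. now apply qpoch_lim. }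
  rewrite <- (Clim_unique _ _ _ E E').
  replace (qpoch_inf tau 0 * (/ qpoch_inf tau 0 * S0)) with S0 by (field; exact PN0). exact HS.
Qed.

Lemma qpoch_inf_step (tau u : C) : (0 < Im tau)%R ->
  (1 - expi (u + tau)) * qpoch_inf tau (u + tau) = qpoch_inf tau u.
Proof.
  intros Ht. apply (Clim_unique (fun n => qpoch tau u (S n))).
  - apply Clim_ext with (fun n => (1 - expi (u + tau)) * qpoch tau (u + tau) n).
    + induction n.
      * unfold qpoch. simpl Cprod. change (Z.of_nat 1) with 1%Z. change (ZtoC 1) with (RtoC 1).
        replace (u + 1 * tau) with (u + tau) by ring. ring.
      * rewrite (qpoch_S _ _ (S n)), <- IHn, (qpoch_S _ (u + tau) n), ZtoC_succ.
        replace (u + tau + (NtoC n + 1) * tau)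
          with (u + (NtoC n + 1 + 1) * tau) by ring.
        ring.
    + apply Clim_scal. now apply qpoch_lim.
  - apply -> Clim_incr. now apply qpoch_lim.
Qed.

Lemma theta_prod_opp (tau u : C) : theta_prod tau (- u) = - expi (- u) * theta_prod tau u.
Proof.
  unfold theta_prod. replace (- - u) with u by ring. rewrite expi_opp.
  pose proof (expi_neq_0 u). field. assumption.
Qed.

Lemma theta_prod_add_tau (tau u : C) : (0 < Im tau)%R -> theta_prod tau (u + tau) = - expi (- u) * theta_prod tau u.
Proof.
  intros Ht. unfold theta_prod. rewrite (qpoch_inf_step tau u Ht).
  pose proof (qpoch_inf_step tau (- (u + tau)) Ht) as E.
  replace (- (u + tau) + tau) with (- u) in E by ring. rewrite <- E, expi_opp.
  pose proof (expi_neq_0 u). field. assumption.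
Qed.

Lemma qpoch_add_Z (tau u : C) (k : Z) (n : nat) : qpoch tau (u + ZtoC k) n = qpoch tau u n.
Proof.
  apply Cprod_ext. intros i _.
  replace (u + ZtoC k + NtoC i * tau) with (u + NtoC i * tau + ZtoC k) by ring.
  now rewrite expi_add_Z.
Qed.

Lemma qpoch_inf_add_Z (tau u : C) (k : Z) : (0 < Im tau)%R -> qpoch_inf tau (u + ZtoC k) = qpoch_inf tau u.
Proof.
  intros Ht. apply (Clim_unique (qpoch tau u)); [|now apply qpoch_lim].
  apply Clim_ext with (qpoch tau (u + ZtoC k)); [intros; apply qpoch_add_Z|now apply qpoch_lim].
Qed.

Lemma theta_prod_add_Z (tau u : C) (k : Z) : (0 < Im tau)%R -> theta_prod tau (u + ZtoC k) = theta_prod tau u.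
Proof.
  intros Ht. unfold theta_prod. rewrite expi_add_Z, qpoch_inf_add_Z by assumption.
  replace (- (u + ZtoC k)) with (- u + ZtoC (- k)) by (zc; ring). now rewrite qpoch_inf_add_Z.
Qed.

(** Continuity is read off the triple product series: along a convergent sequence the imaginary
    parts stay bounded, and [gauss_bound] gives one majorant for the whole sequence. *)
Lemma Clim_theta_prod (tau z : C) (u : nat -> C) : (0 < Im tau)%R -> Clim u z ->
  Clim (fun n => theta_prod tau (u n)) (theta_prod tau z).
Proof.
  intros Ht Hu. assert (PN0 := qpoch_inf_neq_0 tau 0 Ht (or_intror eq_refl)).
  assert (K : Clim (fun n => qpoch_inf tau 0 * theta_prod tau (u n)) (qpoch_inf tau 0 * theta_prod tau z)).
  { destruct (proj1 (is_lim_seq_eps _ _) (proj2 Hu) 1%R ltac:(lra)) as [K0 HK0].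
    assert (Ht2 : (0 < Im (tau / 2))%R) by (rewrite Im_half; lra).
    destruct (gauss_bound (tau / 2) (Rabs (Im z) + 1 + Rabs (Im (1 / 2 - tau / 2))) Ht2)
      as [k0 Hk0].
    apply (tanneryZ (fun n => jtp_term tau (u n)) (jtp_term tau z)
      (fun k => (1 * exp (-1) ^ k / (1 - exp (-1)))%R) k0 K0).
    - apply geom_tail_lim, exp_m1_lt_1.
    - intros K HK k Hk. rewrite geom_tail by apply exp_m1_lt_1.
      rewrite !jtp_term_gauss. apply Hk0; [|exact Hk].
      replace (u K + 1 / 2 - tau / 2) with ((u K - z) + (z + (1 / 2 - tau / 2))) by ring.
      specialize (HK0 K HK). simpl in HK0.
      change (Im (u K - z + (z + (1 / 2 - tau / 2)))) with
        ((Im (u K) - Im z) + (Im z + Im (1 / 2 - tau / 2)))%R.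
      eapply Rle_trans; [apply Rabs_triang|].
      pose proof (Rabs_triang (Im z) (Im (1 / 2 - tau / 2))). simpl in *. lra.
    - intros j. unfold jtp_term. apply Clim_expi.
      apply Clim_plus; [|apply Clim_const]. apply Clim_scal.
      apply Clim_plus; [exact Hu|apply Clim_const].
    - intros n. now apply jacobi_triple_product.
    - now apply jacobi_triple_product. }
  apply (Clim_scal (/ qpoch_inf tau 0)) in K.
  replace (/ qpoch_inf tau 0 * (qpoch_inf tau 0 * theta_prod tau z)) with (theta_prod tau z) in K by (field; exact PN0).
  eapply Clim_ext; [|exact K]. intros n. simpl. field. exact PN0.
Qed.

(** * Quasi-periodicity and the Lambert series *)

Lemma Psi_sym (tau u v : C) : Psi tau u v = Psi tau v u.
Proof. unfold Psi. rewrite (Cplus_comm u v), (Cmult_comm (theta_prod tau u)). reflexivity. Qed.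

Lemma in_lattice_shift (tau u : C) (a b : Z) : in_lattice tau (u + ZtoC a * tau + ZtoC b) -> in_lattice tau u.
Proof.
  intros (m & n & H). exists (m - b)%Z, (n - a)%Z. zc.
  replace u with (u + ZtoC a * tau + ZtoC b - ZtoC a * tau - ZtoC b) by ring. rewrite H. ring.
Qed.

Lemma not_in_lattice_shift (tau u : C) (a b : Z) : ~ in_lattice tau u -> ~ in_lattice tau (u + ZtoC a * tau + ZtoC b).
Proof. intros H K. apply H. now apply in_lattice_shift in K. Qed.

Lemma not_in_lattice_add_tau (tau u : C) : ~ in_lattice tau u -> ~ in_lattice tau (u + tau).
Proof.
  intros H. replace (u + tau) with (u + ZtoC 1 * tau + ZtoC 0) by (zc; ring).
  now apply not_in_lattice_shift.
Qed.

Section PsiFacts.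
Variables (tau u v : C).
Hypothesis Ht : (0 < Im tau)%R.
Hypothesis Hu : ~ in_lattice tau u.
Hypothesis Hv : ~ in_lattice tau v.

Lemma Psi_add_tau_r : Psi tau u (v + tau) = expi (- u) * Psi tau u v.
Proof.
  unfold Psi. rewrite Cplus_assoc, !theta_prod_add_tau by assumption.
  replace (- (u + v)) with (- u + - v) by ring. rewrite expi_add.
  pose proof (theta_prod_neq_0 tau u Ht Hu). pose proof (theta_prod_neq_0 tau v Ht Hv).
  pose proof (expi_neq_0 (- v)). field. auto.
Qed.

Lemma Psi_add_Z_r (k : Z) : Psi tau u (v + ZtoC k) = Psi tau u v.
Proof. unfold Psi. rewrite Cplus_assoc, !theta_prod_add_Z by assumption. reflexivity. Qed.

Lemma Psi_opp : Psi tau (- u) (- v) = - Psi tau u v.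
Proof.
  unfold Psi. replace (- u + - v) with (- (u + v)) by ring. rewrite !theta_prod_opp.
  replace (- (u + v)) with (- u + - v) by ring. rewrite expi_add.
  pose proof (theta_prod_neq_0 tau u Ht Hu). pose proof (theta_prod_neq_0 tau v Ht Hv).
  pose proof (expi_neq_0 (- v)). pose proof (expi_neq_0 (- u)). field. auto.
Qed.

Lemma Psi_neq_0 : ~ in_lattice tau (u + v) -> Psi tau u v <> 0.
Proof.
  intros Hw. assert (PN0 := qpoch_inf_neq_0 tau 0 Ht (or_intror eq_refl)).
  unfold Psi. apply Cmult_neq_0.
  - apply Cmult_neq_0; [now apply Cmult_neq_0|now apply theta_prod_neq_0].
  - intros E. pose proof (Cinv_r (theta_prod tau u * theta_prod tau v)) as K. rewrite E, Cmult_0_r in K.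
    apply C1_nz. symmetry. apply K. apply Cmult_neq_0; now apply theta_prod_neq_0.
Qed.

End PsiFacts.

Lemma Psi_add_tau_l (tau u v : C) : (0 < Im tau)%R -> ~ in_lattice tau u -> ~ in_lattice tau v ->
  Psi tau (u + tau) v = expi (- v) * Psi tau u v.
Proof. intros. rewrite Psi_sym, Psi_add_tau_r by assumption. now rewrite Psi_sym. Qed.

Lemma Psi_add_Z_l (tau u v : C) (k : Z) : (0 < Im tau)%R ->
  Psi tau (u + ZtoC k) v = Psi tau u v.
Proof. intros. rewrite Psi_sym, Psi_add_Z_r by assumption. now rewrite Psi_sym. Qed.

(** Induction in both directions. It spreads a quasi-periodicity, whose factor is invertible and
    thus gives an equivalence, from one period to all multiples. *)
Lemma Z_ind_step (P : Z -> Prop) :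
  P 0%Z -> (forall k, P k <-> P (k + 1)%Z) -> forall k, P k.
Proof.
  intros H0 H.
  assert (N : forall n, P (Z.of_nat n) /\ P (- Z.of_nat n)%Z).
  { induction n as [|n [IH1 IH2]]; [split; exact H0|]. split.
    - rewrite Nat2Z.inj_succ. apply (proj1 (H _)), IH1.
    - apply (proj2 (H _)). replace (- Z.of_nat (S n) + 1)%Z with (- Z.of_nat n)%Z by lia.
      exact IH2. }
  intros k. destruct (Z_le_gt_dec 0 k) as [L|L].
  - rewrite <- (Z2Nat.id k) by lia. apply N.
  - replace k with (- Z.of_nat (Z.to_nat (- k)))%Z by lia. apply N.
Qed.

Lemma Psi_add_lattice_r (tau u v : C) (a b : Z) : (0 < Im tau)%R -> ~ in_lattice tau u -> ~ in_lattice tau v ->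
  Psi tau u (v + ZtoC a * tau + ZtoC b) = expi (- (ZtoC a * u)) * Psi tau u v.
Proof.
  intros Ht Hu Hv. rewrite Psi_add_Z_r by assumption. revert a. apply Z_ind_step.
  - zc. replace (v + 0 * tau) with v by ring. replace (- (0 * u)) with (RtoC 0) by ring.
    rewrite expi_0. ring.
  - intros k. assert (Hk : ~ in_lattice tau (v + ZtoC k * tau)).
    { replace (v + ZtoC k * tau) with (v + ZtoC k * tau + ZtoC 0) by (zc; ring).
      now apply not_in_lattice_shift. }
    replace (v + ZtoC (k + 1) * tau) with (v + ZtoC k * tau + tau) by (zc; ring).
    rewrite Psi_add_tau_r by assumption.
    replace (- (ZtoC (k + 1) * u)) with (- u + - (ZtoC k * u)) by (zc; ring).
    rewrite (expi_add (- u) _). pose proof (expi_neq_0 (- u)). split; intros E.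
    + rewrite E. ring.
    + replace (Psi tau u (v + ZtoC k * tau)) with
        (/ expi (- u) * (expi (- u) * Psi tau u (v + ZtoC k * tau))) by (field; assumption).
      rewrite E. field. assumption.
Qed.

Lemma Clim_Psi (tau u v : C) (a b : nat -> C) : (0 < Im tau)%R -> ~ in_lattice tau u -> ~ in_lattice tau v ->
  Clim a u -> Clim b v -> Clim (fun n => Psi tau (a n) (b n)) (Psi tau u v).
Proof.
  intros Ht Hu Hv Ha Hb. unfold Psi. apply Clim_div.
  - apply Cmult_neq_0; now apply theta_prod_neq_0.
  - apply Clim_scal. apply Clim_theta_prod; [assumption|now apply Clim_plus].
  - apply Clim_mult; now apply Clim_theta_prod.
Qed.

Lemma geom_expi (x : C) (n : nat) : 1 - expi x <> 0 ->
  sumn (fun k => expi (NtoC k * x)) n = (1 - expi (NtoC n * x)) / (1 - expi x).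
Proof.
  intros H. induction n.
  - simpl. change (ZtoC 0) with (RtoC 0). rewrite Cmult_0_l, expi_0. field. assumption.
  - change (sumn ?a (S ?n)) with (sumn a n + a n). rewrite IHn, ZtoC_succ, Cmult_plus_distr_r, expi_add.
    rewrite Cmult_1_l. field. assumption.
Qed.

(* Durfee's splitting: [y^n / (1 - x q^n)] is the sum of the [x^m y^n q^(m n)] over
   [m < n] and of a remainder; summing first over [n] in the former gives the
   Gaussian series. *)
Section LambertHalf.
Variables (tau u v : C).
Hypothesis Ht : (0 < Im tau)%R.
Hypothesis Hu : ~ in_lattice tau u.
Hypothesis Hv : (0 < Im v)%R.
Let b (n : nat) := expi (NtoC n * v) / (1 - expi (u + NtoC n * tau)).
Let c (k : nat) := expi (NtoC k * (u + v) + NtoC k * NtoC k * tau)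
  * (/ (1 - expi (u + NtoC k * tau))
     + expi (v + NtoC k * tau) / (1 - expi (v + NtoC k * tau))).
Let e (n k : nat) := expi (NtoC k * u + NtoC n * (v + NtoC k * tau))
  / (1 - expi (v + NtoC k * tau)).

Lemma v_den_large (k : nat) :
  (1 - Cmod (expi v) <= Cmod (1 - expi (v + NtoC k * tau)))%R.
Proof.
  eapply Rle_trans; [|apply (proj1 (Cmod_1_minus_ge _))]. rewrite Cmod_expi_nat.
  pose proof (Cmod_ge_0 (expi v)). pose proof (Cmod_expi_lt_1 tau Ht).
  assert (Cmod (expi tau) ^ k <= 1)%R.
  { rewrite <- (pow1 k). apply pow_incr. lra. }
  assert (Cmod (expi v) * Cmod (expi tau) ^ k <= Cmod (expi v) * 1)%R
    by (apply Rmult_le_compat_l; assumption).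
  lra.
Qed.

Lemma v_den_neq_0 (k : nat) : 1 - expi (v + NtoC k * tau) <> 0.
Proof.
  apply Cmod_gt_0. pose proof (v_den_large k). pose proof (Cmod_expi_lt_1 v Hv). lra.
Qed.

(** The remainder [e n k] is the tail, over n' >= n, of the geometric series of x^k y^n' q^(k n')
    with x = e(u), y = e(v). Raising n by one therefore removes the terms n' = n, which form a
    geometric sum over k. *)
Lemma lambert_half_finite (n : nat) : sumn b n = sumn c n - sumn (e n) n.
Proof.
  induction n.
  - simpl. ring.
  - change (sumn b n + b n = sumn c n + c n - (sumn (e (S n)) n + e (S n) n)). rewrite IHn.
    assert (E : sumn (e n) n - sumn (e (S n)) n
       = expi (NtoC n * v) * sumn (fun k => expi (NtoC k * (u + NtoC n * tau))) n).
    { transitivity (sumn (fun k => e n k + (- 1) * e (S n) k) n).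
      { rewrite sumn_plus, sumn_scal. ring. }
      rewrite <- sumn_scal. apply sumn_ext. intros k Hk. unfold e. rewrite ZtoC_succ, <- expi_add.
      set (K := NtoC k). set (NN := NtoC n).
      replace (K * u + (NN + 1) * (v + K * tau)) with ((K * u + NN * (v + K * tau)) + (v + K * tau))
        by ring.
      rewrite (expi_add _ (v + K * tau)).
      replace (NN * v + K * (u + NN * tau)) with (K * u + NN * (v + K * tau)) by ring.
      pose proof (v_den_neq_0 k). fold K in H. field. assumption. }
    assert (D := one_minus_neq_0 tau u (Z.of_nat n) Hu).
    rewrite geom_expi in E by exact D.
    assert (E2 : c n - e (S n) n = expi (NtoC n * v)
      * expi (NtoC n * (u + NtoC n * tau)) / (1 - expi (u + NtoC n * tau))).
    { unfold c, e. rewrite ZtoC_succ. set (NN := NtoC n) in *.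
      replace (NN * u + (NN + 1) * (v + NN * tau)) with ((NN * (u + v) + NN * NN * tau) + (v + NN * tau)) by ring.
      rewrite (expi_add _ (v + NN * tau)), <- (expi_add (NN * v)).
      replace (NN * v + NN * (u + NN * tau)) with (NN * (u + v) + NN * NN * tau) by ring.
      pose proof (v_den_neq_0 n). fold NN in H. field. auto. }
    transitivity (sumn c n - sumn (e n) n + ((sumn (e n) n - sumn (e (S n)) n) + (c n - e (S n) n)));
      [|ring].
    f_equal. rewrite E, E2. unfold b. field. exact D.
Qed.

(** Past n0 the ratio |e(u + n tau)| is below 1/2, so the sum over k is bounded by a geometric
    series independent of n, and the common factor |e(v)|^n tends to 0. *)
Lemma lambert_half_error : Clim (fun n => sumn (e n) n) 0.
Proof.
  pose proof (Cmod_expi_lt_1 v Hv) as Y.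
  set (d := (1 - Cmod (expi v))%R).
  destruct (expi_nat_small tau u (1 / 2) Ht ltac:(lra)) as [n0 Hn0].
  apply Clim_0_le with (fun n => (2 / d * Cmod (expi v) ^ n)%R).
  - exists n0. intros n Hn.
    assert (Q : forall m, (Cmod (sumn (e n) m) <= (2 - 2 * (1 / 2) ^ m) / d * Cmod (expi v) ^ n)%R).
    { induction m.
      - simpl sumn. rewrite Cmod_0. simpl pow. right. unfold Rdiv. ring.
      - change (sumn (e n) (S m)) with (sumn (e n) m + e n m).
        eapply Rle_trans; [apply Cmod_triangle|].
        apply Rle_trans with ((2 - 2 * (1 / 2) ^ m) / d * Cmod (expi v) ^ n + / d * ((1 / 2) ^ m * Cmod (expi v) ^ n))%R.
        + apply Rplus_le_compat; [exact IHm|]. unfold e.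
          eapply Rle_trans; [apply (Cmod_div_le _ _ d); [unfold d; lra|apply v_den_large]|].
          apply Rmult_le_compat_l; [left; apply Rinv_0_lt_compat; unfold d; lra|].
          replace (NtoC m * u + NtoC n * (v + NtoC m * tau))
           with ((0 + NtoC m * (u + NtoC n * tau)) + (0 + NtoC n * v)) by ring.
          rewrite expi_add, Cmod_mult, (Cmod_expi_nat _ 0), (Cmod_expi_nat v 0), expi_0, Cmod_1, !Rmult_1_l.
          apply Rmult_le_compat_r; [apply pow_le, Cmod_ge_0|].
          apply pow_incr. split; [apply Cmod_ge_0|]. left. now apply Hn0.
        + right. simpl pow. unfold d. field. lra. }
    eapply Rle_trans; [apply (Q n)|]. apply Rmult_le_compat_r; [apply pow_le, Cmod_ge_0|].
    apply Rmult_le_compat_r; [left; apply Rinv_0_lt_compat; unfold d; lra|].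
    assert (0 <= (1 / 2) ^ n)%R by (apply pow_le; lra). lra.
  - apply is_lim_seq_scal_0. apply is_lim_seq_geom.
    rewrite Rabs_pos_eq; lra.
Qed.

Lemma lambert_half : Clim (fun n => sumn b n - sumn c n) 0.
Proof.
  apply Clim_ext with (fun n => - sumn (e n) n).
  - intros n. rewrite lambert_half_finite. ring.
  - replace (RtoC 0) with (- 0) by ring. apply Clim_opp, lambert_half_error.
Qed.

End LambertHalf.

Definition lambert (tau u v : C) (n : Z) : C :=
  expi (ZtoC n * v) / (1 - expi (u + ZtoC n * tau)).

Lemma strip_not_in_lattice (tau v : C) : (0 < Im v < Im tau)%R -> ~ in_lattice tau v.
Proof.
  intros H (m & n & E). rewrite E in H. destruct tau as [x y]. simpl in H.
  replace (0 + (IZR n * y + 0 * x))%R with (IZR n * y)%R in H by ring.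
  assert (0 < IZR n < 1)%R as [A B] by (split; nra).
  apply lt_IZR in A. apply (lt_IZR n 1) in B. lia.
Qed.

(** The reflection n -> -1 - n makes the negative half a positive half at (tau - u, tau - v). The
    factor is the same as in [kernel_neg], so [lambert_half] serves both halves; its hypothesis
    there is Im v < Im tau. *)
Lemma lambert_neg (tau u v : C) (n : nat) : ~ in_lattice tau u ->
  lambert tau u v (- 1 - Z.of_nat n)
  = - expi (tau - u - v) *
    (expi (NtoC n * (tau - v)) / (1 - expi ((tau - u) + NtoC n * tau))).
Proof.
  intros Hu. unfold lambert. pose proof (one_minus_neq_0 tau u (- 1 - Z.of_nat n) Hu) as D.
  replace (expi (tau - u + NtoC n * tau)) with
    (/ expi (u + ZtoC (- 1 - Z.of_nat n) * tau)).
  2:{ rewrite <- expi_opp. f_equal. zc. ring. }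
  replace (expi (ZtoC (- 1 - Z.of_nat n) * v)) with (expi (tau - u - v) * expi (NtoC n * (tau - v))
    * expi (u + ZtoC (- 1 - Z.of_nat n) * tau)).
  2:{ rewrite <- !expi_add. f_equal. zc. ring. }
  pose proof (expi_neq_0 (u + ZtoC (-1 - Z.of_nat n) * tau)) as N.
  set (X := expi (u + ZtoC (-1 - Z.of_nat n) * tau)) in *.
  assert (X - 1 <> 0). { intros E. apply D. replace (1 - X) with (- (X - 1)) by ring. rewrite E. ring. }
  field. repeat split; auto.
Qed.

Lemma kernel_pos (tau u v : C) (n : nat) : ~ in_lattice tau u -> ~ in_lattice tau v ->
  kernel tau u v (Z.of_nat n) =
  expi (NtoC n * (u + v) + NtoC n * NtoC n * tau)
  * (/ (1 - expi (u + NtoC n * tau))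
     + expi (v + NtoC n * tau) / (1 - expi (v + NtoC n * tau))).
Proof.
  intros Hu Hv. unfold kernel. set (N := NtoC n).
  replace (expi (u + v + 2 * N * tau)) with (expi (u + N * tau) * expi (v + N * tau)).
  2:{ rewrite <- expi_add. f_equal. ring. }
  pose proof (one_minus_neq_0 tau u (Z.of_nat n) Hu). pose proof (one_minus_neq_0 tau v (Z.of_nat n) Hv).
  fold N in H, H0. field. auto.
Qed.

Lemma kernel_neg (tau u v : C) (n : nat) : ~ in_lattice tau u -> ~ in_lattice tau v ->
  kernel tau u v (- 1 - Z.of_nat n) = - expi (tau - u - v) *
  (expi (NtoC n * ((tau - u) + (tau - v)) + NtoC n * NtoC n * tau)
  * (/ (1 - expi ((tau - u) + NtoC n * tau))
     + expi ((tau - v) + NtoC n * tau) / (1 - expi ((tau - v) + NtoC n * tau)))).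
Proof.
  intros Hu Hv. unfold kernel.
  pose proof (one_minus_neq_0 tau u (- 1 - Z.of_nat n) Hu) as D1.
  pose proof (one_minus_neq_0 tau v (- 1 - Z.of_nat n) Hv) as D2.
  replace (expi (u + v + 2 * ZtoC (- 1 - Z.of_nat n) * tau)) with
    (expi (u + ZtoC (- 1 - Z.of_nat n) * tau) * expi (v + ZtoC (- 1 - Z.of_nat n) * tau)).
  2:{ rewrite <- expi_add. f_equal. ring. }
  replace (expi (tau - u + NtoC n * tau)) with
    (/ expi (u + ZtoC (- 1 - Z.of_nat n) * tau)).
  2:{ rewrite <- expi_opp. f_equal. zc. ring. }
  replace (expi (tau - v + NtoC n * tau)) with
    (/ expi (v + ZtoC (- 1 - Z.of_nat n) * tau)).
  2:{ rewrite <- expi_opp. f_equal. zc. ring. }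
  replace (expi (ZtoC (- 1 - Z.of_nat n) * (u + v) + ZtoC (- 1 - Z.of_nat n) * ZtoC (- 1 - Z.of_nat n) * tau))
   with (expi (tau - u - v) * expi (NtoC n * ((tau - u) + (tau - v)) + NtoC n * NtoC n * tau)).
  2:{ rewrite <- !expi_add. f_equal. zc. ring. }
  pose proof (expi_neq_0 (u + ZtoC (-1 - Z.of_nat n) * tau)) as N1.
  pose proof (expi_neq_0 (v + ZtoC (-1 - Z.of_nat n) * tau)) as N2.
  set (X := expi (u + ZtoC (-1 - Z.of_nat n) * tau)) in *.
  set (Y := expi (v + ZtoC (-1 - Z.of_nat n) * tau)) in *.
  assert (X - 1 <> 0). { intros E. apply D1. replace (1 - X) with (- (X - 1)) by ring. rewrite E. ring. }
  assert (Y - 1 <> 0). { intros E. apply D2. replace (1 - Y) with (- (Y - 1)) by ring. rewrite E. ring. }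
  field. repeat split; auto.
Qed.

Lemma not_in_lattice_tau_minus (tau u : C) : ~ in_lattice tau u -> ~ in_lattice tau (tau - u).
Proof.
  intros H. replace (tau - u) with (- u + tau) by ring. apply not_in_lattice_add_tau.
  intros K. now apply H, in_lattice_opp.
Qed.

(** The Lambert series is not compared with [kernel] term by term: on each half the difference of
    the partial sums tends to 0. *)
Theorem sumZ_lambert (tau u v : C) : (0 < Im v < Im tau)%R -> ~ in_lattice tau u ->
  ~ in_lattice tau (u + v) -> sumZ (lambert tau u v) (Psi tau u v).
Proof.
  intros Hv Hu Hw. assert (Ht : (0 < Im tau)%R) by lra.
  pose proof (strip_not_in_lattice _ _ Hv) as Hv'.
  pose proof (sumZ_kernel tau u v Ht Hu Hv' Hw) as K.
  assert (I : (0 < Im (tau - v))%R) by (destruct tau, v; simpl in *; lra).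
  pose proof (lambert_half tau u v Ht Hu (proj1 Hv)) as A.
  pose proof (lambert_half tau (tau - u) (tau - v) Ht (not_in_lattice_tau_minus _ _ Hu) I) as B.
  apply (Clim_scal (- expi (tau - u - v))) in B.
  pose proof (Clim_plus _ _ _ _ K (Clim_plus _ _ _ _ A B)) as D.
  replace (Psi tau u v) with (Psi tau u v + (0 + - expi (tau - u - v) * 0)) by ring.
  eapply Clim_ext; [|exact D]. intros n. cbv beta. unfold SZ. rewrite !sumn_plus.
  rewrite (sumn_ext _ _ n (fun k _ => kernel_pos tau u v k Hu Hv')).
  rewrite (sumn_ext _ _ n (fun k _ => kernel_neg tau u v k Hu Hv')).
  rewrite (sumn_ext _ _ n (fun k _ => lambert_neg tau u v k Hu)).
  rewrite !sumn_scal. unfold lambert. ring.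
Qed.

Lemma vanishing_lambert (tau u v : C) : (0 < Im v < Im tau)%R -> ~ in_lattice tau u ->
  vanishing (lambert tau u v).
Proof.
  intros Hv Hu. assert (Ht : (0 < Im tau)%R) by lra.
  assert (Q : forall u v, (0 < Im v)%R ->
    Clim (fun n => expi (NtoC n * v) / (1 - expi (u + NtoC n * tau))) 0).
  { clear - Ht. intros u v Hv. destruct (one_minus_large tau u Ht) as [n0 Hn0].
    apply Clim_0_le with (fun n => (/ (1 / 2) * Cmod (expi v) ^ n)%R).
    - exists n0. intros n Hn. eapply Rle_trans; [apply (Cmod_div_le _ _ (1 / 2)); [lra|apply Hn0; lia]|].
      apply Rmult_le_compat_l; [lra|].
      replace (NtoC n * v) with (0 + NtoC n * v) by ring.
      rewrite Cmod_expi_nat, expi_0, Cmod_1. lra.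
    - apply is_lim_seq_scal_0. apply is_lim_seq_geom.
      pose proof (Cmod_expi_lt_1 v Hv). rewrite Rabs_pos_eq; lra. }
  split.
  - apply Q. lra.
  - apply Clim_incr. apply Clim_ext with (fun n => lambert tau u v (- 1 - Z.of_nat n)).
    { intros n. f_equal. lia. }
    replace (RtoC 0) with (- expi (tau - u - v) * 0) by ring.
    eapply Clim_ext; [|apply Clim_scal, (Q (tau - u) (tau - v)); destruct tau, v; simpl in *; lra].
    intros n. cbv beta. now rewrite lambert_neg.
Qed.

(** * The twisted Mittag-Leffler expansion *)

(** From sin x >= x - x^3/6 and x^2 <= 4. *)
Lemma sin_ge_third (x : R) : (0 <= x <= 2)%R -> (x / 3 <= sin x)%R.
Proof.
  intros H. destruct (pre_sin_bound x 0) as [A _]; try lra.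
  eapply Rle_trans; [|exact A]. unfold sin_approx, sin_term. simpl.
  nra.
Qed.

(** The range goes beyond 1/2 because the arguments (w + m - 1)/(2K + 1) met below reach (K +
    3/2)/(2K + 1), which is at most 3/4 for K >= 2. Between 1/2 and 3/4 the sine is reflected. *)
Lemma sin_pi_lower (a : R) : (Rabs a <= 3 / 4)%R -> (Rabs a / 3 <= Rabs (sin (PI * a)))%R.
Proof.
  pose proof PI_4. pose proof PI2_3_2. unfold PI2 in *.
  assert (Q : forall x, (0 <= x <= 3 / 4)%R -> (x / 3 <= Rabs (sin (PI * x)))%R).
  { intros x Hx. eapply Rle_trans; [|apply Rle_abs].
    destruct (Rle_lt_dec x (1 / 2)) as [L|L].
    - pose proof (sin_ge_third (PI * x) ltac:(nra)). nra.
    - rewrite <- sin_PI_x. pose proof (sin_ge_third (PI - PI * x) ltac:(nra)). nra. }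
  intros Ha. destruct (Rle_lt_dec 0 a) as [L|L].
  - rewrite (Rabs_pos_eq a L) in *. apply Q. lra.
  - rewrite (Rabs_left a L) in *. replace (PI * a)%R with (- (PI * - a))%R by ring.
    rewrite sin_neg, Rabs_Ropp. apply Q. lra.
Qed.

(** With R = |e(x)|, the square of |1 - e(x)| is (1 - R)^2 + 4 R sin^2 (pi Re x). The second summand
    suffices, as rho <= 1 gives rho^2 <= R. *)
Lemma one_minus_expi_lower (x : C) (rho : R) :
  (0 <= rho <= 1)%R -> (rho <= Cmod (expi x))%R -> (Rabs (Re x) <= 3 / 4)%R ->
  (2 * rho / 3 * Rabs (Re x) <= Cmod (1 - expi x))%R.
Proof.
  intros H0 H1 Hx. pose proof (sin_pi_lower _ Hx) as J.
  rewrite Cmod_expi in H1. set (R := exp (- (2 * PI * Im x))) in *.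
  assert (S : (Cmod (1 - expi x) ^ 2 = (1 - R) ^ 2 + 4 * R * sin (PI * Re x) ^ 2)%R).
  { rewrite Cmod2_alt, expi_form. fold R. simpl.
    replace (2 * PI * Re x)%R with (2 * (PI * Re x))%R by ring.
    pose proof (cos_2a_sin (PI * Re x)) as E1. pose proof (sin2_cos2 (2 * (PI * Re x))) as E2.
    unfold Rsqr in E2. set (c := cos (2 * (PI * Re x))) in *. set (s := sin (2 * (PI * Re x))) in *.
    set (t := sin (PI * Re x)) in *.
    transitivity (1 - 2 * R * c + R * R * (s * s + c * c))%R; [ring|]. rewrite E2, E1. ring. }
  apply Rsqr_incr_0_var; [|apply Cmod_ge_0].
  unfold Rsqr. replace (Cmod (1 - expi x) * Cmod (1 - expi x))%R with (Cmod (1 - expi x) ^ 2)%R by ring.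
  rewrite S. rewrite <- (pow2_abs (sin _)).
  set (a := Rabs (Re x)) in *. set (t := Rabs (sin (PI * Re x))) in *.
  assert (0 <= a)%R by apply Rabs_pos.
  apply Rle_trans with (4 * R * t ^ 2)%R; [|pose proof (pow2_ge_0 (1 - R)); lra].
  apply Rle_trans with (4 * (rho * rho) * (t * t))%R.
  - replace (2 * rho / 3 * a * (2 * rho / 3 * a))%R with (4 * (rho * rho) * ((a / 3) * (a / 3)))%R by field.
    apply Rmult_le_compat_l; [nra|]. apply Rmult_le_compat; lra.
  - replace (4 * R * t ^ 2)%R with (4 * R * (t * t))%R by ring.
    apply Rmult_le_compat_r; [nra|]. nra.
Qed.

Lemma Rabs_sin_le (x : R) : (Rabs (sin x) <= Rabs x)%R.
Proof.
  destruct (Rle_lt_dec 0 x) as [L|L].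
  - rewrite (Rabs_pos_eq x L). apply Rabs_le. pose proof (SIN_bound x).
    destruct (Req_dec x 0) as [->|N]; [rewrite sin_0; lra|].
    assert (sin x < x)%R by (apply sin_lt_x; lra).
    destruct (Rle_lt_dec x 1) as [K|K]; [|lra].
    assert (0 <= sin x)%R; [|lra]. apply sin_ge_0; [lra|]. pose proof PI2_3_2. unfold PI2 in *. lra.
  - rewrite (Rabs_left x L), <- Rabs_Ropp, <- sin_neg. apply Rabs_le.
    set (y := (- x)%R). pose proof (SIN_bound y).
    assert (sin y < y)%R by (apply sin_lt_x; unfold y; lra).
    destruct (Rle_lt_dec y 1) as [K|K]; [|lra].
    assert (0 <= sin y)%R; [|lra]. apply sin_ge_0; [unfold y; lra|]. pose proof PI2_3_2. unfold PI2 in *. lra.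
Qed.

Lemma expi_minus_1_upper (x : R) : (Cmod (expi x - 1) <= 2 * PI * Rabs x)%R.
Proof.
  assert (S : (Cmod (expi x - 1) ^ 2 = (2 * Rabs (sin (PI * x))) ^ 2)%R).
  { rewrite Cmod2_alt, expi_form. simpl. rewrite Rmult_0_r, Ropp_0, exp_0.
    replace (2 * PI * x)%R with (2 * (PI * x))%R by ring.
    pose proof (cos_2a_sin (PI * x)) as E1. pose proof (sin2_cos2 (2 * (PI * x))) as E2.
    unfold Rsqr in E2. set (c := cos (2 * (PI * x))) in *. set (s := sin (2 * (PI * x))) in *.
    transitivity (1 - 2 * c + (s * s + c * c))%R; [ring|]. rewrite E2, E1.
    pose proof (pow2_abs (sin (PI * x))). simpl in H.
    transitivity (4 * (Rabs (sin (PI * x)) * (Rabs (sin (PI * x)) * 1)))%R; [rewrite H; ring|ring]. }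
  pose proof PI_RGT_0.
  apply Rsqr_incr_0_var.
  - unfold Rsqr. replace (Cmod (expi x - 1) * Cmod (expi x - 1))%R with (Cmod (expi x - 1) ^ 2)%R by ring.
    rewrite S. pose proof (Rabs_sin_le (PI * x)) as K.
    rewrite Rabs_mult, (Rabs_pos_eq PI) in K by lra. pose proof (Rabs_pos (sin (PI * x))).
    simpl. rewrite Rmult_1_r. apply Rmult_le_compat; lra.
  - pose proof (Rabs_pos x). nra.
Qed.

(** The derivative of t -> e(xi t) at 0 up to sign, taken along t = 1/(2K + 1) on real and imaginary
    parts. *)
Lemma expi_derivative (xi : C) :
  Clim (fun K => NtoC (2 * K + 1) * (1 - expi (xi / NtoC (2 * K + 1))))
       (- (2 * PI * Ci * xi)).
Proof.
  assert (D : forall (f : R -> R) (l : R), derivable_pt_lim f 0 l ->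
    is_lim_seq (fun K => (IZR (Z.of_nat (2 * K + 1)) * (f 0 - f (/ IZR (Z.of_nat (2 * K + 1)))))%R) (- l)%R).
  { intros f l H. apply is_lim_seq_eps. intros eps He. destruct (H eps He) as [d Hd].
    destruct (INR_unbounded (/ d)) as [k0 Hk0]. exists k0. intros K HK.
    assert (P : (/ d < IZR (Z.of_nat (2 * K + 1)))%R).
    { rewrite <- INR_IZR_INZ. eapply Rlt_le_trans; [exact Hk0|]. apply le_INR. lia. }
    set (N := IZR (Z.of_nat (2 * K + 1))) in *.
    assert (0 < / d)%R by apply Rinv_0_lt_compat, cond_pos.
    assert (0 < N)%R by lra.
    assert (HN : (0 < / N)%R) by now apply Rinv_0_lt_compat.
    specialize (Hd (/ N)%R ltac:(lra)).
    assert (L : (Rabs (/ N) < d)%R).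
    { rewrite Rabs_pos_eq by lra. rewrite <- (Rinv_inv d). apply Rinv_lt_contravar; [|exact P].
      nra. }
    specialize (Hd L). rewrite Rplus_0_l in Hd.
    replace (N * (f 0 - f (/ N)) - - l)%R with (- ((f (/ N) - f 0) / / N - l))%R by (field; lra).
    rewrite Rabs_Ropp. exact Hd. }
  destruct xi as [a b].
  assert (F : forall N : R, (0 < N)%R -> expi ((a, b) / RtoC N)
     = (exp (- (2 * PI * (b * / N))) * cos (2 * PI * (a * / N)),
        exp (- (2 * PI * (b * / N))) * sin (2 * PI * (a * / N)))%R).
  { intros N HN. rewrite expi_form.
    replace (Re ((a, b) / RtoC N)) with (a * / N)%R.
    2:{ simpl. field. lra. }
    replace (Im ((a, b) / RtoC N)) with (b * / N)%R.
    2:{ simpl. field. lra. }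
    apply C_ext; simpl; ring. }
  assert (NP : forall K, (0 < IZR (Z.of_nat (2 * K + 1)))%R) by (intros; apply IZR_lt; lia).
  split.
  - replace (Re (- (2 * PI * Ci * (a, b)))) with (- - (2 * PI * b))%R by (simpl; ring).
    eapply is_lim_seq_ext; [|apply (D (fun t => exp (- (2 * PI * (b * t))) * cos (2 * PI * (a * t)))%R (- (2 * PI * b))%R)].
    + intros K. unfold ZtoC at 2. rewrite F by apply NP.
      rewrite !Rmult_0_r, Ropp_0, exp_0, cos_0. simpl. ring.
    + apply is_derive_Reals. auto_derive; [exact I|].
      rewrite !Rmult_0_r, Ropp_0, exp_0, cos_0, sin_0. ring.
  - replace (Im (- (2 * PI * Ci * (a, b)))) with (- (2 * PI * a))%R by (simpl; ring).
    eapply is_lim_seq_ext; [|apply (D (fun t => exp (- (2 * PI * (b * t))) * sin (2 * PI * (a * t)))%R (2 * PI * a)%R)].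
    + intros K. unfold ZtoC at 2. rewrite F by apply NP.
      rewrite !Rmult_0_r, Ropp_0, exp_0, sin_0. simpl. ring.
    + apply is_derive_Reals. auto_derive; [exact I|].
      rewrite !Rmult_0_r, Ropp_0, exp_0, cos_0, sin_0. ring.
Qed.

(** * Fourier analysis on Z/(2K+1) *)

Lemma sumn_delta (c : C) (k n : nat) : (k < n)%nat ->
  sumn (fun l => if Nat.eq_dec l k then c else 0) n = c.
Proof.
  intros Hk. induction n; [lia|].
  change (sumn ?a (S ?m)) with (sumn a m + a m). cbv beta. destruct (Nat.eq_dec n k) as [->|E].
  - rewrite (sumn_ext _ (fun _ => 0)); [rewrite sumn_0; ring|].
    intros l Hl. destruct Nat.eq_dec; [lia|reflexivity].
  - rewrite IHn by lia. ring.
Qed.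

Section FiniteFourier.
Variables (K k : nat) (w : C).
Hypothesis Hk : (k < 2 * K + 1)%nat.
Hypothesis Hw : 1 - expi w <> 0.
Let N := NtoC (2 * K + 1).
Let h (m : Z) := / (1 - expi ((w + ZtoC m) / N)).
Let z (m : Z) := expi (- (ZtoC m * NtoC k / N)).

Lemma dft_N_neq_0 : N <> 0.
Proof. unfold N. clear. intros E. apply (ZtoC_inj _ 0) in E. lia. Qed.

Lemma dft_den_neq_0 (m : Z) : 1 - expi ((w + ZtoC m) / N) <> 0.
Proof.
  intros E. apply one_minus_eq_0 in E as E1.
  apply expi_eq_1 in E1. destruct E1 as [n En]. apply Hw.
  replace w with (ZtoC (n * Z.of_nat (2 * K + 1) - m)).
  - rewrite expi_Z. ring.
  - zc. fold N. rewrite <- En. field. apply dft_N_neq_0.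
Qed.

(** The N-th power of e((w + m)/N) is e(w) for every m, so 1/(1 - x) = (1 + x + ... + x^(N-1))/(1 -
    x^N) writes h as a trigonometric polynomial in m. *)
Lemma dft_expand (m : Z) :
  h m = sumn (fun l => expi (NtoC l * ((w + ZtoC m) / N))) (2 * K + 1) / (1 - expi w).
Proof.
  rewrite geom_expi by apply dft_den_neq_0. fold N.
  replace (N * ((w + ZtoC m) / N)) with (w + ZtoC m) by (field; apply dft_N_neq_0).
  rewrite expi_add_Z. unfold h. field. split; [apply dft_den_neq_0|exact Hw].
Qed.

(** Orthogonality of the characters of Z/(2K+1) selects the term l = k of [dft_expand]. *)
Lemma dft : sumn (fun i => z (Z.of_nat i - Z.of_nat K) * h (Z.of_nat i - Z.of_nat K)) (2 * K + 1)
  = N * expi (NtoC k * w / N) / (1 - expi w).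
Proof.
  pose proof dft_N_neq_0 as NN.
  rewrite (sumn_ext _ (fun i => / (1 - expi w) * sumn (fun l =>
     expi (NtoC l * w / N) * (expi (- (NtoC K * ((NtoC l - NtoC k) / N)))
     * expi (NtoC i * ((NtoC l - NtoC k) / N)))) (2 * K + 1))).
  2:{ intros i Hi. rewrite dft_expand. unfold Cdiv at 1. rewrite Cmult_assoc, Cmult_comm.
      f_equal. rewrite <- sumn_scal. apply sumn_ext. intros l Hl. unfold z.
      rewrite <- !expi_add. f_equal. zc. field. exact NN. }
  rewrite sumn_scal, sumn_swap.
  rewrite (sumn_ext _ (fun l => if Nat.eq_dec l k then N * expi (NtoC k * w / N) else 0)).
  { rewrite sumn_delta by exact Hk. field. exact Hw. }
  intros l Hl. rewrite sumn_scal, sumn_scal. destruct Nat.eq_dec as [->|E].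
  - replace ((NtoC k - NtoC k) / N) with (RtoC 0) by (field; exact NN).
    rewrite Cmult_0_r, Copp_0, expi_0.
    rewrite (sumn_ext _ (fun _ => 1)).
    2:{ intros. rewrite Cmult_0_r. apply expi_0. }
    replace (sumn (fun _ => 1) (2 * K + 1)) with N; [ring|].
    unfold N. generalize (2 * K + 1)%nat as n. induction n; [reflexivity|].
    rewrite ZtoC_succ, IHn. reflexivity.
  - rewrite geom_expi.
    + fold N. replace (N * ((NtoC l - NtoC k) / N))
        with (ZtoC (Z.of_nat l - Z.of_nat k)) by (zc; field; exact NN).
      rewrite expi_Z. unfold Cdiv. ring.
    + intros F. apply one_minus_eq_0 in F as F1.
      apply expi_eq_1 in F1. destruct F1 as [n En].
      assert (Z.of_nat l - Z.of_nat k = n * Z.of_nat (2 * K + 1))%Z as Q.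
      { apply ZtoC_inj. zc. fold N. rewrite <- En. field. exact NN. }
      assert (n = 0)%Z by nia. lia.
Qed.

(** Summation by parts at the finite level: z h has period N = 2K + 1, hence its sum over a full
    period is unchanged by m -> m - 1. *)
Lemma dft_difference :
  sumn (fun i => z (Z.of_nat i - Z.of_nat K)
      * (h (Z.of_nat i - Z.of_nat K) - h (Z.of_nat i - Z.of_nat K - 1))) (2 * K + 1)
  = (1 - expi (- (NtoC k / N))) * (N * expi (NtoC k * w / N) / (1 - expi w)).
Proof.
  pose proof dft_N_neq_0 as NN. rewrite <- dft.
  set (G := fun m => z m * h m).
  set (S0 := sumn (fun i => G (Z.of_nat i - Z.of_nat K)%Z) (2 * K + 1)).
  change (sumn (fun i : nat => z (Z.of_nat i - Z.of_nat K) * h (Z.of_nat i - Z.of_nat K)) (2 * K + 1))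
    with S0.
  rewrite (sumn_ext _ (fun i => G (Z.of_nat i - Z.of_nat K)%Z +
    (- expi (- (NtoC k / N))) * G (Z.of_nat i - Z.of_nat K - 1)%Z)).
  2:{ intros i Hi. unfold G.
      replace (z (Z.of_nat i - Z.of_nat K) * (h (Z.of_nat i - Z.of_nat K) - h (Z.of_nat i - Z.of_nat K - 1)))
       with (z (Z.of_nat i - Z.of_nat K) * h (Z.of_nat i - Z.of_nat K)
         - z (Z.of_nat i - Z.of_nat K) * h (Z.of_nat i - Z.of_nat K - 1)) by ring.
      replace (z (Z.of_nat i - Z.of_nat K) * h (Z.of_nat i - Z.of_nat K - 1)) with
       (expi (- (NtoC k / N)) * z (Z.of_nat i - Z.of_nat K - 1) * h (Z.of_nat i - Z.of_nat K - 1)).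
      2:{ f_equal. unfold z. rewrite <- expi_add. f_equal. zc. field. exact NN. }
      ring. }
  rewrite sumn_plus, sumn_scal. fold S0.
  replace (sumn (fun i => G (Z.of_nat i - Z.of_nat K - 1)%Z) (2 * K + 1)) with S0; [ring|].
  unfold S0. rewrite Nat.add_1_r.
  rewrite (sumn_S_l (fun i => G (Z.of_nat i - Z.of_nat K - 1)%Z)).
  change (sumn ?a (S ?m)) with (sumn a m + a m). rewrite Cplus_comm. f_equal.
  - replace (Z.of_nat (2 * K) - Z.of_nat K)%Z with (Z.of_nat K) by lia.
    replace (Z.of_nat 0 - Z.of_nat K - 1)%Z with (Z.of_nat K - Z.of_nat (2 * K + 1))%Z by lia.
    unfold G. f_equal.
    + unfold z. replace (- (ZtoC (Z.of_nat K - Z.of_nat (2 * K + 1)) * NtoC k / N))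
       with (- (NtoC K * NtoC k / N) + NtoC k).
      2:{ zc. fold N. field. exact NN. }
      now rewrite expi_add_Z.
    + unfold h. replace ((w + ZtoC (Z.of_nat K - Z.of_nat (2 * K + 1))) / N)
       with ((w + NtoC K) / N + ZtoC (-1)).
      2:{ zc. fold N. field. exact NN. }
      now rewrite expi_add_Z.
  - apply sumn_ext. intros i Hi. f_equal. lia.
Qed.

(** The difference has numerator e(1/N) - 1 of size at most 2 pi/N, and each denominator is at least
    (2 rho/3) |Re w + j|/N. After division by N the bound is quadratic in m and independent of K.
    The third rho bounds |e((w + m - 1)/N)| by 1/rho. *)
Lemma dft_difference_bound (m : Z) (rho : R) :
  (0 < rho <= 1)%R -> (exp (- (2 * PI * Rabs (Im w))) = rho)%R -> (Rabs (Re w) <= 1 / 2)%R ->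
  (2 <= K)%nat -> (2 <= Z.abs m <= Z.of_nat K)%Z ->
  (Cmod (h m - h (m - 1)) <=
   IZR (Z.of_nat (2 * K + 1)) * (18 * PI / (4 * (rho * rho * rho)) / (Rabs (Re w + IZR m) * Rabs (Re w + IZR m - 1))))%R.
Proof.
  intros Hrho Erho Hre HK Hm. pose proof dft_N_neq_0 as NN.
  set (n := IZR (Z.of_nat (2 * K + 1))).
  assert (Hn : (n = 2 * IZR (Z.of_nat K) + 1)%R).
  { unfold n. replace (Z.of_nat (2 * K + 1)) with (2 * Z.of_nat K + 1)%Z by lia.
    rewrite plus_IZR, mult_IZR. reflexivity. }
  assert (HK' : (2 <= IZR (Z.of_nat K))%R) by (apply IZR_le; lia).
  assert (Nn : N = RtoC n) by reflexivity.
  assert (n0 : (0 < n)%R) by lra.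
  assert (Re_x : forall j, Re ((w + ZtoC j) / N) = ((Re w + IZR j) / n)%R).
  { intros j. rewrite Nn. destruct w as [a b]. simpl. field. lra. }
  assert (Im_x : forall j, Im ((w + ZtoC j) / N) = (Im w / n)%R).
  { intros j. rewrite Nn. destruct w as [a b]. simpl. field. lra. }
  assert (Hm1 : (-IZR (Z.of_nat K) <= IZR m <= IZR (Z.of_nat K))%R).
  { rewrite <- opp_IZR. split; apply IZR_le; lia. }
  apply Rabs_le_between in Hre.
  assert (Hmm : (IZR m <= -2 \/ 2 <= IZR m)%R).
  { destruct (Z_le_gt_dec 0 m); [right|left]; [apply (IZR_le 2)|apply (IZR_le _ (-2))]; lia. }
  pose proof PI_RGT_0 as PP.
  assert (Mod : forall j, (rho <= Cmod (expi ((w + ZtoC j) / N)) <= / rho)%R).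
  { intros j. rewrite Cmod_expi, Im_x, <- Erho, <- exp_Ropp.
    assert (Rabs (Im w / n) <= Rabs (Im w))%R.
    { unfold Rdiv. rewrite Rabs_mult, (Rabs_pos_eq (/ n)) by (left; now apply Rinv_0_lt_compat).
      rewrite <- (Rmult_1_r (Rabs (Im w))) at 2. apply Rmult_le_compat_l; [apply Rabs_pos|].
      rewrite <- Rinv_1. apply Rinv_le_contravar; lra. }
    apply Rabs_le_between in H.
    split; apply exp_le; nra. }
  assert (Low : forall j, (Rabs (Re w + IZR j) <= 3 / 4 * n)%R ->
    (2 * rho / 3 * (Rabs (Re w + IZR j) / n) <= Cmod (1 - expi ((w + ZtoC j) / N)))%R).
  { intros j Hj.
    assert (E : Rabs ((Re w + IZR j) / n) = (Rabs (Re w + IZR j) / n)%R).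
    { unfold Rdiv. rewrite Rabs_mult, (Rabs_pos_eq (/ n)); [reflexivity|].
      left; now apply Rinv_0_lt_compat. }
    pose proof (one_minus_expi_lower ((w + ZtoC j) / N) rho) as L.
    rewrite Re_x, E in L. apply L; [lra|apply Mod|]. apply Rle_div_l; lra. }
  pose proof (Low m ltac:(apply Rabs_le; lra)) as L1.
  pose proof (Low (m - 1)%Z ltac:(rewrite minus_IZR; apply Rabs_le; lra)) as L2.
  rewrite minus_IZR in L2. replace (Re w + (IZR m - 1))%R with (Re w + IZR m - 1)%R in L2 by ring.
  set (A := Rabs (Re w + IZR m)) in *. set (B := Rabs (Re w + IZR m - 1)) in *.
  assert (A0 : (0 < A)%R) by (apply Rabs_pos_lt; lra).
  assert (B0 : (0 < B)%R) by (apply Rabs_pos_lt; lra).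
  pose proof (dft_den_neq_0 m) as D1. pose proof (dft_den_neq_0 (m - 1)) as D2.
  assert (EQ : h m - h (m - 1) = expi ((w + ZtoC (m - 1)) / N) * (expi (/ n)%R - 1)
     / ((1 - expi ((w + ZtoC m) / N)) * (1 - expi ((w + ZtoC (m - 1)) / N)))).
  { unfold h. assert (expi ((w + ZtoC m) / N) = expi ((w + ZtoC (m - 1)) / N) * expi (/ n)%R) as X.
    { rewrite <- expi_add. f_equal. rewrite RtoC_inv by lra. fold N in NN. rewrite <- Nn. zc. field. exact NN. }
    rewrite X in *. field. auto. }
  rewrite EQ.
  eapply Rle_trans; [apply (Cmod_div_le _ _ ((2 * rho / 3 * (A / n)) * (2 * rho / 3 * (B / n))))|].
  - assert (0 < / n)%R by now apply Rinv_0_lt_compat.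
    unfold Rdiv. repeat apply Rmult_lt_0_compat; try lra.
  - rewrite Cmod_mult. apply Rmult_le_compat; try lra;
    apply Rmult_le_pos; try lra; apply Rmult_le_pos; try lra; left; now apply Rinv_0_lt_compat.
  - rewrite Cmod_mult. pose proof (expi_minus_1_upper (/ n)) as U.
    rewrite Rabs_pos_eq in U by (left; now apply Rinv_0_lt_compat).
    apply Rle_trans with (/ (2 * rho / 3 * (A / n) * (2 * rho / 3 * (B / n))) * (/ rho * (2 * PI * / n)))%R.
    + apply Rmult_le_compat_l.
      * left. apply Rinv_0_lt_compat. assert (0 < / n)%R by now apply Rinv_0_lt_compat.
        unfold Rdiv. repeat apply Rmult_lt_0_compat; try lra.
      * apply Rmult_le_compat; try apply Cmod_ge_0; [apply Mod|exact U].
    + right. field. repeat split; lra.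
Qed.

End FiniteFourier.

(** The series of the e(-ms)/(w + m) converges only conditionally; this is its term after one
    summation by parts, which gives quadratic decay and multiplies the sum by 1 - e(-s). *)
Definition twisted (s : R) (w : C) (m : Z) : C :=
  expi (- (ZtoC m * RtoC s)) * (/ (w + ZtoC m) - / (w + ZtoC m - 1)).

Lemma quad_tail_lim (c : R) : is_lim_seq (fun k => (c / (INR k - 2))%R) 0%R.
Proof.
  apply is_lim_seq_eps. intros eps He.
  destruct (INR_unbounded (Rabs c / eps + 3)%R) as [n Hn]. exists n. intros k Hk.
  apply le_INR in Hk. assert (0 <= Rabs c / eps)%R.
  { apply Rmult_le_pos; [apply Rabs_pos|]. left. now apply Rinv_0_lt_compat. }
  rewrite Rminus_0_r. unfold Rdiv. rewrite Rabs_mult, (Rabs_pos_eq (/ _)).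
  2:{ left. apply Rinv_0_lt_compat. lra. }
  apply Rlt_div_l; [lra|]. apply Rlt_le_trans with (eps * (Rabs c / eps + 1))%R.
  - replace (eps * (Rabs c / eps + 1))%R with (Rabs c + eps)%R by (field; lra). lra.
  - apply Rmult_le_compat_l; lra.
Qed.

(** For |m| >= k one has |x + m| >= k - 1 and |x + m - 1| >= k - 2, and 1/((k - 2)(k - 1))
    telescopes. Starting at 3 keeps k - 2 positive. *)
Lemma quad_tail (a : Z -> C) (c x : R) : (0 <= c)%R -> (Rabs x <= 1 / 2)%R ->
  (forall m, (2 <= Z.abs m)%Z -> (Cmod (a m) <= c / (Rabs (x + IZR m) * Rabs (x + IZR m - 1)))%R) ->
  tail_boundZ a (fun k => (c / (INR k - 2))%R) 3.
Proof.
  intros Hc Hx H k Hk. apply Rabs_le_between in Hx.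
  assert (K3 : (3 <= INR k)%R) by (replace 3%R with (INR 3) by (simpl; ring); now apply le_INR).
  assert (Q : forall m, (INR k <= Rabs (IZR m))%R ->
     (c / (Rabs (x + IZR m) * Rabs (x + IZR m - 1)) <= c / (INR k - 2) - c / (INR (S k) - 2))%R).
  { intros m Hm. rewrite S_INR.
    replace (c / (INR k - 2) - c / (INR k + 1 - 2))%R with (c / ((INR k - 2) * (INR k - 1)))%R
      by (field; lra).
    apply Rmult_le_compat_l; [assumption|]. apply Rinv_le_contravar; [nra|].
    rewrite Rmult_comm. apply Rmult_le_compat; try lra.
    - revert Hm. unfold Rabs. repeat destruct Rcase_abs; intros; lra.
    - revert Hm. unfold Rabs. repeat destruct Rcase_abs; intros; lra. }
  split.
  - eapply Rle_trans; [apply H; lia|]. apply Q. rewrite <- INR_IZR_INZ. apply Rle_abs.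
  - eapply Rle_trans; [apply H; lia|]. apply Q. rewrite minus_IZR, <- INR_IZR_INZ, Rabs_left; lra.
Qed.

Lemma not_Z_neq_0 (w : C) (m : Z) : 1 - expi w <> 0 -> w + ZtoC m <> 0.
Proof.
  intros H E. apply H. replace w with (ZtoC (- m)).
  - rewrite expi_Z. ring.
  - zc. transitivity (w + ZtoC m - ZtoC m); [rewrite E; ring|ring].
Qed.

Lemma Cmod_twisted_le (s : R) (w : C) (m : Z) : (Rabs (Re w) <= 1 / 2)%R -> (2 <= Z.abs m)%Z ->
  (Cmod (twisted s w m) <= 1 / (Rabs (Re w + IZR m) * Rabs (Re w + IZR m - 1)))%R.
Proof.
  intros Hx Hm. apply Rabs_le_between in Hx. unfold twisted.
  assert (Hmm : (IZR m <= -2 \/ 2 <= IZR m)%R).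
  { destruct (Z_le_gt_dec 0 m); [right|left]; [apply (IZR_le 2)|apply (IZR_le _ (-2))]; lia. }
  assert (A0 : (0 < Rabs (Re w + IZR m))%R) by (apply Rabs_pos_lt; lra).
  assert (B0 : (0 < Rabs (Re w + IZR m - 1))%R) by (apply Rabs_pos_lt; lra).
  pose proof (proj1 (Rabs_le_Cmod (w + ZtoC m))) as L1.
  pose proof (proj1 (Rabs_le_Cmod (w + ZtoC m - 1))) as L2.
  change (Re (w + ZtoC m)) with (Re w + IZR m)%R in L1.
  change (Re (w + ZtoC m - 1)) with (Re w + IZR m - 1)%R in L2.
  assert (N1 : w + ZtoC m <> 0) by (apply Cmod_gt_0; lra).
  assert (N2 : w + ZtoC m - 1 <> 0) by (apply Cmod_gt_0; lra).
  replace (/ (w + ZtoC m) - / (w + ZtoC m - 1)) with (- (1) / ((w + ZtoC m) * (w + ZtoC m - 1)))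
    by (field; auto).
  rewrite Cmod_mult, Cmod_expi.
  replace (Im (- (ZtoC m * s))) with 0%R by (simpl; ring).
  rewrite Rmult_0_r, Ropp_0, exp_0, Rmult_1_l.
  eapply Rle_trans; [apply (Cmod_div_le _ _ (Rabs (Re w + IZR m) * Rabs (Re w + IZR m - 1)))|].
  - now apply Rmult_lt_0_compat.
  - rewrite Cmod_mult. apply Rmult_le_compat; lra.
  - rewrite Cmod_opp, Cmod_1. unfold Rdiv. lra.
Qed.

Lemma summable_twisted_strip (s : R) (w : C) : (Rabs (Re w) <= 1 / 2)%R -> summable (twisted s w).
Proof.
  intros Hx. exists (fun k => (1 / (INR k - 2))%R), 3%nat. split; [apply quad_tail_lim|].
  apply (quad_tail _ _ (Re w)); [lra|assumption|].
  intros m Hm. now apply Cmod_twisted_le.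
Qed.

Lemma Clim_div_N (u : nat -> R) (s : R) (c : C) : is_lim_seq u s ->
  Clim (fun K => RtoC (u K) * c) (RtoC s * c).
Proof.
  intros H. apply Clim_mult; [|apply Clim_const]. split; simpl; [exact H|apply is_lim_seq_const].
Qed.

(* Finite Fourier inversion on Z/(2K+1), in the limit K -> oo. *)
Lemma sumZ_twisted_strip (s : R) (w : C) : (0 < s < 1)%R -> (Rabs (Re w) <= 1 / 2)%R ->
  1 - expi w <> 0 ->
  sumZ (twisted s w) (- (2 * PI * Ci) * ((1 - expi (- RtoC s)) * (expi (RtoC s * w) / (1 - expi w)))).
Proof.
  intros Hs Hx Hw. pose proof PI_RGT_0 as PP.
  assert (KN : - (2 * PI * Ci) <> 0).
  { intros E. apply (f_equal Im) in E. simpl in E. lra. }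
  destruct (summable_sumZ _ (summable_twisted_strip s w Hx)) as [T HT].
  set (N := fun K => IZR (Z.of_nat (2 * K + 1))).
  assert (NP : forall K, (0 < N K)%R) by (intros; apply IZR_lt; lia).
  assert (FL : forall K, (0 <= s * N K)%R) by (intros; specialize (NP K); nra).
  (* The frequency k/N, with k the integer part of s N, approximates s; s < 1 makes k < N. *)
  set (k := fun K => proj1_sig (nfloor_ex (s * N K)%R (FL K))).
  assert (Hk : forall K, (INR (k K) <= s * N K < INR (k K) + 1)%R).
  { intros K. unfold k. now destruct nfloor_ex. }
  assert (kN : forall K, (k K < 2 * K + 1)%nat).
  { intros K. apply INR_lt. specialize (Hk K). specialize (NP K).
    rewrite (INR_IZR_INZ (2 * K + 1)). fold (N K). nra. }
  assert (Nlim : is_lim_seq (fun K => (/ N K)%R) 0%R).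
  { apply is_lim_seq_eps. intros eps He. destruct (INR_unbounded (/ eps)) as [n0 Hn].
    exists n0. intros K HK. rewrite Rminus_0_r, Rabs_pos_eq by (left; now apply Rinv_0_lt_compat).
    rewrite <- (Rinv_inv eps). apply Rinv_lt_contravar.
    - apply Rmult_lt_0_compat; [now apply Rinv_0_lt_compat|apply NP].
    - eapply Rlt_le_trans; [exact Hn|]. unfold N. rewrite <- INR_IZR_INZ. apply le_INR. lia. }
  assert (klim : is_lim_seq (fun K => (INR (k K) / N K)%R) s).
  { apply (is_lim_seq_le_le (fun K => (s - / N K)%R) _ (fun _ => s)).
    - intros K. specialize (Hk K). specialize (NP K). split.
      + apply Rle_div_r; [exact NP|]. rewrite Rmult_minus_distr_r, Rinv_l by lra. lra.
      + apply Rle_div_l; [exact NP|]. lra.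
    - replace (Finite s) with (Finite (s - 0)%R) by (f_equal; ring).
      apply is_lim_seq_minus'; [apply is_lim_seq_const|exact Nlim].
    - apply is_lim_seq_const. }
  assert (kC : forall K, NtoC (k K) / NtoC (2 * K + 1) = RtoC (INR (k K) / N K)).
  { intros K. specialize (NP K). rewrite RtoC_div by lra. rewrite INR_IZR_INZ. reflexivity. }
  assert (L1 : Clim (fun K => (1 - expi (- RtoC (INR (k K) / N K)))
      * (expi (RtoC (INR (k K) / N K) * w) / (1 - expi w)))
      ((1 - expi (- RtoC s)) * (expi (RtoC s * w) / (1 - expi w)))).
  { apply Clim_mult.
    - apply Clim_minus; [apply Clim_const|]. apply Clim_expi.
      apply Clim_opp. split; simpl; [exact klim|apply is_lim_seq_const].
    - apply Clim_div; [exact Hw| |apply Clim_const]. apply Clim_expi. now apply Clim_div_N. }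
  set (rho := exp (- (2 * PI * Rabs (Im w)))).
  assert (Hrho : (0 < rho <= 1)%R).
  { split; [apply exp_pos|]. unfold rho. rewrite <- exp_0. apply exp_le. pose proof (Rabs_pos (Im w)). nra. }
  set (c := (18 * PI / (4 * (rho * rho * rho)))%R).
  assert (Hc : (0 <= c)%R).
  { unfold c. apply Rmult_le_pos; [lra|]. left. apply Rinv_0_lt_compat.
    repeat apply Rmult_lt_0_compat; lra. }
  set (f := fun K m => / NtoC (2 * K + 1) *
     (expi (- (ZtoC m * NtoC (k K) / NtoC (2 * K + 1))) *
      (/ (1 - expi ((w + ZtoC m) / NtoC (2 * K + 1)))
       - / (1 - expi ((w + ZtoC (m - 1)) / NtoC (2 * K + 1)))))).
  assert (NC : forall K, NtoC (2 * K + 1) = RtoC (N K)) by reflexivity.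
  assert (NC0 : forall K, NtoC (2 * K + 1) <> 0).
  { intros K E. apply (ZtoC_inj _ 0) in E. lia. }
  assert (Hlim : forall m, Clim (fun K => / NtoC (2 * K + 1) * / (1 - expi ((w + ZtoC m) / NtoC (2 * K + 1))))
     (/ (- (2 * PI * Ci)) * / (w + ZtoC m))).
  { intros m. pose proof (not_Z_neq_0 w m Hw) as Wm.
    replace (/ (- (2 * PI * Ci)) * / (w + ZtoC m)) with (/ (- (2 * PI * Ci * (w + ZtoC m)))).
    2:{ replace (- (2 * PI * Ci * (w + ZtoC m))) with (- (2 * PI * Ci) * (w + ZtoC m)) by ring.
        field. split; [exact Wm|]. repeat split; try exact Ci_nz.
        intros E. apply RtoC_inj in E. lra. }
    eapply Clim_ext; [|apply Clim_inv; [|apply (expi_derivative (w + ZtoC m))]].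
    - intros K. cbv beta. pose proof (dft_den_neq_0 K w Hw m). field. split; [assumption|apply NC0].
    - replace (- (2 * PI * Ci * (w + ZtoC m))) with (- (2 * PI * Ci) * (w + ZtoC m)) by ring.
      now apply Cmult_neq_0. }
  (* The sequence of L1 again, now as the sum of the finite Fourier series, so that Tannery's
     theorem gives its limit as a multiple of T. *)
  assert (L2 : Clim (fun K => (1 - expi (- RtoC (INR (k K) / N K)))
      * (expi (RtoC (INR (k K) / N K) * w) / (1 - expi w))) (/ (- (2 * PI * Ci)) * T)).
  { apply (tanneryZ (fun K => truncate (f K) K) (fun m => / (- (2 * PI * Ci)) * twisted s w m)
      (fun j => (c / (INR j - 2))%R) 3 2).
    - apply quad_tail_lim.
    - intros K HK. apply (quad_tail _ _ (Re w)); [assumption|assumption|].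
      intros m Hm. unfold truncate. destruct Z_le_dec as [L|L].
      + unfold f. rewrite !Cmod_mult, Cmod_expi.
        replace (Im (- (ZtoC m * NtoC (k K) / NtoC (2 * K + 1)))) with 0%R.
        2:{ unfold Cdiv. rewrite <- Cmult_assoc. fold (NtoC (k K) / NtoC (2 * K + 1)).
            rewrite kC. simpl. ring. }
        rewrite Rmult_0_r, Ropp_0, exp_0, Rmult_1_l.
        pose proof (dft_difference_bound K (k K) w (kN K) Hw m rho Hrho eq_refl Hx HK ltac:(lia)) as DB.
        fold (N K) in DB. fold c in DB.
        rewrite Cmod_inv by apply NC0. rewrite NC, Cmod_R, Rabs_pos_eq by (left; apply NP).
        apply Rle_trans with (/ N K * (N K * (c / (Rabs (Re w + IZR m) * Rabs (Re w + IZR m - 1)))))%R.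
        * apply Rmult_le_compat_l; [left; apply Rinv_0_lt_compat, NP|exact DB].
        * right. rewrite <- Rmult_assoc, Rinv_l, Rmult_1_l; [reflexivity|]. specialize (NP K). lra.
      + rewrite Cmod_0. apply Rmult_le_pos; [assumption|].
        (* Outside the truncation the majorant only has to be nonnegative; a zero denominator is
           settled by the convention / 0 = 0. *)
        destruct (Req_dec (Rabs (Re w + IZR m) * Rabs (Re w + IZR m - 1)) 0) as [E|E].
        * rewrite E, Rinv_0. lra.
        * left. apply Rinv_0_lt_compat.
          pose proof (Rmult_le_pos _ _ (Rabs_pos (Re w + IZR m)) (Rabs_pos (Re w + IZR m - 1))). lra.
    - intros m. apply Clim_ext_loc with (fun K => f K m).
      { exists (Z.to_nat (Z.abs m)). intros K HK. unfold truncate. destruct Z_le_dec; [reflexivity|lia]. }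
      apply Clim_ext with (fun K => expi (- (ZtoC m * RtoC (INR (k K) / N K))) *
         (/ NtoC (2 * K + 1) * / (1 - expi ((w + ZtoC m) / NtoC (2 * K + 1)))
        - / NtoC (2 * K + 1) * / (1 - expi ((w + ZtoC (m - 1)) / NtoC (2 * K + 1))))).
      { intros K. unfold f. rewrite <- kC.
        replace (ZtoC m * NtoC (k K) / NtoC (2 * K + 1)) with
          (ZtoC m * (NtoC (k K) / NtoC (2 * K + 1))) by (unfold Cdiv; ring).
        ring. }
      unfold twisted.
      replace (w + ZtoC m - 1) with (w + ZtoC (m - 1)) by (zc; ring).
      replace (/ - (2 * PI * Ci) * (expi (- (ZtoC m * s)) * (/ (w + ZtoC m) - / (w + ZtoC (m - 1)))))
       with (expi (- (ZtoC m * s)) * (/ - (2 * PI * Ci) * / (w + ZtoC m) - / - (2 * PI * Ci) * / (w + ZtoC (m - 1))))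
       by ring.
      apply Clim_mult; [|apply Clim_minus; apply Hlim].
      apply Clim_expi. apply Clim_opp.
      eapply Clim_ext; [|rewrite Cmult_comm; apply (Clim_div_N _ _ (ZtoC m) klim)].
      intros; cbv beta; ring.
    - intros K. pose proof (sumZ_truncate (f K) K) as E.
      match type of E with sumZ _ ?X => match goal with |- sumZ _ ?Y =>
        replace Y with X; [exact E|] end end.
      unfold f. rewrite sumn_scal.
      rewrite (dft_difference K (k K) w (kN K) Hw).
      rewrite <- kC.
      replace (NtoC (k K) / NtoC (2 * K + 1) * w) with
       (NtoC (k K) * w / NtoC (2 * K + 1)) by (unfold Cdiv; ring).
      field. split; [exact Hw|apply NC0].
    - now apply sumZ_scal. }
  rewrite (Clim_unique _ _ _ L1 L2).
  replace (- (2 * PI * Ci) * (/ - (2 * PI * Ci) * T)) with (- (2 * PI * Ci) * / (- (2 * PI * Ci)) * T) by ring.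
  rewrite Cinv_r by exact KN. rewrite Cmult_1_l. exact HT.
Qed.

Lemma sumZ_shift_inv (a : Z -> C) (l : C) :
  vanishing a -> sumZ (fun j => a (j + 1)%Z) l -> sumZ a l.
Proof.
  intros [H1 H2] H. apply Clim_ext with (fun n => SZ (fun j => a (j + 1)%Z) n - a (Z.of_nat n) + a (- Z.of_nat n)%Z).
  { intros; rewrite SZ_shift. ring. }
  replace l with (l - 0 + 0) by ring. apply Clim_plus; [apply Clim_minus|]; assumption.
Qed.

Lemma vanishing_twisted (s : R) (w : C) : vanishing (twisted s w).
Proof.
  destruct (INR_unbounded (Rabs (Re w) + 2)%R) as [n0 Hn0].
  assert (Q : forall v : nat -> C, (forall n, (n0 <= n)%nat -> (Cmod (v n) <= 2 / (INR n - INR n0 + 1))%R) -> Clim v 0).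
  { intros v Hv. apply Clim_0_le with (fun n => (2 / (INR n - INR n0 + 1))%R); [now exists n0|].
    apply is_lim_seq_eps. intros eps He. destruct (INR_unbounded (2 / eps + INR n0)%R) as [n1 Hn1].
    exists (n0 + n1)%nat. intros n Hn. apply le_INR in Hn. rewrite plus_INR in Hn.
    pose proof (pos_INR n0). assert (0 < 2 / eps)%R by (apply Rdiv_lt_0_compat; lra).
    rewrite Rminus_0_r, Rabs_pos_eq.
    2:{ left. apply Rdiv_lt_0_compat; lra. }
    apply Rlt_div_l; [lra|]. apply Rlt_le_trans with (eps * (2 / eps + 1))%R.
    - replace (eps * (2 / eps + 1))%R with (2 + eps)%R by (field; lra). lra.
    - apply Rmult_le_compat_l; lra. }
  assert (B : forall n m, (n0 <= n)%nat -> (Rabs (IZR m) = INR n)%R ->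
    (Cmod (twisted s w m) <= 2 / (INR n - INR n0 + 1))%R).
  { intros n m Hn Hm. apply le_INR in Hn. unfold twisted.
    rewrite Cmod_mult, Cmod_expi.
    replace (Im (- (ZtoC m * s))) with 0%R by (simpl; ring).
    rewrite Rmult_0_r, Ropp_0, exp_0, Rmult_1_l.
    pose proof (proj1 (Rabs_le_Cmod (w + ZtoC m))) as L1.
    pose proof (proj1 (Rabs_le_Cmod (w + ZtoC m - 1))) as L2.
    change (Re (w + ZtoC m)) with (Re w + IZR m)%R in L1.
    change (Re (w + ZtoC m - 1)) with (Re w + IZR m - 1)%R in L2.
    assert (A1 : (INR n - INR n0 + 1 <= Cmod (w + ZtoC m))%R).
    { eapply Rle_trans; [|exact L1]. revert Hn0 Hm. unfold Rabs. repeat destruct Rcase_abs; lra. }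
    assert (A2 : (INR n - INR n0 + 1 <= Cmod (w + ZtoC m - 1))%R).
    { eapply Rle_trans; [|exact L2]. revert Hn0 Hm. unfold Rabs. repeat destruct Rcase_abs; lra. }
    eapply Rle_trans; [apply Cmod_triangle|]. rewrite Cmod_opp.
    rewrite !Cmod_inv by (apply Cmod_gt_0; lra).
    replace (2 / (INR n - INR n0 + 1))%R with (/ (INR n - INR n0 + 1) + / (INR n - INR n0 + 1))%R by (field; lra).
    apply Rplus_le_compat; apply Rinv_le_contravar; lra. }
  split; apply Q; intros n Hn; apply B; auto.
  - rewrite <- INR_IZR_INZ. apply Rabs_pos_eq, pos_INR.
  - rewrite opp_IZR, Rabs_Ropp, <- INR_IZR_INZ. apply Rabs_pos_eq, pos_INR.
Qed.

(** Raising w by 1 translates the summation index, and both sides acquire the factor e(s).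
    Subtracting the nearest integer from Re w thus reduces to the strip |Re w| <= 1/2. *)
Theorem sumZ_twisted (s : R) (w : C) : (0 < s < 1)%R -> 1 - expi w <> 0 ->
  sumZ (twisted s w) (- (2 * PI * Ci) * ((1 - expi (- RtoC s)) * (expi (RtoC s * w) / (1 - expi w)))).
Proof.
  intros Hs Hw.
  destruct (archimed (Re w - 1 / 2)) as [A1 A2]. set (k := up (Re w - 1 / 2)) in *.
  set (w0 := w - ZtoC k).
  replace w with (w0 + ZtoC k) by (unfold w0; ring).
  assert (Hw0 : 1 - expi w0 <> 0).
  { rewrite <- (expi_add_Z w0 k). replace (w0 + ZtoC k) with w by (unfold w0; ring). exact Hw. }
  assert (Hx : (Rabs (Re w0) <= 1 / 2)%R).
  { change (Re w0) with (Re w - IZR k)%R. apply Rabs_le. lra. }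
  pose proof (sumZ_twisted_strip s w0 Hs Hx Hw0) as H0.
  generalize k. clearbody w0. clear - H0. apply Z_ind_step.
  - zc. now rewrite Cplus_0_r.
  - intros j. set (v := w0 + ZtoC j).
    replace (w0 + ZtoC (j + 1)) with (v + ZtoC 1) by (unfold v; zc; ring).
    assert (E : forall m, expi (RtoC s) * twisted s v (m + 1)%Z = twisted s (v + ZtoC 1) m).
    { intros m. unfold twisted. rewrite Cmult_assoc, <- expi_add. f_equal; [f_equal; zc; ring|].
      f_equal; [f_equal; zc; ring|]. f_equal. f_equal. zc. ring. }
    rewrite expi_add_Z. replace (RtoC s * (v + ZtoC 1)) with (RtoC s + RtoC s * v) by (zc; ring).
    rewrite expi_add. pose proof (expi_neq_0 (RtoC s)) as S0.
    split; intros H.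
    + apply sumZ_ext with (1 := E).
      replace (- (2 * PI * Ci) * ((1 - expi (- RtoC s)) * (expi s * expi (s * v) / (1 - expi v))))
       with (expi s * (- (2 * PI * Ci) * ((1 - expi (- RtoC s)) * (expi (s * v) / (1 - expi v)))))
       by (unfold Cdiv; ring).
      apply sumZ_scal. apply sumZ_shift; [apply vanishing_twisted|exact H].
    + apply sumZ_shift_inv; [apply vanishing_twisted|].
      apply sumZ_ext with (fun m => / expi s * twisted s (v + ZtoC 1) m).
      { intros m. rewrite <- E. field. exact S0. }
      replace (- (2 * PI * Ci) * ((1 - expi (- RtoC s)) * (expi (s * v) / (1 - expi v))))
       with (/ expi s * (- (2 * PI * Ci) * ((1 - expi (- RtoC s)) * (expi s * expi (s * v) / (1 - expi v))))).
      2:{ set (X := - (2 * PI * Ci)). set (Y := 1 - expi (- RtoC s)). unfold Cdiv.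
          set (Z := / (1 - expi v)). field. exact S0. }
      now apply sumZ_scal.
Qed.

(** * The S-transformation *)

(** Tannery's theorem in n, applied to the K-th partial row sums. Their sum over n is the K-th
    partial sum of the column sums, by finite additivity, and their limit in K is the row sum. The
    majorant must be uniform in K. *)
Lemma fubiniZ (a : Z -> Z -> C) (p s : Z -> C) (T : C) (t : nat -> R) (n0 : nat) :
  is_lim_seq t 0%R ->
  (forall K, tail_boundZ (fun n => SZ (a n) K) t n0) ->
  (forall n, sumZ (a n) (p n)) -> (forall m, sumZ (fun n => a n m) (s m)) ->
  sumZ p T -> sumZ s T.
Proof.
  intros Ht Hb HR HS HT. unfold sumZ.
  apply (tanneryZ (fun K n => SZ (a n) K) p t n0 0); auto.
  intros K. unfold SZ at 2.
  apply sumZ_ext with (fun n => sumn (fun k => a n (Z.of_nat k) + a n (- 1 - Z.of_nat k)%Z) K);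
    [reflexivity|].
  apply (sumZ_sumn (fun k n => a n (Z.of_nat k) + a n (- 1 - Z.of_nat k)%Z)).
  intros k _. apply sumZ_plus; auto.
Qed.

(** This is (x + 2)^(-3/2): still summable in one variable, while a product of two weights dominates
    a cubic decay in two variables ([cube_weight]). *)
Definition weight (x : R) : R := / ((x + 2) * sqrt (x + 2)).

Lemma weight_pos (x : R) : (0 <= x)%R -> (0 < weight x)%R.
Proof.
  intros H. apply Rinv_0_lt_compat, Rmult_lt_0_compat; [lra|]. apply sqrt_lt_R0. lra.
Qed.

Lemma weight_decr (x y : R) : (0 <= x <= y)%R -> (weight y <= weight x)%R.
Proof.
  intros H. apply Rinv_le_contravar.
  - apply Rmult_lt_0_compat; [lra|]. apply sqrt_lt_R0. lra.
  - apply Rmult_le_compat; try lra; [apply sqrt_pos|]. apply sqrt_le_1; lra.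
Qed.

(** The right side is the integral of x^(-3/2) over [k + 1, k + 2], and the weight is the value of
    this decreasing integrand at the right end. *)
Lemma weight_tail (k : nat) : (weight (INR k) <= 2 / sqrt (INR k + 1) - 2 / sqrt (INR (S k) + 1))%R.
Proof.
  rewrite S_INR. pose proof (pos_INR k) as P. unfold weight.
  replace (INR k + 2)%R with (INR k + 1 + 1)%R by ring.
  set (x := (INR k + 1)%R). assert (1 <= x)%R by (unfold x; lra).
  assert (A : (0 < sqrt x)%R) by (apply sqrt_lt_R0; lra).
  assert (B : (sqrt x < sqrt (x + 1))%R) by (apply sqrt_lt_1; lra).
  assert (A2 : (sqrt x * sqrt x = x)%R) by (apply sqrt_sqrt; lra).
  assert (B2 : (sqrt (x + 1) * sqrt (x + 1) = x + 1)%R) by (apply sqrt_sqrt; lra).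
  set (a := sqrt x) in *. set (b := sqrt (x + 1)) in *.
  rewrite <- B2.
  replace (2 / a - 2 / b)%R with (2 * (b - a) / (a * b))%R by (field; lra).
  apply Rle_div_r; [nra|].
  apply (Rmult_le_reg_l (b * b * b)); [nra|].
  replace (b * b * b * (/ (b * b * b) * (a * b)))%R with (a * b)%R by (field; lra).
  assert (D : ((b - a) * (b + a) = 1)%R) by nra.
  assert (a * b <= b * b)%R by nra.
  assert (1 <= 2 * b * (b - a))%R by nra.
  replace (b * b * b * (2 * (b - a)))%R with (b * b * (2 * b * (b - a)))%R by ring. nra.
Qed.

Lemma weight_tail_lim (c : R) : is_lim_seq (fun k => (c * (2 / sqrt (INR k + 1)))%R) 0%R.
Proof.
  apply is_lim_seq_scal_0, is_lim_seq_scal_0.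
  apply is_lim_seq_eps. intros eps He. destruct (INR_unbounded (/ (eps * eps))) as [n0 Hn].
  exists n0. intros n Hle. apply le_INR in Hle.
  assert (E2 : (0 < eps * eps)%R) by nra.
  assert (I : (0 < / (eps * eps))%R) by now apply Rinv_0_lt_compat.
  assert (S0 : (0 < sqrt (INR n + 1))%R) by (apply sqrt_lt_R0; lra).
  rewrite Rminus_0_r, Rabs_pos_eq by (left; now apply Rinv_0_lt_compat).
  rewrite <- (Rinv_inv eps). apply Rinv_lt_contravar.
  - apply Rmult_lt_0_compat; [now apply Rinv_0_lt_compat|assumption].
  - rewrite <- (sqrt_Rsqr (/ eps)) by (left; now apply Rinv_0_lt_compat).
    apply sqrt_lt_1; [apply Rle_0_sqr|lra|]. unfold Rsqr. rewrite <- Rinv_mult. lra.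
Qed.

Lemma SZ_weight_bound (a : Z -> C) (c : R) (K : nat) : (0 <= c)%R ->
  (forall m, (Cmod (a m) <= c * weight (Rabs (IZR m)))%R) -> (Cmod (SZ a K) <= 4 * c)%R.
Proof.
  intros Hc H.
  assert (Q : (Cmod (SZ a K) <= 2 * c * (2 - 2 / sqrt (INR K + 1)))%R).
  { induction K.
    - unfold SZ. simpl sumn. rewrite Cmod_0. simpl INR. rewrite Rplus_0_l, sqrt_1. lra.
    - rewrite SZ_S. eapply Rle_trans; [apply Cmod_triangle|].
      pose proof (Cmod_triangle (a (Z.of_nat K)) (a (-1 - Z.of_nat K)%Z)) as T.
      pose proof (H (Z.of_nat K)) as H1. pose proof (H (-1 - Z.of_nat K)%Z) as H2.
      pose proof (weight_tail K) as W. pose proof (pos_INR K).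
      rewrite <- INR_IZR_INZ, Rabs_pos_eq in H1 by assumption.
      assert (weight (Rabs (IZR (-1 - Z.of_nat K))) <= weight (INR K))%R.
      { apply weight_decr. split; [assumption|]. rewrite minus_IZR, <- INR_IZR_INZ, Rabs_left; lra. }
      set (t1 := (2 / sqrt (INR K + 1))%R) in *. set (t2 := (2 / sqrt (INR (S K) + 1))%R) in *.
      nra. }
  assert (0 <= 2 / sqrt (INR K + 1))%R.
  { pose proof (pos_INR K). left. apply Rdiv_lt_0_compat; [lra|]. apply sqrt_lt_R0. lra. }
  nra.
Qed.

(** The imaginary part controls n. The real part contains m + n Re tau, and lam times the estimate
    for the imaginary part makes up for n Re tau. Leaving out small |n| absorbs U, uniformly in
    m. *)
Lemma lattice_lower (tau U : C) : (0 < Im tau)%R ->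
  exists c n0, (0 < c)%R /\ forall n m : Z, (Z.of_nat n0 <= Z.abs n)%Z ->
  (c * (Rabs (IZR n) + Rabs (IZR m) + 2) <= Cmod (U + ZtoC m + ZtoC n * tau))%R.
Proof.
  intros Ht. set (x := Re tau). set (y := Im tau) in *.
  set (lam := ((Rabs x + 1) / y)%R).
  assert (Hl : (lam * y = Rabs x + 1)%R) by (unfold lam; field; lra).
  assert (L0 : (0 < lam)%R) by (pose proof (Rabs_pos x); apply Rdiv_lt_0_compat; lra).
  set (C0 := (lam * Rabs (Im U) + Rabs (Re U))%R).
  destruct (INR_unbounded (2 * C0 + 2)%R) as [n0 Hn0].
  exists (/ (2 * (lam + 1)))%R, n0. split; [apply Rinv_0_lt_compat; lra|].
  intros n m Hn. set (l := U + ZtoC m + ZtoC n * tau).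
  destruct (Rabs_le_Cmod l) as [LR LI].
  assert (ER : Re l = (Re U + IZR m + IZR n * x)%R).
  { unfold l, x. destruct U, tau. simpl. ring. }
  assert (EI : Im l = (Im U + IZR n * y)%R).
  { unfold l, y. destruct U, tau. simpl. ring. }
  rewrite ER in LR. rewrite EI in LI.
  assert (BI : (Rabs (IZR n) * y - Rabs (Im U) <= Cmod l)%R).
  { eapply Rle_trans; [|exact LI].
    pose proof (Rabs_triang (Im U + IZR n * y) (- Im U)) as T. rewrite Rabs_Ropp in T.
    replace (Im U + IZR n * y + - Im U)%R with (IZR n * y)%R in T by ring.
    rewrite Rabs_mult, (Rabs_pos_eq y) in T by lra. lra. }
  assert (BR : (Rabs (IZR m) - Rabs (IZR n) * Rabs x - Rabs (Re U) <= Cmod l)%R).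
  { eapply Rle_trans; [|exact LR].
    pose proof (Rabs_triang (Re U + IZR m + IZR n * x) (- (IZR n * x) + - Re U)) as T.
    replace (Re U + IZR m + IZR n * x + (- (IZR n * x) + - Re U))%R with (IZR m) in T by ring.
    pose proof (Rabs_triang (- (IZR n * x)) (- Re U)) as T2. rewrite !Rabs_Ropp, Rabs_mult in T2. lra. }
  assert (HN : (2 * C0 + 2 <= Rabs (IZR n))%R).
  { left. eapply Rlt_le_trans; [exact Hn0|]. rewrite <- abs_IZR, INR_IZR_INZ. now apply IZR_le. }
  pose proof (Rabs_pos (IZR m)).
  apply (Rmult_le_reg_l (2 * (lam + 1))); [lra|].
  rewrite <- Rmult_assoc, Rinv_r, Rmult_1_l by lra.
  assert (lam * (Rabs (IZR n) * y - Rabs (Im U)) <= lam * Cmod l)%R by (apply Rmult_le_compat_l; lra).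
  unfold C0 in *. nra.
Qed.

(** By the inequality of the means, the square roots of A + 2 and B + 2 have a product of at most A
    + B + 2; it remains to take cubes. *)
Lemma cube_weight (A B : R) : (0 <= A)%R -> (0 <= B)%R ->
  (/ ((A + B + 2) * (A + B + 2) * (A + B + 2)) <= weight A * weight B)%R.
Proof.
  intros HA HB. unfold weight. rewrite <- Rinv_mult.
  set (a := sqrt (A + 2)). set (b := sqrt (B + 2)).
  assert (a0 : (0 < a)%R) by (apply sqrt_lt_R0; lra).
  assert (b0 : (0 < b)%R) by (apply sqrt_lt_R0; lra).
  assert (A2 : (a * a = A + 2)%R) by (apply sqrt_sqrt; lra).
  assert (B2 : (b * b = B + 2)%R) by (apply sqrt_sqrt; lra).
  assert (X : (a * b <= A + B + 2)%R) by nra.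
  apply Rinv_le_contravar.
  - repeat apply Rmult_lt_0_compat; lra.
  - assert (0 < a * b)%R by nra. rewrite <- A2, <- B2.
    replace (a * a * a * (b * b * b))%R with (a * b * (a * b) * (a * b))%R by ring.
    apply Rmult_le_compat; nra.
Qed.

(** * The lattice sum and the exchange of summations *)

Section DoubleSeries.
Variables (tau u : C) (s r : R).
Hypothesis Ht : (0 < Im tau)%R.
Hypothesis Hs : (0 < s < 1)%R.
Hypothesis Hu : ~ in_lattice tau u.
Let v := RtoC s * tau + RtoC r.
Hypothesis Hw : ~ in_lattice tau (u + v).

(** The lattice sum after a summation by parts in m and one in n: the mixed second difference of
    1/(u + m + n tau), which decays cubically. *)
Definition double_term (n m : Z) : C :=
  expi (ZtoC n * RtoC r - ZtoC m * RtoC s) *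
  ((/ (u + ZtoC m + ZtoC n * tau) - / (u + ZtoC m + ZtoC n * tau - 1))
   - (/ (u + ZtoC m + ZtoC n * tau - tau) - / (u + ZtoC m + ZtoC n * tau - tau - 1))).

(** The sum of [double_term] over m by the Mittag-Leffler expansion at u + n tau and at u + (n - 1)
    tau; 1 - e(-s) is the cost of the summation by parts in m. *)
Definition row_sum (n : Z) : C :=
  - (2 * PI * Ci) * (1 - expi (- RtoC s)) * expi (RtoC s * u)
  * (lambert tau u v n - expi (RtoC r) * lambert tau u v (n - 1)).

Lemma lattice_neq_0 (a b : Z) : u + ZtoC a + ZtoC b * tau <> 0.
Proof.
  intros E. apply Hu. exists (- a)%Z, (- b)%Z. zc.
  transitivity (u + ZtoC a + ZtoC b * tau - ZtoC a - ZtoC b * tau); [ring|]. rewrite E. ring.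
Qed.

Lemma sumZ_row (n : Z) : sumZ (double_term n) (row_sum n).
Proof.
  pose proof (one_minus_neq_0 tau u n Hu) as D1.
  pose proof (one_minus_neq_0 tau u (n - 1) Hu) as D2.
  pose proof (sumZ_twisted s _ Hs D1) as S1. pose proof (sumZ_twisted s _ Hs D2) as S2.
  pose proof (sumZ_scal (expi (ZtoC n * RtoC r)) _ _ (sumZ_minus _ _ _ _ S1 S2)) as S3.
  match type of S3 with sumZ _ ?X => replace (row_sum n) with X end.
  - eapply sumZ_ext; [|exact S3]. intros m. cbv beta. unfold twisted, double_term.
    replace (expi (ZtoC n * r - ZtoC m * s)) with (expi (ZtoC n * r) * expi (- (ZtoC m * s))).
    2:{ rewrite <- expi_add. f_equal. }
    replace (u + ZtoC (n - 1) * tau + ZtoC m) with (u + ZtoC m + ZtoC n * tau - tau) by (zc; ring).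
    replace (u + ZtoC n * tau + ZtoC m) with (u + ZtoC m + ZtoC n * tau) by ring.
    ring.
  - unfold row_sum, lambert, v.
    replace (RtoC s * (u + ZtoC (n - 1) * tau)) with (s * u + ZtoC (n - 1) * (s * tau)) by ring.
    replace (RtoC s * (u + ZtoC n * tau)) with (s * u + ZtoC n * (s * tau)) by ring.
    replace (ZtoC n * (s * tau + r)) with (ZtoC n * (s * tau) + ZtoC n * r) by ring.
    replace (ZtoC (n - 1) * (s * tau + r)) with (ZtoC (n - 1) * (s * tau) + (ZtoC n * r - r)) by (zc; ring).
    rewrite (expi_add (s * u)), (expi_add (s * u)), (expi_add (ZtoC n * (s * tau))),
      (expi_add (ZtoC (n - 1) * (s * tau))), (expi_sub (ZtoC n * r) r).
    pose proof (expi_neq_0 r). set (X := - (2 * PI * Ci)). field. auto.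
Qed.

Lemma strip_v : (0 < Im v < Im tau)%R.
Proof. unfold v. destruct tau as [x y]. simpl in *. nra. Qed.

Lemma vanishing_shift_back (a : Z -> C) : vanishing a -> vanishing (fun n => a (n - 1)%Z).
Proof.
  intros [A B]. split.
  - apply Clim_incr. eapply Clim_ext; [|exact A]. intros n. cbv beta. f_equal. lia.
  - apply -> Clim_incr in B. eapply Clim_ext; [|exact B]. intros n. cbv beta. f_equal. lia.
Qed.

Lemma vanishing_row_sum : vanishing row_sum.
Proof.
  pose proof (vanishing_lambert tau u v strip_v Hu) as V.
  pose proof (vanishing_shift_back _ V) as V'.
  destruct V as [A B], V' as [A' B']. unfold row_sum.
  set (c := - (2 * PI * Ci) * (1 - expi (- RtoC s)) * expi (RtoC s * u)).
  split.
  - replace (RtoC 0) with (c * (0 - expi r * 0)) by ring.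
    apply Clim_scal, Clim_minus; [exact A|]. apply Clim_scal. exact A'.
  - replace (RtoC 0) with (c * (0 - expi r * 0)) by ring.
    apply Clim_scal, Clim_minus; [exact B|]. apply Clim_scal. exact B'.
Qed.

Lemma sumZ_row_sum : sumZ row_sum
  (- (2 * PI * Ci) * (1 - expi (- RtoC s)) * expi (RtoC s * u) * ((1 - expi r) * Psi tau u v)).
Proof.
  pose proof (sumZ_lambert tau u v strip_v Hu Hw) as L.
  pose proof (vanishing_lambert tau u v strip_v Hu) as V.
  assert (L' : sumZ (fun n => lambert tau u v (n - 1)) (Psi tau u v)).
  { apply sumZ_shift_inv; [now apply vanishing_shift_back|].
    eapply sumZ_ext; [|exact L]. intros n. cbv beta. f_equal. lia. }
  unfold row_sum. apply sumZ_scal.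
  replace ((1 - expi r) * Psi tau u v) with (Psi tau u v - expi r * Psi tau u v) by ring.
  apply sumZ_minus; [exact L|]. now apply sumZ_scal.
Qed.

(** Only |n| is bounded from below, not |m|: the partial row sums of every length then share one
    majorant in n. *)
Lemma double_term_bound : exists c n0, (0 <= c)%R /\ forall n m : Z, (Z.of_nat n0 <= Z.abs n)%Z ->
  (Cmod (double_term n m) <= c * (weight (Rabs (IZR n)) * weight (Rabs (IZR m))))%R.
Proof.
  destruct (lattice_lower tau u Ht) as (c1 & n1 & C1 & H1).
  destruct (lattice_lower tau (u - 1) Ht) as (c2 & n2 & C2 & H2).
  destruct (lattice_lower tau (u - tau) Ht) as (c3 & n3 & C3 & H3).
  destruct (lattice_lower tau (u - tau - 1) Ht) as (c4 & n4 & C4 & H4).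
  exists (Cmod tau * (/ (c2 * c3 * c4) + / (c1 * c2 * c3)))%R, (n1 + n2 + n3 + n4)%nat.
  assert (P1 : (0 < c2 * c3 * c4)%R) by (repeat apply Rmult_lt_0_compat; assumption).
  assert (P2 : (0 < c1 * c2 * c3)%R) by (repeat apply Rmult_lt_0_compat; assumption).
  assert (I1 := Rinv_0_lt_compat _ P1). assert (I2 := Rinv_0_lt_compat _ P2).
  split; [apply Rmult_le_pos; [apply Cmod_ge_0|lra]|].
  intros n m Hn. specialize (H1 n m ltac:(lia)). specialize (H2 n m ltac:(lia)).
  specialize (H3 n m ltac:(lia)). specialize (H4 n m ltac:(lia)).
  pose proof (Rabs_pos (IZR n)) as An. pose proof (Rabs_pos (IZR m)) as Am.
  pose proof (cube_weight _ _ An Am) as CW.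
  set (X := (Rabs (IZR n) + Rabs (IZR m) + 2)%R) in *.
  assert (X0 : (0 < X)%R) by (unfold X; lra).
  unfold double_term. set (l := u + ZtoC m + ZtoC n * tau) in *.
  replace (u - 1 + ZtoC m + ZtoC n * tau) with (l - 1) in H2 by (unfold l; ring).
  replace (u - tau + ZtoC m + ZtoC n * tau) with (l - tau) in H3 by (unfold l; ring).
  replace (u - tau - 1 + ZtoC m + ZtoC n * tau) with (l - tau - 1) in H4 by (unfold l; ring).
  assert (Pos : forall c, (0 < c)%R -> (0 < c * X)%R) by (intros; now apply Rmult_lt_0_compat).
  assert (N1 : l <> 0) by (apply Cmod_gt_0; pose proof (Pos _ C1); lra).
  assert (N2 : l - 1 <> 0) by (apply Cmod_gt_0; pose proof (Pos _ C2); lra).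
  assert (N3 : l - tau <> 0) by (apply Cmod_gt_0; pose proof (Pos _ C3); lra).
  assert (N4 : l - tau - 1 <> 0) by (apply Cmod_gt_0; pose proof (Pos _ C4); lra).
  (* The mixed difference, written as two terms of degree -3 without cancellation. *)
  replace (/ l - / (l - 1) - (/ (l - tau) - / (l - tau - 1))) with
    (tau * (1 / ((l - 1) * (l - tau) * (l - tau - 1)) + 1 / (l * (l - 1) * (l - tau))))
    by (field; auto).
  rewrite Cmod_mult, Cmod_expi.
  replace (Im (ZtoC n * r - ZtoC m * s)) with 0%R by (simpl; ring).
  rewrite Rmult_0_r, Ropp_0, exp_0, Rmult_1_l, Cmod_mult, Rmult_assoc.
  apply Rmult_le_compat_l; [apply Cmod_ge_0|].
  assert (Q : forall a b c x y z, (0 < a)%R -> (0 < b)%R -> (0 < c)%R ->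
     (a * X <= Cmod x)%R -> (b * X <= Cmod y)%R -> (c * X <= Cmod z)%R ->
     (Cmod (1 / (x * y * z)) <= / (a * b * c) * (weight (Rabs (IZR n)) * weight (Rabs (IZR m))))%R).
  { intros a b c x y z Ha Hb Hc Hx Hy Hz.
    pose proof (Pos _ Ha). pose proof (Pos _ Hb). pose proof (Pos _ Hc).
    eapply Rle_trans; [apply (Cmod_div_le _ _ ((a * X) * (b * X) * (c * X)))|].
    - repeat apply Rmult_lt_0_compat; assumption.
    - rewrite !Cmod_mult. repeat apply Rmult_le_compat; try lra. apply Rmult_le_pos; lra.
    - rewrite Cmod_1, Rmult_1_r.
      replace (a * X * (b * X) * (c * X))%R with ((a * b * c) * (X * X * X))%R by ring.
      rewrite Rinv_mult. apply Rmult_le_compat_l; [|exact CW].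
      left. apply Rinv_0_lt_compat. repeat apply Rmult_lt_0_compat; assumption. }
  eapply Rle_trans; [apply Cmod_triangle|]. rewrite Rmult_plus_distr_r.
  apply Rplus_le_compat; apply Q; assumption.
Qed.

(** The column sums are left as a parameter; for the S-transformation they are row sums of the
    series attached to -1/tau. *)
Lemma double_fubini (col : Z -> C) : (forall m, sumZ (fun n => double_term n m) (col m)) ->
  sumZ col (- (2 * PI * Ci) * (1 - expi (- RtoC s)) * expi (RtoC s * u) * ((1 - expi r) * Psi tau u v)).
Proof.
  intros HS. destruct double_term_bound as (c & n0 & Hc & HB).
  apply (fubiniZ double_term row_sum col _ (fun k => (4 * c * (2 / sqrt (INR k + 1)))%R) (S n0)); auto.
  - apply weight_tail_lim.
  - intros K.
    assert (Q : forall n, (Z.of_nat n0 <= Z.abs n)%Z ->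
      (Cmod (SZ (double_term n) K) <= 4 * c * weight (Rabs (IZR n)))%R).
    { intros n Hn. rewrite Rmult_assoc. apply SZ_weight_bound.
      - apply Rmult_le_pos; [assumption|]. left. apply weight_pos, Rabs_pos.
      - intros m. rewrite Rmult_assoc. now apply HB. }
    intros k Hk. rewrite <- Rmult_minus_distr_l. pose proof (weight_tail k) as W. pose proof (pos_INR k).
    assert (B : forall n, (Z.of_nat n0 <= Z.abs n)%Z -> (INR k <= Rabs (IZR n))%R ->
      (Cmod (SZ (double_term n) K) <= 4 * c * (2 / sqrt (INR k + 1) - 2 / sqrt (INR (S k) + 1)))%R).
    { intros n Hn Hk'. eapply Rle_trans; [apply Q; exact Hn|].
      apply Rmult_le_compat_l; [lra|]. eapply Rle_trans; [|exact W]. apply weight_decr. lra. }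
    split; apply B; try lia.
    + rewrite <- INR_IZR_INZ. apply Rle_abs.
    + rewrite minus_IZR, <- INR_IZR_INZ, Rabs_left; lra.
  - apply sumZ_row.
  - apply sumZ_row_sum.
Qed.

End DoubleSeries.

Lemma in_lattice_S (tau u : C) : (0 < Im tau)%R -> in_lattice (- (1) / tau) (u / tau) -> in_lattice tau u.
Proof.
  intros Ht (m & n & H). assert (tau <> 0) by (intros E; rewrite E in Ht; simpl in Ht; lra).
  exists (- n)%Z, m. zc. replace u with (u / tau * tau) by (field; assumption). rewrite H.
  field. assumption.
Qed.

Lemma Im_S (tau : C) : (0 < Im tau)%R -> (0 < Im (- (1) / tau))%R.
Proof.
  intros Ht. destruct tau as [x y]. simpl in *.
  assert (0 < x * (x * 1) + y * (y * 1))%R by nra.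
  match goal with |- (0 < ?X)%R =>
    replace X with (y / (x * (x * 1) + y * (y * 1)))%R by (field; lra) end.
  now apply Rdiv_lt_0_compat.
Qed.

Lemma one_minus_expi_R_neq_0 (s : R) : (forall k : Z, s <> IZR k) -> 1 - expi (RtoC s) <> 0.
Proof.
  intros H F. apply one_minus_eq_0 in F.
  apply expi_eq_1 in F. destruct F as [n Hn]. apply RtoC_inj in Hn. now apply (H n).
Qed.

(* [Psi] is, up to elementary factors, the lattice sum
   [sum_{n,m} e(n r - m s) / (u + m + n tau)]; the S-transformation exchanges the
   two summations. *)
Lemma Psi_S_fundamental (tau u : C) (s r : R) : (0 < Im tau)%R -> (0 < s < 1)%R -> (-1 < r < 0)%R ->
  ~ in_lattice tau u -> ~ in_lattice tau (u + (RtoC s * tau + RtoC r)) ->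
  Psi (- (1) / tau) (u / tau) ((RtoC s * tau + RtoC r) / tau)
  = tau * expi (u * (RtoC s * tau + RtoC r) / tau) * Psi tau u (RtoC s * tau + RtoC r).
Proof.
  intros Ht Hs Hr Hu Hw. assert (T0 : tau <> 0) by (intros E; rewrite E in Ht; simpl in Ht; lra).
  pose proof PI_RGT_0 as PP.
  set (tau' := - (1) / tau). set (u' := u / tau). set (v := RtoC s * tau + RtoC r) in *.
  assert (Ht' : (0 < Im tau')%R) by now apply Im_S.
  (* Relative to -1/tau, the coordinates (s, r) of v become (-r, s); the range -1 < r < 0 thus makes
     -r an admissible first coordinate. *)
  assert (Ev : RtoC (- r) * tau' + RtoC s = v / tau).
  { unfold tau', v. rewrite RtoC_opp. field. exact T0. }
  assert (Hu' : ~ in_lattice tau' u') by (intros K; now apply Hu, in_lattice_S).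
  assert (Hw' : ~ in_lattice tau' (u' + (RtoC (- r) * tau' + RtoC s))).
  { rewrite Ev. unfold u'. replace (u / tau + v / tau) with ((u + v) / tau) by (field; exact T0).
    intros K. now apply Hw, in_lattice_S. }
  pose proof (sumZ_row_sum tau' u' (- r) s Ht' ltac:(lra) Hu' Hw') as S1.
  pose proof (sumZ_row tau' u' (- r) s ltac:(lra) Hu') as R1.
  pose proof (vanishing_row_sum tau' u' (- r) s Ht' ltac:(lra) Hu' Hw') as V1.
  set (R' := row_sum tau' u' (- r) s) in *.
  set (q := - (tau * expi (RtoC s))).
  assert (Q0 : q <> 0).
  { unfold q. intros E. assert (tau * expi s = 0) as E2.
    { replace (tau * expi s) with (- - (tau * expi s)) by ring. rewrite E. ring. }
    revert E2. apply Cmult_neq_0; [exact T0|apply expi_neq_0]. }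
  (* Dividing the lattice by tau sends (n, m) to (m, -n). The backward difference in n becomes a
     forward one, which is minus a backward difference one step further: hence the index 1 - n, the
     sign in q, and the phase e(s). *)
  assert (DT : forall n m, double_term tau' u' (- r) s n m = q * double_term tau u s r m (1 - n)).
  { intros n m. unfold double_term, q.
    replace (expi (ZtoC n * s - ZtoC m * (- r)%R)) with (expi s * expi (ZtoC m * r - ZtoC (1 - n) * s)).
    2:{ rewrite <- expi_add. f_equal. rewrite RtoC_opp. zc. ring. }
    set (E := expi (ZtoC m * r - ZtoC (1 - n) * s)).
    pose proof (lattice_neq_0 tau u Hu (- n) m) as L1.
    pose proof (lattice_neq_0 tau u Hu (- n) (m - 1)) as L2.
    pose proof (lattice_neq_0 tau u Hu (1 - n) m) as L3.
    pose proof (lattice_neq_0 tau u Hu (1 - n) (m - 1)) as L4.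
    replace (u' + ZtoC m + ZtoC n * tau') with ((u + ZtoC (- n) + ZtoC m * tau) / tau).
    2:{ unfold u', tau'. zc. field. exact T0. }
    replace ((u + ZtoC (- n) + ZtoC m * tau) / tau - 1) with ((u + ZtoC (- n) + ZtoC (m - 1) * tau) / tau).
    2:{ zc. field. exact T0. }
    replace ((u + ZtoC (- n) + ZtoC m * tau) / tau - tau') with ((u + ZtoC (1 - n) + ZtoC m * tau) / tau).
    2:{ unfold tau'. zc. field. exact T0. }
    replace ((u + ZtoC (1 - n) + ZtoC m * tau) / tau - 1) with ((u + ZtoC (1 - n) + ZtoC (m - 1) * tau) / tau).
    2:{ zc. field. exact T0. }
    replace (u + ZtoC (1 - n) + ZtoC m * tau - tau - 1) with (u + ZtoC (- n) + ZtoC (m - 1) * tau).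
    2:{ zc. ring. }
    replace (u + ZtoC (1 - n) + ZtoC m * tau - tau) with (u + ZtoC (1 - n) + ZtoC (m - 1) * tau).
    2:{ zc. ring. }
    replace (u + ZtoC (1 - n) + ZtoC m * tau - 1) with (u + ZtoC (- n) + ZtoC m * tau).
    2:{ zc. ring. }
    set (A := u + ZtoC (- n) + ZtoC m * tau) in *. set (B := u + ZtoC (- n) + ZtoC (m - 1) * tau) in *.
    set (D := u + ZtoC (1 - n) + ZtoC m * tau) in *. set (F := u + ZtoC (1 - n) + ZtoC (m - 1) * tau) in *.
    field. repeat split; assumption. }
  assert (Col : forall m, sumZ (fun n => double_term tau u s r n m) (/ q * R' (1 - m)%Z)).
  { intros m. eapply sumZ_ext; [|apply sumZ_scal, (R1 (1 - m)%Z)]. intros n. cbv beta.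
    rewrite DT. replace (1 - (1 - m))%Z with m by lia. field. exact Q0. }
  pose proof (double_fubini tau u s r Ht Hs Hu Hw _ Col) as S2. fold v in S2.
  assert (S3 : sumZ (fun m => / q * R' (1 - m)%Z) (/ q * (- (2 * PI * Ci) * (1 - expi (- RtoC (- r))) *
     expi (RtoC (- r) * u') * ((1 - expi s) * Psi tau' u' (RtoC (- r) * tau' + RtoC s))))).
  { apply sumZ_scal.
    assert (W : vanishing (fun m => R' (m + 1)%Z)).
    { destruct V1 as [A B]. unfold vanishing. split.
      - apply -> Clim_incr in A. eapply Clim_ext; [|exact A]. intros n. cbv beta. f_equal. lia.
      - apply Clim_incr. eapply Clim_ext; [|exact B]. intros n. cbv beta. f_equal. lia. }
    apply sumZ_ext with (fun m => R' (- m + 1)%Z). { intros m. f_equal. lia. }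
    apply (sumZ_opp (fun m => R' (m + 1)%Z)); [exact W|]. now apply sumZ_shift. }
  pose proof (Clim_unique _ _ _ S2 S3) as EQ.
  rewrite Ev in EQ.
  assert (K0 : 2 * PI * Ci <> 0).
  { apply Cmult_neq_0; [|exact Ci_nz]. apply Cmult_neq_0.
    - intros E. apply RtoC_inj in E. lra.
    - intros E. apply RtoC_inj in E. lra. }
  assert (KN : - (2 * PI * Ci) <> 0).
  { intros E. apply K0. replace (2 * PI * Ci) with (- - (2 * PI * Ci)) by ring. rewrite E. ring. }
  assert (Ns : 1 - expi (RtoC s) <> 0).
  { apply one_minus_expi_R_neq_0. intros k E. rewrite E in Hs. destruct Hs as [A B].
    apply (lt_IZR 0) in A. apply (lt_IZR _ 1) in B. lia. }
  assert (Nr : 1 - expi (RtoC r) <> 0).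
  { apply one_minus_expi_R_neq_0. intros k E. rewrite E in Hr. destruct Hr as [A B].
    apply (lt_IZR (-1)) in A. apply (lt_IZR _ 0) in B. lia. }
  replace (- RtoC (- r)) with (RtoC r) in EQ by (rewrite RtoC_opp; ring).
  replace (u * v / tau) with (s * u + r * u').
  2:{ unfold v, u'. field. exact T0. }
  replace (RtoC (- r) * u') with (- (r * u')) in EQ by (rewrite RtoC_opp; ring).
  rewrite (expi_opp (r * u')), (expi_opp (RtoC s)) in EQ. rewrite expi_add.
  set (K := - (2 * PI * Ci)) in *. set (P' := Psi tau' u' (v / tau)) in *. set (P := Psi tau u v) in *.
  pose proof (expi_neq_0 s) as Es. pose proof (expi_neq_0 (r * u')) as Er.
  set (es := expi s) in *. set (er := expi (r * u')) in *. set (eu := expi (s * u)) in *.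
  set (e1 := expi r) in *. unfold q in EQ.
  apply (f_equal (fun X => - X * tau * es * er * / (K * (1 - e1) * (1 - es)))) in EQ.
  transitivity (- (/ - (tau * es) * (K * (1 - e1) * / er * ((1 - es) * P'))) * tau * es * er * / (K * (1 - e1) * (1 - es))).
  - field. repeat split; assumption.
  - rewrite <- EQ. field. repeat split; assumption.
Qed.

(** Both sides have the same quasi-periodicity in v, so (s, r) may be moved to the cell 0 < s < 1,
    -1 < r < 0; non-integral s and r stay off its boundary. *)
Theorem Psi_S (tau u : C) (s r : R) : (0 < Im tau)%R ->
  (forall k : Z, s <> IZR k) -> (forall k : Z, r <> IZR k) ->
  ~ in_lattice tau u -> ~ in_lattice tau (u + (RtoC s * tau + RtoC r)) ->
  Psi (- (1) / tau) (u / tau) ((RtoC s * tau + RtoC r) / tau)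
  = tau * expi (u * (RtoC s * tau + RtoC r) / tau) * Psi tau u (RtoC s * tau + RtoC r).
Proof.
  intros Ht Hs Hr Hu Hw. assert (T0 : tau <> 0) by (intros E; rewrite E in Ht; simpl in Ht; lra).
  destruct (archimed s) as [s1 s2]. destruct (archimed r) as [r1 r2].
  set (a := (up s - 1)%Z). set (b := up r).
  set (s0 := (s - IZR a)%R). set (r0 := (r - IZR b)%R).
  assert (Hs0 : (0 < s0 < 1)%R).
  { unfold s0, a. rewrite minus_IZR. split; [|lra].
    assert (s <> IZR (up s) - 1)%R by (rewrite <- minus_IZR; apply Hs). lra. }
  assert (Hr0 : (-1 < r0 < 0)%R).
  { unfold r0, b. split; [|lra].
    assert (r <> IZR (up r) - 1)%R by (rewrite <- minus_IZR; apply Hr). lra. }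
  set (v0 := RtoC s0 * tau + RtoC r0).
  assert (Ev : RtoC s * tau + RtoC r = v0 + ZtoC a * tau + ZtoC b).
  { unfold v0, s0, r0. rewrite !RtoC_minus. unfold ZtoC. ring. }
  assert (Hv0 : ~ in_lattice tau v0).
  { apply strip_not_in_lattice. unfold v0. destruct tau as [x y]. simpl in *. nra. }
  assert (Hw0 : ~ in_lattice tau (u + v0)).
  { intros K. apply Hw. rewrite Ev. destruct K as (m & n & K). exists (m + b)%Z, (n + a)%Z.
    zc. rewrite !Cplus_assoc, K. ring. }
  assert (F := Psi_S_fundamental tau u s0 r0 Ht Hs0 Hr0 Hu Hw0). fold v0 in F.
  rewrite Ev, Psi_add_lattice_r by assumption.
  replace ((v0 + ZtoC a * tau + ZtoC b) / tau) with (v0 / tau + ZtoC (- b) * (- (1) / tau) + ZtoC a).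
  2:{ zc. field. exact T0. }
  rewrite Psi_add_lattice_r.
  2:{ now apply Im_S. }
  2:{ intros K. now apply Hu, in_lattice_S. }
  2:{ intros K. now apply Hv0, in_lattice_S. }
  rewrite F.
  replace (u * (v0 + ZtoC a * tau + ZtoC b) / tau) with (u * v0 / tau + ZtoC a * u + - (ZtoC (- b) * (u / tau))).
  2:{ zc. field. exact T0. }
  rewrite (expi_add (u * v0 / tau + ZtoC a * u)), (expi_add (u * v0 / tau)).
  rewrite (expi_opp (ZtoC a * u)). pose proof (expi_neq_0 (ZtoC a * u)). field. assumption.
Qed.

(** * The distribution relation *)

Lemma sumn_mul (a : nat -> C) (n m : nat) :
  sumn a (n * m) = sumn (fun i => sumn (fun d => a (i * m + d)%nat) m) n.
Proof.
  induction n; [reflexivity|].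
  replace (S n * m)%nat with (n * m + m)%nat by lia. rewrite sumn_add, IHn. reflexivity.
Qed.

(** The half-open window -N m <= j < N m is exactly the union, over the residues d mod m, of windows
    -N <= n < N. *)
Lemma SZ_mul (a : Z -> C) (N m : nat) :
  SZ a (N * m) = sumn (fun d => SZ (fun n => a (Z.of_nat m * n + Z.of_nat d)%Z) N) m.
Proof.
  unfold SZ. rewrite sumn_mul, sumn_swap.
  transitivity (sumn (fun i => sumn (fun d => a (Z.of_nat m * Z.of_nat i + Z.of_nat d)%Z
     + a (Z.of_nat m * (- 1 - Z.of_nat i) + Z.of_nat d)%Z) m) N); [|apply sumn_swap].
  rewrite sumn_swap. apply sumn_ext. intros i _. rewrite !sumn_plus. f_equal.
  - apply sumn_ext. intros d _. f_equal. lia.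
  - rewrite sumn_rev. apply sumn_ext. intros d Hd. f_equal. lia.
Qed.

Lemma not_in_lattice_multiple (tau u : C) (M : nat) (d : Z) : ~ in_lattice tau u ->
  ~ in_lattice (NtoC M * tau) (u + ZtoC d * tau).
Proof.
  intros H (m & n & E). apply H. exists m, (n * Z.of_nat M - d)%Z. zc.
  replace u with (u + ZtoC d * tau - ZtoC d * tau) by ring. rewrite E. ring.
Qed.

Lemma not_in_lattice_divide (tau u : C) (M : nat) : (0 < M)%nat -> ~ in_lattice tau u ->
  ~ in_lattice (tau / NtoC M) (u / NtoC M).
Proof.
  intros HM H (m & n & E). assert (M0 : NtoC M <> 0).
  { intros K. apply (ZtoC_inj _ 0) in K. lia. }
  apply H. exists (m * Z.of_nat M)%Z, n. zc.
  replace u with (u / NtoC M * NtoC M) by (field; exact M0).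
  rewrite E. field. exact M0.
Qed.

Lemma Im_div_Z (x : C) (M : nat) : (0 < M)%nat ->
  Im (x / NtoC M) = (Im x / IZR (Z.of_nat M))%R.
Proof.
  intros H. assert (IZR (Z.of_nat M) <> 0)%R by (apply not_0_IZR; lia).
  destruct x. simpl. field. assumption.
Qed.

Lemma Im_mul_Z (x : C) (m : Z) : Im (ZtoC m * x) = (IZR m * Im x)%R.
Proof. destruct x. simpl. ring. Qed.

Section Distribution.
Variables (tau u : C) (M : nat).
Hypothesis Ht : (0 < Im tau)%R.
Hypothesis HM : (0 < M)%nat.
Hypothesis Hu : ~ in_lattice tau u.
Let MM := NtoC M.

Definition dist_term (v : C) (d c : nat) : C :=
  expi ((NtoC c * u + NtoC d * v + NtoC c * NtoC d * tau) / MM)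
  * Psi (MM * tau) (u + NtoC d * tau) (v + NtoC c * tau).

Lemma dist_MM_neq_0 : MM <> 0.
Proof. intros K. apply (ZtoC_inj _ 0) in K. lia. Qed.

(** With x = e((u + (M n + d) tau)/M), the expansion 1/(1 - x) = (1 + ... + x^(M-1))/(1 - x^M) gives
    the sum over c; the modulus of x^M is attached to M tau. *)
Lemma lambert_split (v : C) (d : nat) (n : Z) :
  lambert (tau / MM) (u / MM) (v / MM) (Z.of_nat M * n + Z.of_nat d)
  = sumn (fun c => expi ((NtoC c * u + NtoC d * v
                          + NtoC c * NtoC d * tau) / MM)
       * lambert (MM * tau) (u + NtoC d * tau) (v + NtoC c * tau) n) M.
Proof.
  pose proof dist_MM_neq_0 as M0.
  pose proof (one_minus_neq_0 _ _ (Z.of_nat M * n + Z.of_nat d) (not_in_lattice_divide tau u M HM Hu)) as D1.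
  pose proof (one_minus_neq_0 _ _ n (not_in_lattice_multiple tau u M (Z.of_nat d) Hu)) as D2.
  fold MM in D1, D2. unfold lambert.
  set (x := u / MM + ZtoC (Z.of_nat M * n + Z.of_nat d) * (tau / MM)) in *.
  assert (Ex : MM * x = u + NtoC d * tau + ZtoC n * (MM * tau)).
  { unfold x. zc. fold MM. field. exact M0. }
  rewrite <- Ex in *.
  rewrite (sumn_ext _ (fun c => (expi (ZtoC n * v + NtoC d * v / MM) / (1 - expi (MM * x))) *
     expi (NtoC c * x))).
  2:{ intros c Hc. unfold Cdiv at 2 3. rewrite Cmult_assoc, <- expi_add.
      rewrite <- (Cmult_assoc _ (/ _)), (Cmult_comm (/ _)), Cmult_assoc, <- expi_add. do 2 f_equal.
      unfold x. zc. fold MM. field. exact M0. }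
  rewrite sumn_scal, geom_expi by exact D1. fold MM.
  replace (ZtoC (Z.of_nat M * n + Z.of_nat d) * (v / MM)) with (ZtoC n * v + NtoC d * v / MM).
  2:{ zc. fold MM. field. exact M0. }
  field. split; assumption.
Qed.

(** For 0 < Im v < Im tau every v + c tau with c < M lies in the strip of M tau, so all the Lambert
    series involved converge. *)
Lemma Psi_distribution_strip (v : C) : (0 < Im v < Im tau)%R -> ~ in_lattice tau (u + v) ->
  Psi (tau / MM) (u / MM) (v / MM) = sumn (fun d => sumn (dist_term v d) M) M.
Proof.
  intros Hv Hw. pose proof dist_MM_neq_0 as M0.
  assert (MP : (1 <= IZR (Z.of_nat M))%R) by (apply (IZR_le 1); lia).
  assert (L : sumZ (lambert (tau / MM) (u / MM) (v / MM)) (Psi (tau / MM) (u / MM) (v / MM))).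
  { apply sumZ_lambert.
    - unfold MM. rewrite !Im_div_Z by assumption. split.
      + apply Rdiv_lt_0_compat; lra.
      + apply Rmult_lt_compat_r; [apply Rinv_0_lt_compat|]; lra.
    - now apply not_in_lattice_divide.
    - replace (u / MM + v / MM) with ((u + v) / MM) by (field; exact M0). now apply not_in_lattice_divide. }
  apply (Clim_unique (fun N => SZ (lambert (tau / MM) (u / MM) (v / MM)) (N * M))).
  - apply (Clim_subseq (SZ (lambert (tau / MM) (u / MM) (v / MM)))); [|exact L].
    intros P [n0 H]. exists n0. intros n Hn. apply H. nia.
  - apply Clim_ext with (fun N => sumn (fun d => SZ (fun n =>
       lambert (tau / MM) (u / MM) (v / MM) (Z.of_nat M * n + Z.of_nat d)%Z) N) M).
    { intros N. now rewrite SZ_mul. }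
    apply Clim_sumn. intros d Hd.
    eapply sumZ_ext; [intros n; symmetry; apply lambert_split|].
    apply sumZ_sumn. intros c Hc. apply sumZ_scal. apply sumZ_lambert.
    + unfold MM. rewrite Im_mul_Z.
      change (Im (v + NtoC c * tau)) with (Im v + Im (NtoC c * tau))%R.
      rewrite Im_mul_Z. assert (0 <= IZR (Z.of_nat c))%R by (apply IZR_le; lia).
      assert (IZR (Z.of_nat c) + 1 <= IZR (Z.of_nat M))%R.
      { rewrite <- plus_IZR. apply IZR_le. lia. }
      split; nra.
    + now apply not_in_lattice_multiple.
    + replace (u + NtoC d * tau + (v + NtoC c * tau))
        with (u + v + ZtoC (Z.of_nat d + Z.of_nat c) * tau) by (zc; ring).
      now apply not_in_lattice_multiple.
Qed.

Lemma sumn_cyclic (G : nat -> C) (n : nat) : G n = G 0%nat ->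
  sumn (fun c => G (S c)) n = sumn G n.
Proof.
  intros H. pose proof (sumn_S_l G n) as E. simpl in E. rewrite H in E.
  replace (sumn (fun c => G (S c)) n) with (G 0%nat + sumn (fun c => G (S c)) n - G 0%nat) by ring.
  rewrite <- E. ring.
Qed.

Lemma Im_MM_tau : (0 < Im (MM * tau))%R.
Proof.
  unfold MM. rewrite Im_mul_Z. apply Rmult_lt_0_compat; [apply (IZR_lt 0); lia|assumption].
Qed.

(** Adding tau to v raises c by one; the term that leaves the range at c = M equals the one at c =
    0, by quasi-periodicity for the period M tau. *)
Lemma dist_sum_step (v : C) : ~ in_lattice tau v ->
  sumn (fun d => sumn (dist_term (v + tau) d) M) M
  = expi (- (u / MM)) * sumn (fun d => sumn (dist_term v d) M) M.
Proof.
  intros Hv. pose proof dist_MM_neq_0 as M0. rewrite <- sumn_scal. apply sumn_ext. intros d Hd.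
  rewrite <- (sumn_cyclic (dist_term v d) M).
  - rewrite <- sumn_scal. apply sumn_ext. intros c Hc. unfold dist_term.
    rewrite Cmult_assoc, <- expi_add. f_equal.
    + f_equal. zc. field. exact M0.
    + f_equal. zc. ring.
  - unfold dist_term. fold MM. change (NtoC 0) with (RtoC 0).
    replace (v + 0 * tau) with v by ring.
    rewrite Psi_add_tau_r.
    2:{ apply Im_MM_tau. }
    2:{ now apply not_in_lattice_multiple. }
    2:{ replace v with (v + ZtoC 0 * tau) by (zc; ring). now apply not_in_lattice_multiple. }
    rewrite Cmult_assoc, <- expi_add. do 2 f_equal. field. exact M0.
Qed.

(** The strip condition concerns Im v alone, so only s is reduced modulo 1, both sides acquiring
    e(-u/M) when v is raised by tau. *)
Theorem Psi_distribution (s r : R) : (forall k : Z, s <> IZR k) ->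
  ~ in_lattice tau (u + (RtoC s * tau + RtoC r)) ->
  Psi (tau / MM) (u / MM) ((RtoC s * tau + RtoC r) / MM)
  = sumn (fun d => sumn (dist_term (RtoC s * tau + RtoC r) d) M) M.
Proof.
  intros Hs Hw. pose proof dist_MM_neq_0 as M0.
  destruct (archimed s) as [s1 s2]. set (a := (up s - 1)%Z). set (s0 := (s - IZR a)%R).
  assert (Hs0 : (0 < s0 < 1)%R).
  { unfold s0, a. rewrite minus_IZR. split; [|lra].
    assert (s <> IZR (up s) - 1)%R by (rewrite <- minus_IZR; apply Hs). lra. }
  set (v0 := RtoC s0 * tau + RtoC r).
  replace (RtoC s * tau + RtoC r) with (v0 + ZtoC a * tau) in *.
  2:{ unfold v0, s0. rewrite !RtoC_minus. unfold ZtoC. ring. }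
  assert (Iv0 : (0 < Im v0 < Im tau)%R).
  { unfold v0. clear - Hs0 Ht. destruct tau as [x y]. simpl in *. nra. }
  assert (Hv0 := strip_not_in_lattice _ _ Iv0).
  assert (Hw0 : ~ in_lattice tau (u + v0)).
  { intros K. apply Hw. replace (u + (v0 + ZtoC a * tau)) with (u + v0 + ZtoC a * tau) by ring.
    destruct K as (m & n & K). exists m, (n + a)%Z. zc. rewrite K. ring. }
  generalize a. apply Z_ind_step.
  - zc. replace (v0 + 0 * tau) with v0 by ring. now apply Psi_distribution_strip.
  - intros k. assert (Hk : ~ in_lattice tau (v0 + ZtoC k * tau)).
    { replace (v0 + ZtoC k * tau) with (v0 + ZtoC k * tau + ZtoC 0) by (zc; ring).
      now apply not_in_lattice_shift. }
    set (v := v0 + ZtoC k * tau) in *.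
    replace (v0 + ZtoC (k + 1) * tau) with (v + tau) by (unfold v; zc; ring).
    rewrite dist_sum_step by assumption.
    replace ((v + tau) / MM) with (v / MM + tau / MM) by (field; exact M0).
    rewrite Psi_add_tau_r.
    2:{ unfold MM. rewrite Im_div_Z by assumption. apply Rdiv_lt_0_compat; [assumption|apply (IZR_lt 0); lia]. }
    2:{ now apply not_in_lattice_divide. }
    2:{ now apply not_in_lattice_divide. }
    pose proof (expi_neq_0 (- (u / MM))) as E0. split; intros E.
    + now rewrite E.
    + apply (f_equal (fun X => / expi (- (u / MM)) * X)) in E.
      rewrite !Cmult_assoc, Cinv_l, !Cmult_1_l in E by exact E0. exact E.
Qed.

End Distribution.

(** * Numerators and their quotients *)

(* The pair [(p, e)] is the characteristic: [p = 1] in the untwisted and [p = 0] in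
   the twisted sector, [e = 1] for characters and [e = 0] for supercharacters. *)
Definition numerator (M : nat) (p e i j : Z) (tau z : C) : C :=
  let MM := NtoC M in
  let a := ZtoC i + ZtoC p / 2 in
  let b := ZtoC j + ZtoC p / 2 in
  expi (((a + b) * z + a * b * tau) / MM)
  * Psi (MM * tau) (z + a * tau + ZtoC e / 2) (z + b * tau + ZtoC e / 2).

Definition quotient (M : nat) (p e i j : Z) (tau z : C) : C :=
  numerator M p e i j tau z / numerator 1 p e 0 0 tau z.

Lemma ZtoC_nat_neq_0 (M : nat) : (0 < M)%nat -> NtoC M <> 0.
Proof. intros HM K. apply (ZtoC_inj _ 0) in K. lia. Qed.

Lemma regular_not_in_lattice (tau z : C) (p e i : Z) : regular tau z ->
  ~ in_lattice tau (z + (ZtoC i + ZtoC p / 2) * tau + ZtoC e / 2).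
Proof.
  intros [Ht H] (m & n & E). apply (H (2 * m - e)%Z (2 * n - 2 * i - p)%Z). zc.
  replace z with (z + (ZtoC i + ZtoC p / 2) * tau + ZtoC e / 2
     - (ZtoC i + ZtoC p / 2) * tau - ZtoC e / 2) by ring.
  rewrite E. field.
Qed.

Lemma regular_not_in_lattice_M (tau z : C) (M : nat) (p e i : Z) : regular tau z ->
  ~ in_lattice (NtoC M * tau) (z + (ZtoC i + ZtoC p / 2) * tau + ZtoC e / 2).
Proof.
  intros H. pose proof (not_in_lattice_multiple _ _ M 0 (regular_not_in_lattice _ _ p e i H)) as K.
  change (ZtoC 0) with (RtoC 0) in K. now rewrite Cmult_0_l, Cplus_0_r in K.
Qed.

Lemma regular_sum_not_in_lattice (tau z : C) (m n : Z) : regular tau z ->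
  ~ in_lattice tau (2 * z + ZtoC m * tau + ZtoC n).
Proof.
  intros [Ht H] (a & b & E). apply (H (a - n)%Z (b - m)%Z). zc.
  transitivity (2 * z + ZtoC m * tau + ZtoC n - ZtoC m * tau - ZtoC n); [ring|]. rewrite E. ring.
Qed.

Lemma tau_neq_0 (tau : C) : (0 < Im tau)%R -> tau <> 0.
Proof. intros Ht E. rewrite E in Ht. simpl in Ht. lra. Qed.

Lemma regular_S (tau z : C) : regular tau z -> regular (- (1) / tau) (z / tau).
Proof.
  intros [Ht H]. split; [now apply Im_S|]. intros m n E. apply (H (- n)%Z m). zc.
  pose proof (tau_neq_0 tau Ht).
  replace (2 * z) with (2 * (z / tau) * tau) by (field; assumption). rewrite E. field. assumption.
Qed.

Lemma Clim_numerator (M : nat) (p e i j : Z) (tau z : C) (zs : nat -> C) : (0 < M)%nat ->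
  regular tau z -> Clim zs z ->
  Clim (fun n => numerator M p e i j tau (zs n)) (numerator M p e i j tau z).
Proof.
  intros HM H Hz. unfold numerator. apply Clim_mult.
  - apply Clim_expi. apply Clim_div; [now apply ZtoC_nat_neq_0| |apply Clim_const].
    apply Clim_plus; [now apply Clim_scal|apply Clim_const].
  - apply Clim_Psi.
    + apply Im_MM_tau; [apply H|exact HM].
    + now apply regular_not_in_lattice_M.
    + now apply regular_not_in_lattice_M.
    + repeat apply Clim_plus; try apply Clim_const; assumption.
    + repeat apply Clim_plus; try apply Clim_const; assumption.
Qed.

Definition S_coef (M : nat) (p e i j : Z) (d c : nat) : C :=
  let a := ZtoC i + ZtoC p / 2 in
  let b := ZtoC j + ZtoC p / 2 in
  expi (- ((ZtoC e / 2 * (a + b) + NtoC c * a + NtoC d * b) / NtoC M)).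

(** Since M (-1/tau) = -1/(tau/M), [Psi_S] is applied at tau/M, and the distribution relation brings
    the result back to M tau. Non-integrality of 2s and 2r survives the half-integral shifts by the
    characteristic. *)
Lemma numerator_S_generic (M : nat) (p e i j : Z) (tau : C) (s r : R) : (0 < M)%nat ->
  let z := RtoC s * tau + RtoC r in
  (0 < Im tau)%R -> (forall k : Z, (2 * s)%R <> IZR k) -> (forall k : Z, (2 * r)%R <> IZR k) ->
  numerator M p e i j (- (1) / tau) (z / tau)
  = tau / NtoC M * expi (z * z / (NtoC M * tau)) *
    sumn (fun d => sumn (fun c =>
      S_coef M p e i j d c * numerator M e p (Z.of_nat d) (Z.of_nat c) tau z) M) M.
Proof.
  intros HM z Ht Hs Hr. pose proof (tau_neq_0 tau Ht) as T0.
  assert (Hz : regular tau z).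
  { split; [exact Ht|]. intros m n E. apply (Hs n). apply (f_equal Im) in E. unfold z in E.
    destruct tau as [x y]. simpl in *.
    assert (2 * s * y = IZR n * y)%R by lra. nra. }
  set (MM := NtoC M). assert (M0 : MM <> 0) by now apply ZtoC_nat_neq_0.
  assert (MR : (1 <= IZR (Z.of_nat M))%R) by (apply (IZR_le 1); lia).
  set (a := ZtoC i + ZtoC p / 2). set (b := ZtoC j + ZtoC p / 2). set (al := ZtoC e / 2).
  set (U := z - a + al * tau). set (V := z - b + al * tau).
  set (s' := (s + IZR e / 2)%R). set (r' := (r - IZR j - IZR p / 2)%R).
  assert (EV : V = RtoC s' * tau + RtoC r').
  { unfold V, b, al, z, s', r'. rewrite !RtoC_minus, RtoC_plus, !RtoC_div by lra. unfold ZtoC. ring. }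
  assert (Hs' : forall k : Z, s' <> IZR k).
  { intros k E. apply (Hs (2 * k - e)%Z). rewrite minus_IZR, mult_IZR. unfold s' in E. lra. }
  assert (HU : ~ in_lattice tau U).
  { pose proof (regular_not_in_lattice tau z e (- p - 2 * i) 0 Hz) as K.
    replace (z + (ZtoC 0 + ZtoC e / 2) * tau + ZtoC (- p - 2 * i) / 2) with U in K; [exact K|].
    unfold U, a, al. zc. field. }
  assert (HV : ~ in_lattice tau V).
  { pose proof (regular_not_in_lattice tau z e (- p - 2 * j) 0 Hz) as K.
    replace (z + (ZtoC 0 + ZtoC e / 2) * tau + ZtoC (- p - 2 * j) / 2) with V in K; [exact K|].
    unfold V, b, al. zc. field. }
  assert (HUV : ~ in_lattice tau (U + V)).
  { pose proof (regular_sum_not_in_lattice tau z e (- i - j - p) Hz) as K.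
    replace (2 * z + ZtoC e * tau + ZtoC (- i - j - p)) with (U + V) in K; [exact K|].
    unfold U, V, a, b, al. zc. field. }
  assert (Ht' : (0 < Im (tau / MM))%R).
  { unfold MM. rewrite Im_div_Z by assumption. apply Rdiv_lt_0_compat; lra. }
  assert (EV' : V / MM = RtoC s' * (tau / MM) + RtoC (r' / IZR (Z.of_nat M))).
  { rewrite EV, RtoC_div by lra. unfold MM, ZtoC. field. intros E. apply RtoC_inj in E. lra. }
  pose proof (Psi_S (tau / MM) (U / MM) s' (r' / IZR (Z.of_nat M)) Ht' Hs') as F.
  rewrite <- EV' in F.
  pose proof (Psi_distribution tau U M Ht HM HU s' r' Hs') as G. fold MM in G. rewrite <- EV in G.
  rewrite G in F by exact HUV. clear G.
  assert (F1 : Psi (- (1) / (tau / MM)) (U / MM / (tau / MM)) (V / MM / (tau / MM))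
     = tau / MM * expi (U / MM * (V / MM) / (tau / MM)) *
      sumn (fun d : nat => sumn (dist_term tau U M V d) M) M).
  { apply F.
    - intros k E. apply (Hr (2 * (k * Z.of_nat M) + 2 * j + p)%Z).
      rewrite !plus_IZR, !mult_IZR. unfold r' in E.
      assert (r - IZR j - IZR p / 2 = IZR k * IZR (Z.of_nat M))%R.
      { rewrite <- E. field. lra. }
      lra.
    - now apply not_in_lattice_divide.
    - replace (U / MM + V / MM) with ((U + V) / MM) by (field; exact M0). now apply not_in_lattice_divide. }
  clear F. unfold numerator. fold MM a b al.
  replace (MM * (- (1) / tau)) with (- (1) / (tau / MM)) by (field; auto).
  replace (z / tau + a * (- (1) / tau) + al) with (U / MM / (tau / MM)).
  2:{ unfold U. field. auto. }
  replace (z / tau + b * (- (1) / tau) + al) with (V / MM / (tau / MM)).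
  2:{ unfold V. field. auto. }
  rewrite F1.
  replace (expi (((a + b) * (z / tau) + a * b * (- (1) / tau)) / MM) *
    (tau / MM * expi (U / MM * (V / MM) / (tau / MM)) * sumn (fun d : nat => sumn (dist_term tau U M V d) M) M))
   with (tau / MM * (expi (((a + b) * (z / tau) + a * b * (- (1) / tau)) / MM) * expi (U / MM * (V / MM) / (tau / MM)) *
     sumn (fun d : nat => sumn (dist_term tau U M V d) M) M)) by ring.
  rewrite <- (Cmult_assoc (tau / MM) (expi (z * z / (MM * tau)))). f_equal. rewrite <- expi_add, <- !sumn_scal.
  apply sumn_ext. intros d Hd. rewrite <- !sumn_scal. apply sumn_ext. intros c Hc.
  unfold dist_term, S_coef. fold MM a b al.
  (* The translation -(i + p/2) is p/2 modulo integers, while e/2 has become a multiple of tau: here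
     p and e change places. *)
  replace (U + NtoC d * tau) with (z + (NtoC d + al) * tau + ZtoC p / 2 + ZtoC (- i - p)).
  2:{ unfold U, a, al. zc. field. }
  replace (V + NtoC c * tau) with (z + (NtoC c + al) * tau + ZtoC p / 2 + ZtoC (- j - p)).
  2:{ unfold V, b, al. zc. field. }
  assert (IM : (0 < Im (MM * tau))%R) by (now apply Im_MM_tau).
  rewrite Psi_add_Z_l, Psi_add_Z_r by exact IM.
  set (Y := Psi _ _ _). rewrite !Cmult_assoc. f_equal. rewrite <- !expi_add. f_equal.
  unfold U, V. field. auto.
Qed.

(** Eventually 2 (x + 1/(n + 1)) lies strictly between up (2x) - 1 and up (2x). It supplies generic
    points near an arbitrary one. *)
Lemma frac_avoid (x : R) : exists N, forall n, (N <= n)%nat ->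
  forall k : Z, (2 * (x + / (INR n + 1)))%R <> IZR k.
Proof.
  destruct (archimed (2 * x)) as [A1 A2]. set (k0 := up (2 * x)) in *.
  destruct (INR_unbounded (2 / (IZR k0 - 2 * x))) as [N HN]. exists N. intros n Hn k E.
  apply le_INR in Hn. pose proof (pos_INR n).
  assert (P : (0 < / (INR n + 1))%R) by (apply Rinv_0_lt_compat; lra).
  assert (Q : (2 * / (INR n + 1) < IZR k0 - 2 * x)%R).
  { apply (Rmult_lt_reg_r (INR n + 1)); [lra|]. rewrite Rmult_assoc, Rinv_l, Rmult_1_r by lra.
    apply Rlt_div_l in HN; [|lra]. nra. }
  assert (k < k0)%Z by (apply lt_IZR; lra).
  assert (k0 - 1 < k)%Z by (apply lt_IZR; rewrite minus_IZR; lra). lia.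
Qed.

Lemma is_lim_seq_inv_S : is_lim_seq (fun n => (/ (INR n + 1))%R) 0%R.
Proof.
  apply is_lim_seq_eps. intros eps He. destruct (INR_unbounded (/ eps)) as [N HN].
  exists N. intros n Hn. apply le_INR in Hn. pose proof (pos_INR n).
  rewrite Rminus_0_r, Rabs_pos_eq by (left; apply Rinv_0_lt_compat; lra).
  rewrite <- (Rinv_inv eps). assert (0 < / eps)%R by now apply Rinv_0_lt_compat.
  apply Rinv_lt_contravar; [nra|lra].
Qed.

Lemma Clim_double_sumn (f : nat -> nat -> nat -> C) (g : nat -> nat -> C) (M : nat) :
  (forall d c, Clim (fun n => f n d c) (g d c)) ->
  Clim (fun n => sumn (fun d => sumn (f n d) M) M) (sumn (fun d => sumn (g d) M) M).
Proof.
  intros H. apply Clim_sumn. intros d _. apply (Clim_sumn (fun n => f n d)). intros c _. apply H.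
Qed.

(** Both sides are continuous in z at regular points, and z is the limit of the generic points z +
    (tau + 1)/(n + 1). *)
Theorem numerator_S (M : nat) (p e i j : Z) (tau z : C) : (0 < M)%nat -> regular tau z ->
  numerator M p e i j (- (1) / tau) (z / tau)
  = tau / NtoC M * expi (z * z / (NtoC M * tau)) *
    sumn (fun d => sumn (fun c =>
      S_coef M p e i j d c * numerator M e p (Z.of_nat d) (Z.of_nat c) tau z) M) M.
Proof.
  intros HM Hz. assert (Ht := proj1 Hz). pose proof (tau_neq_0 tau Ht) as T0.
  assert (M0 : NtoC M <> 0) by now apply ZtoC_nat_neq_0.
  set (s := (Im z / Im tau)%R). set (r := (Re z - s * Re tau)%R).
  assert (Ez : z = RtoC s * tau + RtoC r).
  { unfold r, s. destruct z as [a b], tau as [x y]. simpl in *. apply C_ext; simpl; field; lra. }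
  set (dl := fun n : nat => (/ (INR n + 1))%R).
  set (zs := fun n => RtoC (s + dl n) * tau + RtoC (r + dl n)).
  assert (Lz : Clim zs z).
  { rewrite Ez. apply Clim_ext with (fun n => (RtoC s * tau + RtoC r) + RtoC (dl n) * (tau + 1)).
    { intros n. unfold zs. rewrite !RtoC_plus. ring. }
    apply (eq_ind (RtoC s * tau + RtoC r + RtoC 0 * (tau + 1))); [|ring].
    apply Clim_plus; [apply Clim_const|]. apply Clim_div_N. apply is_lim_seq_inv_S. }
  destruct (frac_avoid s) as [N1 H1]. destruct (frac_avoid r) as [N2 H2].
  apply (Clim_unique (fun n => numerator M p e i j (- (1) / tau) (zs n / tau))).
  - apply Clim_numerator; [assumption|now apply regular_S|].
    apply Clim_div; [exact T0|exact Lz|apply Clim_const].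
  - apply Clim_ext_loc with (fun n => tau / NtoC M * expi (zs n * zs n / (NtoC M * tau)) *
      sumn (fun d => sumn (fun c =>
      S_coef M p e i j d c * numerator M e p (Z.of_nat d) (Z.of_nat c) tau (zs n)) M) M).
    { exists (N1 + N2)%nat. intros n Hn. symmetry. apply numerator_S_generic; auto.
      - intros k. apply (H1 n); lia.
      - intros k. apply (H2 n); lia. }
    apply Clim_mult.
    + apply Clim_scal, Clim_expi. apply Clim_div; [now apply Cmult_neq_0| |apply Clim_const].
      now apply Clim_mult.
    + apply Clim_double_sumn. intros d c. apply Clim_scal. now apply Clim_numerator.
Qed.

(** * Translations of tau and of the index *)

Lemma qpoch_tau_add_Z (tau u : C) (k : Z) (n : nat) : qpoch (tau + ZtoC k) u n = qpoch tau u n.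
Proof.
  apply Cprod_ext. intros i _.
  replace (u + NtoC i * (tau + ZtoC k)) with
    (u + NtoC i * tau + ZtoC (Z.of_nat i * k)) by (zc; ring).
  now rewrite expi_add_Z.
Qed.

Lemma Im_add_Z (tau : C) (k : Z) : Im (tau + ZtoC k) = Im tau.
Proof. destruct tau. simpl. ring. Qed.

Lemma qpoch_inf_tau_add_Z (tau u : C) (k : Z) : (0 < Im tau)%R -> qpoch_inf (tau + ZtoC k) u = qpoch_inf tau u.
Proof.
  intros Ht. apply (Clim_unique (qpoch tau u)); [|now apply qpoch_lim].
  apply Clim_ext with (qpoch (tau + ZtoC k) u); [intros; apply qpoch_tau_add_Z|].
  apply qpoch_lim. now rewrite Im_add_Z.
Qed.

Lemma Psi_tau_add_Z (tau u v : C) (k : Z) : (0 < Im tau)%R -> Psi (tau + ZtoC k) u v = Psi tau u v.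
Proof. intros Ht. unfold Psi, theta_prod. rewrite !qpoch_inf_tau_add_Z by assumption. reflexivity. Qed.

(** As a (tau + n) = a tau + i n + p n/2 for a = i + p/2, the half-integral part of the shift
    changes e to e + p n, and the integral part has no effect. *)
Lemma numerator_T (M : nat) (p e i j n : Z) (tau z : C) : (0 < M)%nat -> (0 < Im tau)%R ->
  numerator M p e i j (tau + ZtoC n) z
  = expi ((ZtoC i + ZtoC p / 2) * (ZtoC j + ZtoC p / 2) * ZtoC n / NtoC M)
    * numerator M p (e + p * n) i j tau z.
Proof.
  intros HM Ht. unfold numerator. set (MM := NtoC M).
  assert (M0 : MM <> 0) by now apply ZtoC_nat_neq_0.
  set (a := ZtoC i + ZtoC p / 2). set (b := ZtoC j + ZtoC p / 2).
  assert (IM : (0 < Im (MM * tau))%R) by now apply Im_MM_tau.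
  replace (MM * (tau + ZtoC n)) with (MM * tau + ZtoC (Z.of_nat M * n)) by (unfold MM; zc; ring).
  rewrite Psi_tau_add_Z by exact IM.
  replace (z + a * (tau + ZtoC n) + ZtoC e / 2) with (z + a * tau + ZtoC (e + p * n) / 2 + ZtoC (i * n)).
  2:{ unfold a. zc. field. }
  replace (z + b * (tau + ZtoC n) + ZtoC e / 2) with (z + b * tau + ZtoC (e + p * n) / 2 + ZtoC (j * n)).
  2:{ unfold b. zc. field. }
  rewrite Psi_add_Z_l, Psi_add_Z_r by exact IM.
  rewrite Cmult_assoc, <- expi_add. do 2 f_equal. field. exact M0.
Qed.

Lemma numerator_e_mod_2 (M : nat) (p e i j t : Z) (tau z : C) : (0 < M)%nat -> (0 < Im tau)%R ->
  numerator M p (e + 2 * t) i j tau z = numerator M p e i j tau z.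
Proof.
  intros HM Ht. unfold numerator. set (MM := NtoC M).
  assert (IM : (0 < Im (MM * tau))%R) by now apply Im_MM_tau.
  set (a := ZtoC i + ZtoC p / 2). set (b := ZtoC j + ZtoC p / 2).
  replace (z + a * tau + ZtoC (e + 2 * t) / 2) with (z + a * tau + ZtoC e / 2 + ZtoC t) by (zc; field).
  replace (z + b * tau + ZtoC (e + 2 * t) / 2) with (z + b * tau + ZtoC e / 2 + ZtoC t) by (zc; field).
  now rewrite Psi_add_Z_l, Psi_add_Z_r by exact IM.
Qed.

Lemma numerator_sym (M : nat) (p e i j : Z) (tau z : C) : numerator M p e i j tau z = numerator M p e j i tau z.
Proof.
  unfold numerator. rewrite Psi_sym. f_equal. f_equal. f_equal. ring.
Qed.

(** The exponential in [numerator] compensates the factor of quasi-periodicity except for the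
    constant e(-e/2); this makes the index periodic modulo M up to constants. *)
Lemma numerator_add_M (M : nat) (p e i j : Z) (tau z : C) : (0 < M)%nat -> regular tau z ->
  numerator M p e (i + Z.of_nat M) j tau z = expi (- (ZtoC e / 2)) * numerator M p e i j tau z.
Proof.
  intros HM Hz. unfold numerator. set (MM := NtoC M).
  assert (M0 : MM <> 0) by now apply ZtoC_nat_neq_0.
  assert (IM : (0 < Im (MM * tau))%R) by (apply Im_MM_tau; [apply Hz|exact HM]).
  pose proof (regular_not_in_lattice_M tau z M p e i Hz) as HU.
  pose proof (regular_not_in_lattice_M tau z M p e j Hz) as HV. fold MM in HU, HV.
  set (a := ZtoC i + ZtoC p / 2) in *. set (b := ZtoC j + ZtoC p / 2) in *.
  replace (ZtoC (i + Z.of_nat M) + ZtoC p / 2) with (a + MM) by (unfold a, MM; zc; ring).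
  replace (z + (a + MM) * tau + ZtoC e / 2) with (z + a * tau + ZtoC e / 2 + MM * tau) by ring.
  rewrite Psi_add_tau_l by assumption.
  rewrite !Cmult_assoc, <- !expi_add. do 2 f_equal. field. exact M0.
Qed.

Lemma numerator_neq_0 (p e : Z) (tau z : C) : regular tau z -> numerator 1 p e 0 0 tau z <> 0.
Proof.
  intros Hz. unfold numerator. change (NtoC 1) with (RtoC 1). rewrite Cmult_1_l.
  apply Cmult_neq_0; [apply expi_neq_0|]. apply Psi_neq_0.
  - apply Hz.
  - now apply regular_not_in_lattice.
  - now apply regular_not_in_lattice.
  - pose proof (regular_sum_not_in_lattice tau z p e Hz) as K.
    match goal with |- ~ in_lattice tau ?X => replace X with (2 * z + ZtoC p * tau + ZtoC e); [exact K|] end.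
    change (ZtoC 0) with (RtoC 0). field.
Qed.

(* The powers of [tau] cancel, and the Gaussian factors combine to the one in
   the slash action. *)
Theorem quotient_S (M : nat) (p e i j : Z) (tau z : C) : (0 < M)%nat -> regular tau z ->
  expi (- ((1 - NtoC M) / NtoC M * (z * z / tau)))
  * quotient M p e i j (- (1) / tau) (z / tau)
  = sumn (fun d => sumn (fun c =>
      S_coef M p e i j d c / (NtoC M * S_coef 1 p e 0 0 0 0)
      * quotient M e p (Z.of_nat d) (Z.of_nat c) tau z) M) M.
Proof.
  intros HM Hz. pose proof (tau_neq_0 tau (proj1 Hz)) as T0.
  set (MM := NtoC M). assert (M0 : MM <> 0) by now apply ZtoC_nat_neq_0.
  unfold quotient at 1. rewrite !numerator_S by (auto with arith). fold MM.
  change (NtoC 1) with (RtoC 1). simpl (sumn _ 1). change (Z.of_nat 0) with 0%Z.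
  pose proof (numerator_neq_0 e p tau z Hz) as D0.
  assert (K0 : S_coef 1 p e 0 0 0 0 <> 0) by apply expi_neq_0.
  set (D := numerator 1 e p 0 0 tau z) in *. set (K := S_coef 1 p e 0 0 0 0) in *.
  set (X := sumn _ M).
  replace (expi (z * z / (1 * tau))) with
   (expi (- ((1 - MM) / MM * (z * z / tau))) * expi (z * z / (MM * tau))).
  2:{ rewrite <- expi_add. f_equal. field. auto. }
  pose proof (expi_neq_0 (- ((1 - MM) / MM * (z * z / tau)))) as E1.
  pose proof (expi_neq_0 (z * z / (MM * tau))) as E2.
  set (A := expi (- ((1 - MM) / MM * (z * z / tau)))) in *. set (B := expi (z * z / (MM * tau))) in *.
  transitivity (/ (MM * K * D) * X).
  { field. repeat split; auto. }
  unfold X. rewrite <- sumn_scal. apply sumn_ext. intros d _. rewrite <- sumn_scal.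
  apply sumn_ext. intros c _. unfold quotient. fold D. field. auto.
Qed.

Theorem quotient_T (M : nat) (p e i j n : Z) (tau z : C) : (0 < M)%nat -> regular tau z ->
  quotient M p e i j (tau + ZtoC n) z
  = expi ((ZtoC i + ZtoC p / 2) * (ZtoC j + ZtoC p / 2) * ZtoC n / NtoC M
       - ZtoC p / 2 * (ZtoC p / 2) * ZtoC n)
    * quotient M p (e + p * n) i j tau z.
Proof.
  intros HM Hz. unfold quotient. rewrite !numerator_T by (auto with arith; apply Hz).
  change (NtoC 1) with (RtoC 1). change (ZtoC 0) with (RtoC 0).
  rewrite expi_sub.
  replace ((0 + ZtoC p / 2) * (0 + ZtoC p / 2) * ZtoC n / 1) with (ZtoC p / 2 * (ZtoC p / 2) * ZtoC n) by field.
  pose proof (numerator_neq_0 p (e + p * n) tau z Hz).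
  pose proof (expi_neq_0 (ZtoC p / 2 * (ZtoC p / 2) * ZtoC n)).
  set (X := expi (ZtoC p / 2 * (ZtoC p / 2) * ZtoC n)) in *.
  set (D := numerator 1 p (e + p * n) 0 0 tau z) in *. field. auto.
Qed.

(** * Characters *)

Lemma theta_product (a b : Z) (tau z : C) : (0 < Im tau)%R ->
  theta a b tau z
  = expi (ZtoC a * ZtoC a * tau / 8 + ZtoC a * (z + ZtoC b / 2) / 2)
    * (qpoch_inf tau 0 * theta_prod tau (z + (ZtoC b + 1) / 2 + (ZtoC a + 1) / 2 * tau)).
Proof.
  intros Ht. set (u := z + (ZtoC b + 1) / 2 + (ZtoC a + 1) / 2 * tau).
  set (c := expi (ZtoC a * ZtoC a * tau / 8 + ZtoC a * (z + ZtoC b / 2) / 2)).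
  assert (E : forall n : Z, c * jtp_term tau u n =
    Cexp (PI * Ci * ((ZtoC n + ZtoC a / 2) * (ZtoC n + ZtoC a / 2)) * tau
          + 2 * PI * Ci * (ZtoC n + ZtoC a / 2) * (z + ZtoC b / 2))).
  { intros n. unfold c, jtp_term. rewrite <- expi_add.
    (* The (b + 1)/2 in u and the sign in [jtp_term] add up to n b/2 + n; the integer n is
       dropped. *)
    rewrite <- (expi_add_Z _ (- n)). unfold expi. f_equal. unfold u. zc. field. }
  unfold theta. apply summable_CSeriesZ.
  - eapply summable_ext; [exact E|]. apply summable_scal. now apply summable_jtp.
  - eapply sumZ_ext; [exact E|]. apply sumZ_scal. now apply jacobi_triple_product.
Qed.

Lemma eta_product (tau : C) : (0 < Im tau)%R -> eta tau = expi (tau / 24) * qpoch_inf tau 0.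
Proof.
  intros Ht. unfold eta. f_equal. apply CLim_seq_eq.
  eapply Clim_ext; [|apply (qpoch_lim tau 0 Ht)]. intros n. apply Cprod_ext. intros k _.
  unfold ZtoC. rewrite <- INR_IZR_INZ. do 2 f_equal. ring.
Qed.

Definition sector_p (x : sector) : Z := match x with Untw => 1 | Tw => 0 end.
Definition sign_e (e : sign) : Z := match e with Plus => 1 | Minus => 0 end.

Lemma theta_prod_half_regular (tau z : C) (p e : Z) : regular tau z ->
  theta_prod tau (z + ZtoC e / 2 + ZtoC p / 2 * tau) <> 0.
Proof.
  intros Hz. apply theta_prod_neq_0; [apply Hz|].
  pose proof (regular_not_in_lattice tau z p e 0 Hz) as K.
  replace (z + (ZtoC 0 + ZtoC p / 2) * tau + ZtoC e / 2) with (z + ZtoC e / 2 + ZtoC p / 2 * tau) in K;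
    [exact K|]. change (ZtoC 0) with (RtoC 0). ring.
Qed.

Lemma theta_quotient (a b : Z) (tau z : C) : regular tau z ->
  eta tau ^ 3 * theta 1 1 tau (2 * z) / theta a b tau z ^ 2
  = - (expi (tau / 4 - z + 1 / 4 - ZtoC a * ZtoC a / 4 * tau - ZtoC a * (z + ZtoC b / 2))
    * (qpoch_inf tau 0 * qpoch_inf tau 0 * theta_prod tau (2 * z)
       / (theta_prod tau (z + (ZtoC b + 1) / 2 + (ZtoC a + 1) / 2 * tau)
          * theta_prod tau (z + (ZtoC b + 1) / 2 + (ZtoC a + 1) / 2 * tau)))).
Proof.
  intros Hz. assert (Ht := proj1 Hz). rewrite eta_product, !theta_product by assumption.
  pose proof (theta_prod_half_regular tau z (a + 1) (b + 1) Hz) as N.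
  rewrite !ZtoC_plus in N. change (ZtoC 1) with (RtoC 1) in *.
  assert (PN0 := qpoch_inf_neq_0 tau 0 Ht (or_intror eq_refl)).
  replace (2 * z + (1 + 1) / 2 + (1 + 1) / 2 * tau) with (2 * z + tau + ZtoC 1) by (zc; field).
  rewrite theta_prod_add_Z, theta_prod_add_tau by assumption.
  set (y := theta_prod tau (z + (ZtoC b + 1) / 2 + (ZtoC a + 1) / 2 * tau)) in *.
  set (q := qpoch_inf tau 0) in *. set (w := theta_prod tau (2 * z)) in *.
  set (A := expi (ZtoC a * ZtoC a * tau / 8 + ZtoC a * (z + ZtoC b / 2) / 2)).
  set (B := expi (1 * 1 * tau / 8 + 1 * (2 * z + 1 / 2) / 2)).
  assert (A0 : A <> 0) by apply expi_neq_0.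
  transitivity (- (expi (tau / 24) * expi (tau / 24) * expi (tau / 24) * B * expi (- (2 * z)) / (A * A)
     * (q * q * w / (y * y)))).
  - simpl. field. auto.
  - f_equal. f_equal. unfold A, B, Cdiv. rewrite <- (expi_add (ZtoC a * ZtoC a * tau * / 8 + _)).
    rewrite <- expi_opp, <- !expi_add. f_equal. field.
Qed.

Lemma numerator_1_eq (p e : Z) (tau z : C) :
  numerator 1 p e 0 0 tau z = expi (ZtoC p * z + ZtoC p * ZtoC p / 4 * tau)
  * (qpoch_inf tau 0 * qpoch_inf tau 0 * theta_prod tau (2 * z + ZtoC p * tau + ZtoC e)
       / (theta_prod tau (z + ZtoC e / 2 + ZtoC p / 2 * tau) * theta_prod tau (z + ZtoC e / 2 + ZtoC p / 2 * tau))).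
Proof.
  unfold numerator, Psi. change (NtoC 1) with (RtoC 1). change (ZtoC 0) with (RtoC 0).
  rewrite Cmult_1_l.
  replace (z + (0 + ZtoC p / 2) * tau + ZtoC e / 2) with (z + ZtoC e / 2 + ZtoC p / 2 * tau) by ring.
  replace (z + ZtoC e / 2 + ZtoC p / 2 * tau + (z + ZtoC e / 2 + ZtoC p / 2 * tau))
    with (2 * z + ZtoC p * tau + ZtoC e) by field.
  do 2 f_equal. field.
Qed.

Lemma theta_prod_sqr_add_tau (tau u : C) : (0 < Im tau)%R ->
  theta_prod tau (u + tau) * theta_prod tau (u + tau) = expi (- (2 * u)) * (theta_prod tau u * theta_prod tau u).
Proof.
  intros Ht. rewrite theta_prod_add_tau by assumption.
  replace (- (2 * u)) with (- u + - u) by ring. rewrite expi_add. ring.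
Qed.

(** The zeros of theta_0b are at (1 + b)/2 + tau/2 modulo the lattice and sign, so a = 0 corresponds
    to p = 1 and b to e = 1 + b, to be reduced mod 2. *)
Lemma theta_0_numerator (b : Z) (tau z : C) : regular tau z ->
  eta tau ^ 3 * theta 1 1 tau (2 * z) / theta 0 b tau z ^ 2
  = expi (1 / 4) * numerator 1 1 (1 + b) 0 0 tau z.
Proof.
  intros Hz. assert (Ht := proj1 Hz). rewrite theta_quotient, numerator_1_eq by assumption.
  zc.
  pose proof (theta_prod_half_regular tau z 1 (1 + b) Hz) as N. rewrite ZtoC_plus in N. change (ZtoC 1) with (RtoC 1) in N.
  replace (z + (ZtoC b + 1) / 2 + (0 + 1) / 2 * tau) with (z + (1 + ZtoC b) / 2 + 1 / 2 * tau) by field.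
  replace (2 * z + 1 * tau + (1 + ZtoC b)) with (2 * z + tau + ZtoC (1 + b)) by (zc; ring).
  rewrite theta_prod_add_Z, theta_prod_add_tau by assumption.
  set (y := theta_prod tau (z + (1 + ZtoC b) / 2 + 1 / 2 * tau)) in *.
  replace (expi (tau / 4 - z + 1 / 4 - 0 * 0 / 4 * tau - 0 * (z + ZtoC b / 2))) with
    (expi (1 / 4) * expi (1 * z + 1 * 1 / 4 * tau) * expi (- (2 * z))).
  2:{ rewrite <- !expi_add. f_equal. field. }
  field. exact N.
Qed.

(** For a = 1 the half period becomes a full tau, which quasi-periodicity removes; hence p = 0. *)
Lemma theta_1_numerator (b : Z) (tau z : C) : regular tau z ->
  eta tau ^ 3 * theta 1 1 tau (2 * z) / theta 1 b tau z ^ 2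
  = - expi (1 / 4 - ZtoC b / 2) * numerator 1 0 (1 + b) 0 0 tau z.
Proof.
  intros Hz. assert (Ht := proj1 Hz). rewrite theta_quotient, numerator_1_eq by assumption.
  zc.
  pose proof (theta_prod_half_regular tau z 0 (1 + b) Hz) as N. rewrite ZtoC_plus in N.
  change (ZtoC 1) with (RtoC 1) in N. change (ZtoC 0) with (RtoC 0) in N.
  replace (z + (1 + ZtoC b) / 2 + 0 / 2 * tau) with (z + (1 + ZtoC b) / 2) in * by field.
  replace (z + (ZtoC b + 1) / 2 + (1 + 1) / 2 * tau) with (z + (1 + ZtoC b) / 2 + tau) by field.
  rewrite theta_prod_sqr_add_tau by assumption.
  replace (2 * z + 0 * tau + (1 + ZtoC b)) with (2 * z + ZtoC (1 + b)) by (zc; ring).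
  rewrite theta_prod_add_Z by assumption.
  set (y := theta_prod tau (z + (1 + ZtoC b) / 2)) in *.
  replace (expi (0 * z + 0 * 0 / 4 * tau)) with (RtoC 1).
  2:{ rewrite <- expi_0. f_equal. field. }
  replace (expi (tau / 4 - z + 1 / 4 - 1 * 1 / 4 * tau - 1 * (z + ZtoC b / 2))) with
    (expi (1 / 4 - ZtoC b / 2) * expi (- (2 * (z + (1 + ZtoC b) / 2)))).
  2:{ rewrite <- (expi_add_Z (tau / 4 - z + 1 / 4 - 1 * 1 / 4 * tau - 1 * (z + ZtoC b / 2)) (- (1 + b))).
      rewrite <- !expi_add. f_equal. zc. field. }
  pose proof (expi_neq_0 (- (2 * (z + (1 + ZtoC b) / 2)))).
  field. auto.
Qed.

(** The constant matters only through being nonzero and independent of tau and z, since linear spans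
    absorb it. *)
Lemma denom_numerator (x : sector) (e : sign) :
  exists k : C, k <> 0 /\ forall tau z, regular tau z ->
  denom x e tau z = k * numerator 1 (sector_p x) (sign_e e) 0 0 tau z.
Proof.
  assert (I0 : - Ci <> 0).
  { intros E. apply Ci_nz. replace Ci with (- - Ci) by ring. rewrite E. ring. }
  assert (N1 : forall c y : C, c <> 0 -> c * - expi y <> 0).
  { intros c y Hc E. apply (Cmult_neq_0 _ _ Hc (expi_neq_0 y)).
    replace (c * expi y) with (- (c * - expi y)) by ring. rewrite E. ring. }
  destruct x, e; simpl sector_p; simpl sign_e.
  - exists (- Ci * expi (1 / 4)). split; [apply Cmult_neq_0; [exact I0|apply expi_neq_0]|].
    intros tau z Hz. pose proof (theta_0_numerator 0 tau z Hz) as E. simpl (1 + 0)%Z in E.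
    rewrite <- Cmult_assoc, <- E. unfold denom, Cdiv. ring.
  - exists (Ci * expi (1 / 4)). split; [apply Cmult_neq_0; [exact Ci_nz|apply expi_neq_0]|].
    intros tau z Hz. pose proof (theta_0_numerator 1 tau z Hz) as E.
    change (1 + 1)%Z with (0 + 2 * 1)%Z in E. rewrite numerator_e_mod_2 in E by (auto; apply Hz).
    rewrite <- Cmult_assoc, <- E. unfold denom, Cdiv. ring.
  - exists (- Ci * - expi (1 / 4 - ZtoC 0 / 2)). split; [now apply N1|].
    intros tau z Hz. pose proof (theta_1_numerator 0 tau z Hz) as E. simpl (1 + 0)%Z in E.
    rewrite <- Cmult_assoc, <- E. unfold denom, Cdiv. ring.
  - exists (Ci * - expi (1 / 4 - ZtoC 1 / 2)). split; [now apply N1, Ci_nz|].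
    intros tau z Hz. pose proof (theta_1_numerator 1 tau z Hz) as E.
    change (1 + 1)%Z with (0 + 2 * 1)%Z in E. rewrite numerator_e_mod_2 in E by (auto; apply Hz).
    rewrite <- Cmult_assoc, <- E. unfold denom, Cdiv. ring.
Qed.

(** * The series [Phi] and the numerators of the characters *)

Definition Phi_term (s : R) (tau z1 z2 : C) (n : Z) : C :=
  let j := ZtoC n in
  expi (1 * j * (z1 + z2) + RtoC s * z1)
      * expi ((1 * (j * j) + RtoC s * j) * tau)
      / (1 - expi z1 * expi (j * tau)) ^ 2
  - expi (- (1 * j * (z1 + z2)) - RtoC s * z2)
      * expi ((1 * (j * j) + RtoC s * j) * tau)
      / (1 - expi (- z2) * expi (j * tau)) ^ 2.

Lemma summable_Phi_term (s : R) (tau z1 z2 : C) : (0 < Im tau)%R -> summable (Phi_term s tau z1 z2).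
Proof.
  intros Ht.
  assert (Q : forall al y, summable (fun j => expi (ZtoC j * al + ZtoC j * ZtoC j * tau)
     / (1 - expi (y + ZtoC j * tau)) ^ 2)).
  { intros al y. destruct (one_minus_large tau y Ht) as [n0 Hn0].
    apply (summable_le _ (fun j => expi (ZtoC j * al + ZtoC j * ZtoC j * tau)) (/ (1 / 2 * (1 / 2))) n0).
    - intros j Hj. apply Cmod_div_le; [lra|]. rewrite Cmod_pow. specialize (Hn0 j Hj). simpl. nra.
    - now apply summable_gauss. }
  apply summable_ext with (fun j =>
    expi (s * z1) * (expi (ZtoC j * (z1 + z2 + s * tau) + ZtoC j * ZtoC j * tau) / (1 - expi (z1 + ZtoC j * tau)) ^ 2)
    + (- expi (- (s * z2))) * (expi (ZtoC j * (- (z1 + z2) + s * tau) + ZtoC j * ZtoC j * tau) / (1 - expi (- z2 + ZtoC j * tau)) ^ 2)).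
  - intros j. unfold Phi_term. rewrite <- !expi_add.
    replace (1 * ZtoC j * (z1 + z2) + s * z1 + (1 * (ZtoC j * ZtoC j) + s * ZtoC j) * tau)
      with (s * z1 + (ZtoC j * (z1 + z2 + s * tau) + ZtoC j * ZtoC j * tau)) by ring.
    replace (- (1 * ZtoC j * (z1 + z2)) - s * z2 + (1 * (ZtoC j * ZtoC j) + s * ZtoC j) * tau)
      with (- (s * z2) + (ZtoC j * (- (z1 + z2) + s * tau) + ZtoC j * ZtoC j * tau)) by ring.
    rewrite (expi_add (s * z1)), (expi_add (- (s * z2))). unfold Cdiv. ring.
  - apply summable_plus; apply summable_scal; apply Q.
Qed.

Lemma Phi_eq (s : R) (tau z1 z2 : C) : (0 < Im tau)%R ->
  sumZ (Phi_term s tau z1 z2) (Phi 1 s tau z1 z2 0).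
Proof.
  intros Ht. destruct (summable_sumZ _ (summable_Phi_term s tau z1 z2 Ht)) as [T HT].
  pose proof (summable_CSeriesZ _ _ (summable_Phi_term s tau z1 z2 Ht) HT) as E.
  replace (Phi 1 s tau z1 z2 0) with T; [exact HT|].
  unfold Phi. replace (- (1 * 0)) with (RtoC 0) by ring. rewrite expi_0, Cmult_1_l. symmetry. exact E.
Qed.

(** Since x/(1 - x)^2 - x^2/(1 - x)^2 = x/(1 - x), the double poles cancel. The two parts of the
    remaining series match [kernel] through (1 - x y)/((1 - x)(1 - y)) = x/(1 - x) + 1/(1 - y), once
    the second part is reflected by j -> -j. *)
Lemma Phi_difference (tau z1 z2 : C) : (0 < Im tau)%R -> ~ in_lattice tau z1 -> ~ in_lattice tau z2 ->
  ~ in_lattice tau (z1 + z2) ->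
  Phi 1 (INR 1) tau z1 z2 0 - Phi 1 (INR 2) tau z1 z2 0 = Psi tau z1 z2.
Proof.
  intros Ht H1 H2 Hw.
  set (g := fun j => expi (ZtoC j * (z1 + z2) + ZtoC j * ZtoC j * tau)).
  set (p := fun j => g j * (expi (z1 + ZtoC j * tau) / (1 - expi (z1 + ZtoC j * tau)))).
  (* The part to be reflected. It is added to both series, once at -j and once at j, so that both
     turn into p. *)
  set (q := fun j => g j * (- (1) / (1 - expi (z2 + ZtoC j * tau)))).
  assert (Sq : summable q).
  { destruct (one_minus_large tau z2 Ht) as [n0 Hn0].
    apply (summable_le _ g (/ (1 / 2)) n0); [|now apply summable_gauss].
    intros j Hj. unfold q.
    replace (g j * (- (1) / (1 - expi (z2 + ZtoC j * tau)))) with ((- g j) / (1 - expi (z2 + ZtoC j * tau)))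
      by (unfold Cdiv; ring).
    rewrite <- (Cmod_opp (g j)). apply Cmod_div_le; [lra|auto]. }
  destruct (summable_sumZ _ Sq) as [Q HQ].
  pose proof (sumZ_opp _ _ (summable_vanishing _ Sq) HQ) as HQ'.
  pose proof (sumZ_minus _ _ _ _ (Phi_eq (INR 1) tau z1 z2 Ht) (Phi_eq (INR 2) tau z1 z2 Ht)) as D.
  pose proof (sumZ_kernel tau z1 z2 Ht H1 H2 Hw) as K.
  assert (H2' : ~ in_lattice tau (- z2)) by (intros X; now apply H2, in_lattice_opp).
  assert (E1 : sumZ p (Phi 1 (INR 1) tau z1 z2 0 - Phi 1 (INR 2) tau z1 z2 0 + Q)).
  { eapply sumZ_ext; [|apply sumZ_plus; [exact D|exact HQ']]. intros j. cbv beta.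
    unfold Phi_term, p, q, g. simpl INR. replace (RtoC (1 + 1)) with (RtoC 2) by reflexivity.
    pose proof (one_minus_neq_0 tau z1 j H1) as D1. pose proof (one_minus_neq_0 tau (- z2) j H2') as D2.
    rewrite <- (expi_add z1), <- (expi_add (- z2)).
    set (x := expi (z1 + ZtoC j * tau)) in *. set (y := expi (- z2 + ZtoC j * tau)) in *.
    assert (y0 : y <> 0) by apply expi_neq_0.
    replace (expi (z2 + ZtoC (- j) * tau)) with (/ y).
    2:{ unfold y. rewrite <- expi_opp. f_equal. zc. ring. }
    set (G := expi (ZtoC j * (z1 + z2) + ZtoC j * ZtoC j * tau)).
    set (G' := expi (ZtoC (- j) * (z1 + z2) + ZtoC (- j) * ZtoC (- j) * tau)).
    replace (expi (1 * ZtoC j * (z1 + z2) + 1 * z1) * expi ((1 * (ZtoC j * ZtoC j) + 1 * ZtoC j) * tau)) with (G * x).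
    2:{ unfold G, x. rewrite <- !expi_add. f_equal. ring. }
    replace (expi (1 * ZtoC j * (z1 + z2) + 2 * z1) * expi ((1 * (ZtoC j * ZtoC j) + 2 * ZtoC j) * tau)) with (G * x * x).
    2:{ unfold G, x. rewrite <- !expi_add. f_equal. ring. }
    replace (expi (- (1 * ZtoC j * (z1 + z2)) - 1 * z2) * expi ((1 * (ZtoC j * ZtoC j) + 1 * ZtoC j) * tau)) with (G' * y).
    2:{ unfold G', y. rewrite <- !expi_add. f_equal. zc. ring. }
    replace (expi (- (1 * ZtoC j * (z1 + z2)) - 2 * z2) * expi ((1 * (ZtoC j * ZtoC j) + 2 * ZtoC j) * tau)) with (G' * y * y).
    2:{ unfold G', y. rewrite <- !expi_add. f_equal. zc. ring. }
    assert (y - 1 <> 0). { intros E. apply D2. replace (1 - y) with (- (y - 1)) by ring. rewrite E. ring. }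
    field. repeat split; auto. }
  assert (E2 : sumZ p (Psi tau z1 z2 + Q)).
  { eapply sumZ_ext; [|apply sumZ_plus; [exact K|exact HQ]]. intros j. cbv beta.
    unfold kernel, p, q, g.
    replace (expi (z1 + z2 + 2 * ZtoC j * tau)) with (expi (z1 + ZtoC j * tau) * expi (z2 + ZtoC j * tau)).
    2:{ rewrite <- expi_add. f_equal. ring. }
    pose proof (one_minus_neq_0 tau z1 j H1). pose proof (one_minus_neq_0 tau z2 j H2).
    field. auto. }
  pose proof (Clim_unique _ _ _ E1 E2) as E.
  replace (Phi 1 (INR 1) tau z1 z2 0 - Phi 1 (INR 2) tau z1 z2 0)
    with (Phi 1 (INR 1) tau z1 z2 0 - Phi 1 (INR 2) tau z1 z2 0 + Q - Q) by ring.
  rewrite E. ring.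
Qed.

(** Read off the arguments of [Phi] in [numer], written as z + (i + p/2) tau and z + (j + p/2) tau.
    Where [numer] has -z, these are taken with the opposite sign, and the oddness of [Psi] enters
    [sgn_eh]. *)
Definition index_i (x : sector) (h : heart) (k1 k2 : Z) : Z :=
  match x, h with
  | Untw, TypeI => k1
  | Untw, TypeIII => - k1 - 1
  | Tw, TypeI => - k1
  | Tw, TypeIII => k1 + 1
  end.

Definition index_j (x : sector) (h : heart) (k1 k2 : Z) : Z :=
  match x, h with
  | Untw, TypeI => - k1 - k2 - 1
  | Untw, TypeIII => k1 + k2
  | Tw, TypeI => k1 + k2 + 1
  | Tw, TypeIII => - k1 - k2
  end.

Definition sgn_eh (e : sign) (h : heart) (x : sector) : C :=
  match e with Plus => - (1) | Minus => 1 end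
  * match x, h with Untw, TypeI => 1 | Untw, TypeIII => - (1) | Tw, TypeI => - (1) | Tw, TypeIII => 1 end.

Lemma numer_numerator (x : sector) (e : sign) (h : heart) (M : nat) (k1 k2 : Z) (tau z : C) :
  (0 < M)%nat -> regular tau z ->
  numer x e h (Z.of_nat M) 0 k1 k2 tau z + sgnC e * numer x e h (Z.of_nat M) 1 k1 k2 tau z
  = sgn_eh e h x * numerator M (sector_p x) (sign_e e) (index_i x h k1 k2) (index_j x h k1 k2) tau z.
Proof.
  intros HM Hz. assert (Ht := proj1 Hz).
  assert (M0 := ZtoC_nat_neq_0 M HM).
  assert (IM : (0 < Im (NtoC M * tau))%R) by now apply Im_MM_tau.
  set (p := sector_p x). set (i := index_i x h k1 k2). set (j := index_j x h k1 k2).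
  set (a := ZtoC i + ZtoC p / 2). set (b := ZtoC j + ZtoC p / 2).
  pose proof (regular_not_in_lattice_M tau z M p (sign_e e) i Hz) as HU.
  pose proof (regular_not_in_lattice_M tau z M p (sign_e e) j Hz) as HV.
  assert (HW : ~ in_lattice (NtoC M * tau) (z + a * tau + ZtoC (sign_e e) / 2 + (z + b * tau + ZtoC (sign_e e) / 2))).
  { pose proof (not_in_lattice_multiple _ _ M (i + j + p) (regular_sum_not_in_lattice tau z 0 (sign_e e) Hz)) as K.
    match type of K with ~ in_lattice _ ?X => match goal with |- ~ in_lattice _ ?Y => replace Y with X; [exact K|] end end.
    unfold a, b. zc. field. }
  fold a in HU. fold b in HV.
  set (U := z + a * tau + ZtoC (sign_e e) / 2) in *. set (V := z + b * tau + ZtoC (sign_e e) / 2) in *.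
  set (MM := NtoC M) in *.
  assert (PU : Phi 1 (INR 1) (MM * tau) U V 0 - Phi 1 (INR 2) (MM * tau) U V 0 = Psi (MM * tau) U V).
  { now apply Phi_difference. }
  assert (HU' : ~ in_lattice (MM * tau) (- U)) by (intros X; now apply HU, in_lattice_opp).
  assert (HV' : ~ in_lattice (MM * tau) (- V)) by (intros X; now apply HV, in_lattice_opp).
  assert (HW' : ~ in_lattice (MM * tau) (- U + - V)).
  { replace (- U + - V) with (- (U + V)) by ring. intros X; now apply HW, in_lattice_opp. }
  (* For the cases with -z: negation turns the shift e/2 into -e/2, which the integer k = e
     restores. *)
  assert (PN : forall k : Z, Phi 1 (INR 1) (MM * tau) (- U + ZtoC k) (- V + ZtoC k) 0
     - Phi 1 (INR 2) (MM * tau) (- U + ZtoC k) (- V + ZtoC k) 0 = - Psi (MM * tau) U V).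
  { intros k. rewrite Phi_difference; try assumption.
    - rewrite Psi_add_Z_l, Psi_add_Z_r by exact IM. now apply Psi_opp.
    - replace (- U + ZtoC k) with (- U + ZtoC 0 * (MM * tau) + ZtoC k) by (zc; ring). now apply not_in_lattice_shift.
    - replace (- V + ZtoC k) with (- V + ZtoC 0 * (MM * tau) + ZtoC k) by (zc; ring). now apply not_in_lattice_shift.
    - replace (- U + ZtoC k + (- V + ZtoC k)) with (- U + - V + ZtoC 0 * (MM * tau) + ZtoC (2 * k)) by (zc; ring).
      now apply not_in_lattice_shift. }
  unfold numerator. fold MM a b U V.
  assert (half : RtoC (1 / 2) = 1 / 2) by (rewrite RtoC_div by lra; reflexivity).
  (* For characters [sigma] changes sign with m2, for supercharacters the parity sign does; either
     way the sum over m2 is a difference of [Phi] at s = 1 and s = 2. *)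
  assert (Key : forall (f1 f2 w1 w2 z1 z2 : C) (k : C),
    (z1 = w1 /\ z2 = w2) -> f1 * f2 = k ->
    sigma e 0 * (f1 * f2 * Phi 1 (INR (0 + 1)) (MM * tau) z1 z2 0)
    + sgnC e * (sigma e 1 * (f1 * f2 * Phi 1 (INR (1 + 1)) (MM * tau) z1 z2 0))
    = match e with Plus => - (1) | Minus => 1 end * k *
      (Phi 1 (INR 1) (MM * tau) w1 w2 0 - Phi 1 (INR 2) (MM * tau) w1 w2 0)).
  { intros f1 f2 w1 w2 z1 z2 k [-> ->] <-. change (0 + 1)%nat with 1%nat. change (1 + 1)%nat with 2%nat.
    assert (M1 : RtoC (-1) = - (1)) by (apply C_ext; simpl; ring).
    destruct e; simpl sigma; simpl sgnC; rewrite ?M1; ring. }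
  unfold numer. cbv zeta. fold MM.
  destruct x, h; simpl sector_p in *; simpl index_i in *; simpl index_j in *; unfold sgn_eh.
  - rewrite (Key _ _ U V _ _ (expi (((a + b) * z + a * b * tau) / MM))).
    + rewrite PU. ring.
    + rewrite half. unfold U, V, a, b, i, j, p. destruct e; simpl sign_e; simpl shift; rewrite ?half; split; zc; field.
    + rewrite half, <- expi_add. f_equal. unfold a, b, i, j, p. zc. field. exact M0.
  - rewrite (Key _ _ (- U + ZtoC (sign_e e)) (- V + ZtoC (sign_e e)) _ _ (expi (((a + b) * z + a * b * tau) / MM))).
    + rewrite PN. ring.
    + rewrite half. unfold U, V, a, b, i, j, p. destruct e; simpl sign_e; simpl shift; rewrite ?half; split; zc; field.
    + rewrite half, <- expi_add. f_equal. unfold a, b, i, j, p. zc. field. exact M0.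
  - rewrite (Key _ _ (- U + ZtoC (sign_e e)) (- V + ZtoC (sign_e e)) _ _ (expi (((a + b) * z + a * b * tau) / MM))).
    + rewrite PN. ring.
    + unfold U, V, a, b, i, j, p. destruct e; simpl sign_e; simpl shift; rewrite ?half; split; zc; field.
    + rewrite <- expi_add. f_equal. unfold a, b, i, j, p. zc. field. exact M0.
  - rewrite (Key _ _ U V _ _ (expi (((a + b) * z + a * b * tau) / MM))).
    + rewrite PU. ring.
    + unfold U, V, a, b, i, j, p. destruct e; simpl sign_e; simpl shift; rewrite ?half; split; zc; field.
    + rewrite <- expi_add. f_equal. unfold a, b, i, j, p. zc. field. exact M0.
Qed.

Lemma ch_quotient (x : sector) (e : sign) (h : heart) (M : nat) (k1 k2 : Z) : (0 < M)%nat ->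
  exists k : C, k <> 0 /\ forall tau z, regular tau z ->
  ch_ddotH x e h (Z.of_nat M) k1 k2 tau z
  = k * quotient M (sector_p x) (sign_e e) (index_i x h k1 k2) (index_j x h k1 k2) tau z.
Proof.
  intros HM. destruct (denom_numerator x e) as (k & Hk & HD).
  assert (S0 : sgn_eh e h x <> 0).
  { assert (N1 : - (1) <> 0) by (intros E; apply (f_equal Re) in E; simpl in E; lra).
    unfold sgn_eh. destruct e, x, h; apply Cmult_neq_0; try exact N1; apply C1_nz. }
  exists (sgn_eh e h x / k). split.
  - unfold Cdiv. apply Cmult_neq_0; [exact S0|]. intros E.
    pose proof (Cinv_r k Hk) as R1. rewrite E, Cmult_0_r in R1. now apply C1_nz.
  - intros tau z Hz. unfold ch_ddotH, ch_H.
    transitivity ((numer x e h (Z.of_nat M) 0 k1 k2 tau z + sgnC e * numer x e h (Z.of_nat M) 1 k1 k2 tau z)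
       / denom x e tau z); [unfold Cdiv; ring|].
    rewrite numer_numerator, HD by assumption. unfold quotient.
    pose proof (numerator_neq_0 (sector_p x) (sign_e e) tau z Hz). field. auto.
Qed.

(** * Invariance under the modular group *)

Section Span.
Variable S : (C -> C -> C) -> Prop.

Lemma in_span_ext (f g : C -> C -> C) : mero_eq f g -> in_span S g -> in_span S f.
Proof.
  intros E (l & Hl & Hg). exists l. split; [exact Hl|].
  intros tau z Hz. rewrite E by exact Hz. now apply Hg.
Qed.

Lemma lin_comb_app (l1 l2 : list (C * (C -> C -> C))) (tau z : C) :
  lin_comb (l1 ++ l2) tau z = lin_comb l1 tau z + lin_comb l2 tau z.
Proof.
  induction l1 as [|p l1 IH]; unfold lin_comb in *; simpl; [ring|]. rewrite IH. ring.
Qed.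

Lemma lin_comb_scal (k : C) (l : list (C * (C -> C -> C))) (tau z : C) :
  lin_comb (map (fun p => (k * fst p, snd p)) l) tau z = k * lin_comb l tau z.
Proof.
  induction l as [|p l IH]; unfold lin_comb in *; simpl; [ring|]. rewrite IH. ring.
Qed.

Lemma in_span_0 : in_span S (fun _ _ => 0).
Proof. exists nil. split; [constructor|]. intros tau z _. reflexivity. Qed.

Lemma in_span_plus (f g : C -> C -> C) : in_span S f -> in_span S g ->
  in_span S (fun tau z => f tau z + g tau z).
Proof.
  intros (l1 & H1 & E1) (l2 & H2 & E2). exists (l1 ++ l2). split.
  - apply Forall_app. auto.
  - intros tau z Hz. rewrite lin_comb_app, E1, E2 by exact Hz. reflexivity.
Qed.

Lemma in_span_scal (k : C) (f : C -> C -> C) : in_span S f -> in_span S (fun tau z => k * f tau z).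
Proof.
  intros (l & H & E). exists (map (fun p => (k * fst p, snd p)) l). split.
  - apply Forall_map. exact H.
  - intros tau z Hz. rewrite lin_comb_scal, E by exact Hz. reflexivity.
Qed.

Lemma in_span_gen (f : C -> C -> C) : S f -> in_span S f.
Proof.
  intros H. exists ((RtoC 1, f) :: nil). split.
  - constructor; [exact H|constructor].
  - intros tau z _. unfold lin_comb. simpl. ring.
Qed.

Lemma in_span_sumn (f : nat -> C -> C -> C) (n : nat) : (forall k, in_span S (f k)) ->
  in_span S (fun tau z => sumn (fun k => f k tau z) n).
Proof.
  intros H. induction n; simpl; [apply in_span_0|]. now apply in_span_plus.
Qed.

End Span.

(** * The slash action and generation by S and T *)

Lemma automorphy_neq_0 (tau : C) (a b c d : Z) : (0 < Im tau)%R -> (a * d - b * c = 1)%Z ->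
  ZtoC c * tau + ZtoC d <> 0.
Proof.
  intros Ht Hd E. assert (c = 0)%Z.
  { apply (f_equal Im) in E. destruct tau as [x y]. simpl in *.
    apply eq_IZR. replace (IZR c * y + 0 * x + 0)%R with (IZR c * y)%R in E by ring.
    destruct (Rmult_integral _ _ E); [assumption|lra]. }
  subst c. assert (d = 0)%Z; [|lia]. apply ZtoC_inj. change (ZtoC 0) with (RtoC 0) in *. rewrite <- E. ring.
Qed.

Lemma regular_slash (tau z : C) (a b c d : Z) : (a * d - b * c = 1)%Z -> regular tau z ->
  regular ((ZtoC a * tau + ZtoC b) / (ZtoC c * tau + ZtoC d)) (z / (ZtoC c * tau + ZtoC d)).
Proof.
  intros Hd [Ht H]. pose proof (automorphy_neq_0 tau a b c d Ht Hd) as J0. split.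
  - pose proof (Cnorm2_neq0 _ J0) as N. clear H J0. destruct tau as [x y]. simpl in *.
    assert (Q : (0 < (IZR c * x - 0 * y + IZR d) ^ 2 + (IZR c * y + 0 * x + 0) ^ 2)%R).
    { simpl. pose proof (Rle_0_sqr (IZR c * x - 0 * y + IZR d)).
      pose proof (Rle_0_sqr (IZR c * y + 0 * x + 0)). unfold Rsqr in *. simpl in *. lra. }
    assert (D : (IZR a * IZR d - IZR b * IZR c = 1)%R).
    { rewrite <- !mult_IZR, <- minus_IZR, Hd. reflexivity. }
    simpl in Q. match type of Q with (0 < ?q)%R => set (n := q) in * end.
    match goal with |- (0 < ?X)%R => replace X with (y * (IZR a * IZR d - IZR b * IZR c) / n)%R end.
    + rewrite D, Rmult_1_r. now apply Rdiv_lt_0_compat.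
    + unfold n. field. intros E. apply N. refine (eq_trans _ E). unfold n. ring.
  - intros m n E. apply (H (m * d + n * b)%Z (m * c + n * a)%Z). zc.
    replace (2 * z) with (2 * (z / (ZtoC c * tau + ZtoC d)) * (ZtoC c * tau + ZtoC d)) by (field; exact J0).
    rewrite E. field. exact J0.
Qed.

(** The exponents c z^2/(c tau + d) add up under composition. The identity behind this is c + c' J =
    (c a' + d c') j, which uses the determinant of the second matrix. *)
Lemma slash_comp (M : Z) (f : C -> C -> C) (a b c d a' b' c' d' : Z) (tau z : C) :
  (M <> 0)%Z -> (a * d - b * c = 1)%Z -> (a' * d' - b' * c' = 1)%Z -> (0 < Im tau)%R ->
  slash M (slash M f a b c d) a' b' c' d' tau z
  = slash M f (a * a' + b * c') (a * b' + b * d') (c * a' + d * c') (c * b' + d * d') tau z.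
Proof.
  intros HM Hd Hd' Ht. unfold slash.
  pose proof (automorphy_neq_0 tau a' b' c' d' Ht Hd') as J1.
  pose proof (automorphy_neq_0 tau (a * a' + b * c') (a * b' + b * d') (c * a' + d * c') (c * b' + d * d') Ht ltac:(nia)) as J2.
  assert (M0 : ZtoC M <> 0) by (intros K; now apply (ZtoC_inj _ 0) in K).
  assert (D : ZtoC a' * ZtoC d' = 1 + ZtoC b' * ZtoC c').
  { rewrite <- !ZtoC_mult. change (RtoC 1) with (ZtoC 1). rewrite <- ZtoC_plus. f_equal. lia. }
  rewrite !ZtoC_plus, !ZtoC_mult in *.
  set (A := ZtoC a) in *. set (B := ZtoC b) in *. set (Cc := ZtoC c) in *. set (Dd := ZtoC d) in *.
  set (A' := ZtoC a') in *. set (B' := ZtoC b') in *. set (C' := ZtoC c') in *. set (D' := ZtoC d') in *.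
  set (j := C' * tau + D') in *.
  set (J := (Cc * A' + Dd * C') * tau + (Cc * B' + Dd * D')) in *.
  assert (EJ : Cc * ((A' * tau + B') / j) + Dd = J / j).
  { unfold J, j. field. exact J1. }
  rewrite EJ, Cmult_assoc, <- expi_add. f_equal.
  - f_equal.
    assert (X : Cc * (z / j) ^ 2 / (J / j) + C' * z ^ 2 / j = (Cc * A' + Dd * C') * z ^ 2 / J).
    { assert (Y : Cc + C' * J = (Cc * A' + Dd * C') * j).
      { unfold J, j. transitivity (Cc * (1 + B' * C') + C' * ((Cc * A' + Dd * C') * tau + Dd * D')); [ring|].
        rewrite <- D. ring. }
      apply (f_equal (fun y => y * (z ^ 2 / (j * J)))) in Y.
      transitivity ((Cc + C' * J) * (z ^ 2 / (j * J))); [field; auto|]. rewrite Y. field. auto. }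
    rewrite <- X. field. auto.
  - f_equal; [|field; auto].
    transitivity ((A * (A' * tau + B') + B * j) / J); [field; auto|]. f_equal. unfold j. ring.
Qed.

Section Invariance.
Variables (M : Z) (S : (C -> C -> C) -> Prop).
Hypothesis HM : (M <> 0)%Z.

Definition stable (a b c d : Z) : Prop :=
  (a * d - b * c = 1)%Z /\ forall f, in_span S f -> in_span S (slash M f a b c d).

Lemma stable_comp (a b c d a' b' c' d' x y z w : Z) : stable a b c d -> stable a' b' c' d' ->
  x = (a * a' + b * c')%Z -> y = (a * b' + b * d')%Z -> z = (c * a' + d * c')%Z ->
  w = (c * b' + d * d')%Z -> stable x y z w.
Proof.
  intros [D1 H1] [D2 H2] -> -> -> ->. split; [nia|]. intros f Hf.
  apply in_span_ext with (slash M (slash M f a b c d) a' b' c' d').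
  - intros tau t Hz. symmetry. apply slash_comp; auto. apply Hz.
  - auto.
Qed.

Lemma stable_gen (a b c d : Z) : (a * d - b * c = 1)%Z ->
  (forall g, S g -> in_span S (slash M g a b c d)) -> stable a b c d.
Proof.
  intros D H. split; [exact D|]. intros f (l & Hl & E).
  apply in_span_ext with (slash M (lin_comb l) a b c d).
  - intros tau z Hz. unfold slash. f_equal. apply E. now apply regular_slash.
  - clear E. induction Hl as [|p l Hp Hl IH].
    + apply in_span_ext with (fun _ _ => 0); [|apply in_span_0].
      intros tau z _. unfold slash, lin_comb. simpl. ring.
    + apply in_span_ext with (fun tau z => fst p * slash M (snd p) a b c d tau z
         + slash M (lin_comb l) a b c d tau z).
      * intros tau z _. unfold slash, lin_comb. simpl. ring.
      * apply in_span_plus; [|exact IH]. apply in_span_scal. now apply H.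
Qed.

Hypothesis HS : stable 0 (-1) 1 0.
Hypothesis HT : forall n, stable 1 n 0 1.

Lemma stable_minus_1 : stable (-1) 0 0 (-1).
Proof. apply (stable_comp _ _ _ _ _ _ _ _ _ _ _ _ HS HS); reflexivity. Qed.

(* Euclid's algorithm on the bottom row. *)
Lemma stable_all (a b c d : Z) : (a * d - b * c = 1)%Z -> stable a b c d.
Proof.
  remember (Z.to_nat (Z.abs c)) as n eqn:En. revert a b c d En.
  induction n as [n IH] using (well_founded_induction lt_wf). intros a b c d En D.
  destruct (Z.eq_dec c 0) as [->|Hc].
  - assert (Had : (a * d = 1)%Z) by lia.
    destruct (Z.mul_eq_1 a d) as [->| ->]; [lia| |].
    + replace d with 1%Z by lia. apply HT.
    + replace d with (-1)%Z by lia.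
      apply (stable_comp _ _ _ _ _ _ _ _ _ _ _ _ stable_minus_1 (HT (- b))); lia.
  - set (q := (d / c)%Z). set (r := (d - c * q)%Z).
    assert (Hr : (Z.abs r < Z.abs c)%Z).
    { unfold r, q. pose proof (Z.mod_eq d c Hc). rewrite <- H. apply Z.mod_bound_abs. exact Hc. }
    (* The matrix (a b; c d) is the product of (b - q a, -a; r, -c), S, -1 and the translation by q;
       the first factor has the smaller lower left entry r. *)
    assert (I1 : stable (b - q * a) (- a) r (- c)).
    { apply (IH (Z.to_nat (Z.abs r))); [lia|reflexivity|]. unfold r. nia. }
    pose proof (stable_comp _ _ _ _ _ _ _ _ _ _ _ _ I1 HS eq_refl eq_refl eq_refl eq_refl) as I2.
    pose proof (stable_comp _ _ _ _ _ _ _ _ _ _ _ _ I2 stable_minus_1 eq_refl eq_refl eq_refl eq_refl) as I3.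
    apply (stable_comp _ _ _ _ _ _ _ _ _ _ _ _ I3 (HT q)); unfold r; ring.
Qed.

End Invariance.

(** * The index sets represent all pairs (i, j) *)

Section Coverage.
Variables (M : nat) (p e : Z).
Hypothesis HM : (0 < M)%nat.

Definition prop_quotient (i j i' j' : Z) : Prop :=
  exists k : C, forall tau z, regular tau z -> quotient M p e i j tau z = k * quotient M p e i' j' tau z.

Lemma prop_quotient_trans (i j i' j' i'' j'' : Z) :
  prop_quotient i j i' j' -> prop_quotient i' j' i'' j'' -> prop_quotient i j i'' j''.
Proof.
  intros [k H] [k' H']. exists (k * k'). intros tau z Hz. rewrite H, H' by exact Hz. ring.
Qed.

Lemma prop_quotient_sym (i j : Z) : prop_quotient i j j i.
Proof. exists 1. intros tau z _. unfold quotient. rewrite numerator_sym. ring. Qed.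

Lemma prop_quotient_shift (i j i' : Z) (t : Z) : (i = i' + Z.of_nat M * t)%Z -> prop_quotient i j i' j.
Proof.
  intros ->. exists (expi (- (ZtoC e / 2 * ZtoC t))). intros tau z Hz. unfold quotient.
  replace (numerator M p e (i' + Z.of_nat M * t) j tau z)
    with (expi (- (ZtoC e / 2 * ZtoC t)) * numerator M p e i' j tau z); [unfold Cdiv; ring|].
  revert t. apply Z_ind_step.
  - rewrite Z.mul_0_r, Z.add_0_r. change (ZtoC 0) with (RtoC 0).
    rewrite Cmult_0_r, Copp_0, expi_0. ring.
  - intros k. replace (i' + Z.of_nat M * (k + 1))%Z with (i' + Z.of_nat M * k + Z.of_nat M)%Z by ring.
    rewrite numerator_add_M by assumption.
    replace (- (ZtoC e / 2 * ZtoC (k + 1))) with (- (ZtoC e / 2) + - (ZtoC e / 2 * ZtoC k)) by (zc; ring).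
    rewrite (expi_add (- (ZtoC e / 2))), <- Cmult_assoc.
    pose proof (expi_neq_0 (- (ZtoC e / 2))) as E0. split; intros E.
    + now rewrite E.
    + apply (f_equal (fun X => / expi (- (ZtoC e / 2)) * X)) in E.
      rewrite !Cmult_assoc, Cinv_l, !Cmult_1_l in E by exact E0. exact E.
Qed.

Lemma prop_quotient_shift_r (i j j' : Z) (t : Z) : (j = j' + Z.of_nat M * t)%Z -> prop_quotient i j i j'.
Proof.
  intros H. eapply prop_quotient_trans; [apply prop_quotient_sym|].
  eapply prop_quotient_trans; [apply (prop_quotient_shift _ _ _ t H)|apply prop_quotient_sym].
Qed.

Lemma prop_quotient_reflect (i j : Z) : prop_quotient i j (j + Z.of_nat M) (i - Z.of_nat M).
Proof.
  eapply prop_quotient_trans; [apply prop_quotient_sym|].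
  eapply prop_quotient_trans; [apply (prop_quotient_shift _ _ (j + Z.of_nat M) (-1)); ring|].
  apply (prop_quotient_shift_r _ _ _ 1). ring.
Qed.

Lemma coverage (x : sector) (i j : Z) : exists h k1 k2, index_set h (Z.of_nat M) k1 k2 /\
  prop_quotient i j (index_i x h k1 k2) (index_j x h k1 k2).
Proof.
  assert (P : (0 < Z.of_nat M)%Z) by lia.
  (* Modulo M and up to reflection, the indices form the triangle [k + l <= M - 1];
     the types I and III are its two halves. *)
  set (I0 := fun k l : Z => match x with Untw => l | Tw => - k end%Z).
  set (J0 := fun k l : Z => match x with Untw => - k - 1 | Tw => l + 1 end%Z).
  assert (A : forall k l, (0 <= k)%Z -> (0 <= l)%Z -> (k + l <= Z.of_nat M - 1)%Z ->
    exists h k1 k2, index_set h (Z.of_nat M) k1 k2 /\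
      prop_quotient (I0 k l) (J0 k l) (index_i x h k1 k2) (index_j x h k1 k2)).
  (* Here k1 is the minimum of k and l and k2 = |k - l|, so 2 k1 + k2 = k + l. The diagonal has k2 =
     0 and must go to type I. *)
  { intros k l Hk Hl Hkl. unfold I0, J0. destruct x, (Z_le_gt_dec k l) as [L|L].
    - destruct (Z.eq_dec k l) as [->|N].
      + exists TypeI, l, 0%Z. split; [unfold index_set; lia|]. unfold index_i, index_j. replace (- l - 0 - 1)%Z with (- l - 1)%Z by ring.
        apply (prop_quotient_shift _ _ _ 0). ring.
      + exists TypeIII, k, (l - k)%Z. split; [unfold index_set; lia|]. unfold index_i, index_j. replace (k + (l - k))%Z with l by ring.
        apply prop_quotient_sym.
    - exists TypeI, l, (k - l)%Z. split; [unfold index_set; lia|]. unfold index_i, index_j. replace (- l - (k - l) - 1)%Z with (- k - 1)%Z by ring.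
      apply (prop_quotient_shift _ _ _ 0). ring.
    - exists TypeI, k, (l - k)%Z. split; [unfold index_set; lia|]. unfold index_i, index_j. replace (k + (l - k) + 1)%Z with (l + 1)%Z by ring.
      apply (prop_quotient_shift _ _ _ 0). ring.
    - exists TypeIII, l, (k - l)%Z. split; [unfold index_set; lia|]. unfold index_i, index_j. replace (- l - (k - l))%Z with (- k)%Z by ring.
      apply prop_quotient_sym. }
  (* The reflection (k, l) -> (M - 1 - l, M - 1 - k) carries the part k + l >= M of the square into
     the triangle. *)
  assert (B : forall k l, (0 <= k < Z.of_nat M)%Z -> (0 <= l < Z.of_nat M)%Z ->
    exists h k1 k2, index_set h (Z.of_nat M) k1 k2 /\
      prop_quotient (I0 k l) (J0 k l) (index_i x h k1 k2) (index_j x h k1 k2)).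
  { intros k l Hk Hl. destruct (Z_le_gt_dec (k + l) (Z.of_nat M - 1)) as [L|L]; [apply A; lia|].
    destruct (A (Z.of_nat M - 1 - l)%Z (Z.of_nat M - 1 - k)%Z) as (h & k1 & k2 & H1 & H2); try lia.
    exists h, k1, k2. split; [exact H1|]. eapply prop_quotient_trans; [|exact H2].
    unfold I0, J0. destruct x.
    - replace (Z.of_nat M - 1 - k)%Z with (- k - 1 + Z.of_nat M)%Z by ring.
      replace (- (Z.of_nat M - 1 - l) - 1)%Z with (l - Z.of_nat M)%Z by ring. apply prop_quotient_reflect.
    - replace (- (Z.of_nat M - 1 - l))%Z with (l + 1 - Z.of_nat M)%Z by ring.
      replace (Z.of_nat M - 1 - k + 1)%Z with (- k + Z.of_nat M)%Z by ring.
      eapply prop_quotient_trans; [apply prop_quotient_sym|].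
      eapply prop_quotient_trans; [apply prop_quotient_reflect|apply prop_quotient_sym]. }
  set (k := match x with Untw => (- j - 1) mod Z.of_nat M | Tw => (- i) mod Z.of_nat M end%Z).
  set (l := match x with Untw => i mod Z.of_nat M | Tw => (j - 1) mod Z.of_nat M end%Z).
  destruct (B k l) as (h & k1 & k2 & H1 & H2).
  { unfold k. destruct x; apply Z.mod_pos_bound, P. }
  { unfold l. destruct x; apply Z.mod_pos_bound, P. }
  exists h, k1, k2. split; [exact H1|]. eapply prop_quotient_trans; [|exact H2].
  unfold I0, J0, k, l. destruct x.
  - eapply prop_quotient_trans; [apply (prop_quotient_shift _ _ (i mod Z.of_nat M) (i / Z.of_nat M))|].
    { rewrite (Z.div_mod i (Z.of_nat M)) at 1 by lia. ring. }
    apply (prop_quotient_shift_r _ _ _ (- ((- j - 1) / Z.of_nat M))).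
    pose proof (Z.div_mod (- j - 1) (Z.of_nat M) ltac:(lia)). lia.
  - eapply prop_quotient_trans; [apply (prop_quotient_shift _ _ (- ((- i) mod Z.of_nat M)) (- ((- i) / Z.of_nat M)))|].
    { pose proof (Z.div_mod (- i) (Z.of_nat M) ltac:(lia)). lia. }
    apply (prop_quotient_shift_r _ _ _ ((j - 1) / Z.of_nat M)).
    pose proof (Z.div_mod (j - 1) (Z.of_nat M) ltac:(lia)). lia.
Qed.

End Coverage.

(** A is a set of characteristics; the last two hypotheses are its closure under S, which exchanges
    p and e, and under tau -> tau + n, which adds p n to e modulo 2. *)
Lemma span_invariant (M : nat) (S : (C -> C -> C) -> Prop) (A : sector -> sign -> Prop) :
  (0 < M)%nat ->
  (forall f, S f <-> exists x e h k1 k2, A x e /\ index_set h (Z.of_nat M) k1 k2 /\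
     f = ch_ddotH x e h (Z.of_nat M) k1 k2) ->
  (forall x e, A x e -> exists x' e', A x' e' /\ sector_p x' = sign_e e /\ sign_e e' = sector_p x) ->
  (forall x e n, A x e -> exists e' t, A x e' /\ (sign_e e + sector_p x * n = sign_e e' + 2 * t)%Z) ->
  SL2Z_invariant_span (Z.of_nat M) S.
Proof.
  intros HM HS AS AT.
  assert (M0 := ZtoC_nat_neq_0 M HM).
  (* All index pairs have to be covered, since the S-transform of a single quotient involves every
     pair (d, c). *)
  assert (Q : forall x e i j, A x e -> in_span S (quotient M (sector_p x) (sign_e e) i j)).
  { intros x e i j Hxe. destruct (coverage M (sector_p x) (sign_e e) HM x i j) as (h & k1 & k2 & Hk & [k E]).
    destruct (ch_quotient x e h M k1 k2 HM) as (k' & Hk' & E').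
    apply in_span_ext with (fun tau z => k / k' * ch_ddotH x e h (Z.of_nat M) k1 k2 tau z).
    - intros tau z Hz. rewrite E, E' by exact Hz. field. exact Hk'.
    - apply in_span_scal, in_span_gen, HS. exists x, e, h, k1, k2. auto. }
  assert (G : forall a b c d, (a * d - b * c = 1)%Z ->
    (forall x e i j, A x e -> in_span S (slash (Z.of_nat M) (quotient M (sector_p x) (sign_e e) i j) a b c d)) ->
    stable (Z.of_nat M) S a b c d).
  { intros a b c d D H. apply stable_gen; [exact D|]. intros g Hg. apply HS in Hg.
    destruct Hg as (x & e & h & k1 & k2 & Hxe & _ & ->).
    destruct (ch_quotient x e h M k1 k2 HM) as (k & _ & E).
    apply in_span_ext with (fun tau z => k * slash (Z.of_nat M)
      (quotient M (sector_p x) (sign_e e) (index_i x h k1 k2) (index_j x h k1 k2)) a b c d tau z).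
    - intros tau z Hz. unfold slash. rewrite E by now apply regular_slash. ring.
    - apply in_span_scal. now apply H. }
  intros f Hf a b c d D. apply stable_all; [lia| | |exact D|exact Hf].
  - apply G; [reflexivity|]. intros x e i j Hxe.
    destruct (AS x e Hxe) as (x' & e' & Hxe' & Ex & Ee).
    apply in_span_ext with (fun tau z => sumn (fun d => sumn (fun c =>
      S_coef M (sector_p x) (sign_e e) i j d c / (NtoC M * S_coef 1 (sector_p x) (sign_e e) 0 0 0 0)
      * quotient M (sector_p x') (sign_e e') (Z.of_nat d) (Z.of_nat c) tau z) M) M).
    + intros tau z Hz. rewrite Ex, Ee, <- quotient_S by assumption.
      pose proof (tau_neq_0 tau (proj1 Hz)) as T0.
      unfold slash. zc.
      replace (1 * tau + 0) with tau by ring.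
      f_equal; [f_equal; field; auto|]. f_equal.
      f_equal. apply C_ext; simpl; ring.
    + apply in_span_sumn. intros d'. apply in_span_sumn. intros c'. apply in_span_scal. now apply Q.
  - intros n. apply G; [ring|]. intros x e i j Hxe.
    destruct (AT x e n Hxe) as (e' & t & Hxe' & Et).
    apply in_span_ext with (fun tau z =>
     expi ((ZtoC i + ZtoC (sector_p x) / 2) * (ZtoC j + ZtoC (sector_p x) / 2) * ZtoC n / NtoC M
       - ZtoC (sector_p x) / 2 * (ZtoC (sector_p x) / 2) * ZtoC n)
     * quotient M (sector_p x) (sign_e e') i j tau z).
    + intros tau z Hz. unfold slash. zc.
      replace (0 * tau + 1) with (RtoC 1) by ring.
      replace ((1 * tau + ZtoC n) / 1) with (tau + ZtoC n) by field.
      replace (z / 1) with z by field.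
      rewrite quotient_T, Et by assumption.
      unfold quotient. rewrite !numerator_e_mod_2 by (auto with arith; apply Hz).
      replace (- ((1 - NtoC M) / NtoC M * (0 * z ^ 2 / 1))) with (RtoC 0) by (field; exact M0).
      rewrite expi_0. ring.
    + apply in_span_scal. now apply Q.
Qed.

Theorem theorem11p1 (M : Z) (hM : (0 < M)%Z) :
  SL2Z_invariant_span M
    (fun f => exists (h : heart) (k1 k2 : Z), index_set h M k1 k2 /\
       (f = ch_ddotH Untw Plus h M k1 k2
        \/ f = ch_ddotH Untw Minus h M k1 k2
        \/ f = ch_ddotH Tw Plus h M k1 k2))
  /\
  SL2Z_invariant_span M
    (fun f => exists (h : heart) (k1 k2 : Z), index_set h M k1 k2 /\
       f = ch_ddotH Tw Minus h M k1 k2).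
Proof.
  rewrite <- (Z2Nat.id M) by lia. set (m := Z.to_nat M).
  assert (Hm : (0 < m)%nat) by (unfold m; lia). clearbody m. clear M hM.
  assert (T : forall x e n, exists e' t, (sign_e e + sector_p x * n = sign_e e' + 2 * t)%Z).
  { intros x e n. pose proof (Z.div_mod (sign_e e + sector_p x * n) 2 ltac:(lia)) as D.
    pose proof (Z.mod_pos_bound (sign_e e + sector_p x * n) 2 ltac:(lia)) as B.
    set (r := ((sign_e e + sector_p x * n) mod 2)%Z) in *.
    exists (if Z.eq_dec r 0 then Minus else Plus), ((sign_e e + sector_p x * n) / 2)%Z.
    destruct Z.eq_dec; simpl (sign_e Minus); simpl (sign_e Plus); lia. }
  split.
  - apply (span_invariant m _ (fun x e => match x, e with Tw, Minus => False | _, _ => True end) Hm).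
    + intros f. split.
      * intros (h & k1 & k2 & Hk & [-> | [-> | ->]]);
          [exists Untw, Plus|exists Untw, Minus|exists Tw, Plus]; exists h, k1, k2; auto.
      * intros (x & e & h & k1 & k2 & Hxe & Hk & ->). exists h, k1, k2. split; [exact Hk|].
        destruct x, e; tauto.
    + intros [] [] H; try contradiction.
      * exists Untw, Plus. auto.
      * exists Tw, Plus. auto.
      * exists Untw, Minus. auto.
    + intros x e n H. destruct (T x e n) as (e' & t & E). exists e', t. split; [|exact E].
      (* In the twisted sector p = 0, so the parity of e is kept and the sign cannot become
         [Minus]. *)
      destruct x, e, e'; cbn [sign_e sector_p] in *; auto; lia.
  - apply (span_invariant m _ (fun x e => match x, e with Tw, Minus => True | _, _ => False end) Hm).
    + intros f. split.
      * intros (h & k1 & k2 & Hk & ->). exists Tw, Minus, h, k1, k2. auto.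
      * intros (x & e & h & k1 & k2 & Hxe & Hk & ->). exists h, k1, k2. split; [exact Hk|].
        destruct x, e; tauto.
    + intros [] [] H; try contradiction. exists Tw, Minus. auto.
    + intros x e n H. destruct (T x e n) as (e' & t & E). exists e', t. split; [|exact E].
      destruct x, e, e'; cbn [sign_e sector_p] in *; auto; lia.
Qed.
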